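(* Let $j\ge 1$ be an integer. For $\gamma\in\mathcal{M}_{n+1,n}$ with isotropic moving frame $g$ and isotropic curvature $u$: (B-type) $g\,P_{2j-1,0}(u)\,e_1$ is tangent to $\mathcal{M}_{n+1,n}$ at $\gamma$; thus $\gamma_t=g\,P_{2j-1,0}(u)\,e_1$ is an isotropic curve flow on $\mathcal{M}_{n+1,n}$. (A-type) If $2j-1\not\equiv 0\pmod{2n+1}$, then $g\,S_{2j-1,0}(u)\,e_1$ is tangent to $\mathcal{M}_{n+1,n}$ at $\gamma$; thus $\gamma_t=g\,S_{2j-1,0}(u)\,e_1$ is an isotropic curve flow on $\mathcal{M}_{n+1,n}$.
   Context: Let $n\ge 1$, let $e_{i,j}$ be the $(2n+1)\times(2n+1)$ elementary matrices, $C_n=\sum_{i=1}^{2n+1}(-1)^{n+i-1}e_{i,2n+2-i}$, $\mathbb{R}^{n+1,n}=\mathbb{R}^{2n+1}$ with $\langle X,Y\rangle=X^tC_nY$, $O(n+1,n)=\{A: A^tC_nA=C_n\}$ with Lie algebra $o(n+1,n)$, and $e_1=(1,0,\dots,0)^t$. Put $b=\sum_{i=1}^{2n}e_{i+1,i}$, $\beta_i=e_{n+1-i,n+i}+e_{n+2-i,n+1+i}$, $V_n=\bigoplus_{i=1}^n\mathbb{R}\beta_i$. For matrix functions, $[\partial_x+A,B]=B_x+[A,B]$. Curves. A smooth $\gamma:\mathbb{R}\to\mathbb{R}^{n+1,n}$ is isotropic if $\gamma,\gamma_s,\dots,\gamma_s^{(2n)}$ are linearly independent and $\gamma,\dots,\gamma_s^{(n-1)}$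 span a maximal isotropic subspace for every $s$. $\mathcal{M}_{n+1,n}$ is the set of isotropic curves with $\langle\gamma_x^{(n)},\gamma_x^{(n)}\rangle\equiv1$. The isotropic moving frame of $\gamma\in\mathcal{M}_{n+1,n}$ is the unique smooth $g:\mathbb{R}\to O(n+1,n)$ whose $i$-th column is $\gamma_x^{(i-1)}$ for $1\le i\le n+1$ and with $u=g^{-1}g_x-b\in C^\infty(\mathbb{R},V_n)$; $u$ is the isotropic curvature. A tangent vector at $\gamma$ is $\frac{d}{d\epsilon}|_{\epsilon=0}\gamma_\epsilon$ for a smooth one-parameter family $\gamma_\epsilon$ in $\mathcal{M}_{n+1,n}$ with $\gamma_0=\gamma$. An isotropic curve flow is an evolution equation $\gamma_t=g\,\xi(u)$ on $\mathcal{M}_{n+1,n}$ (so $g\,\xi(u)$ is tangent to $\mathcal{M}_{n+1,n}$), where $\xi(u)$ is an $\mathbb{R}^{2n+1}$-valued differential polynomial of $u$ in $x$. B-type. $\hat B_n^{(1)}$ is the algebra of formal series $\sum_{i\le m_0}\xi_i\lambda^i$, $\xi_i\in o(n+1,n)$. Let $\beta=\frac12(e_{1,2n}+e_{2,2n+1})$, $J_B=b+\beta\lambda$; then $J_B^{2n+1}=\lambda J_B$. For $u\in C^\infty(\mathbb{R},V_n)$, $P(u,\lambda)$ is the unique $\hat B_n^{(1)}$-valued function of $x$ with $[\partial_x+J_B+u,P(u,\lambda)]=0$ that is conjugate to $J_B$ (in particular $P^{2n+1}=\lambda P$) and has leading term $J_B$, i.e. $P-J_B$ contains only terms of degree $\le0$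 when $e_{i,j}\lambda^k$ has degree $i-j+2nk$. Write $P^{2j-1}(u,\lambda)=\sum_iP_{2j-1,i}(u)\lambda^i$; the $P_{2j-1,i}(u)$ are differential polynomials in $u$. A-type. $\hat A_{2n}^{(2)}$ is the algebra of formal series $\xi(\lambda)=\sum_{i\le m_0}\xi_i\lambda^i$, $\xi_i\in sl(2n+1,\mathbb{R})$, with $C_n\xi(-\lambda)^tC_n+\xi(\lambda)=0$. Let $J=b+e_{1,2n+1}\lambda$; then $J^{2n+1}=\lambda I$. $S(u,\lambda)$ is the unique $\hat A_{2n}^{(2)}$-valued function of $x$ with $[\partial_x+J+u,S(u,\lambda)]=0$ that is conjugate to $J$ (in particular $S^{2n+1}=\lambda I$) and has leading term $J$, i.e. $S-J$ contains only terms of degree $\le0$ when $e_{i,j}\lambda^k$ has degree $i-j+(2n+1)k$. Write $S^{2j-1}(u,\lambda)=\sum_iS_{2j-1,i}(u)\lambda^i$; the $S_{2j-1,i}(u)$ are differential polynomials in $u$. *)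

(* Defs.v *)
From mathcomp Require Import all_boot all_order all_algebra.
From mathcomp Require Import all_classical all_reals all_analysis.

Set Implicit Arguments.
Unset Strict Implicit.
Unset Printing Implicit Defensive.
Import Order.TTheory GRing.Theory Num.Theory.
Import numFieldNormedType.Exports.
Local Open Scope ring_scope.
Local Open Scope classical_set_scope.

Notation mat R n := 'M[R]_((2 * n).+1).
Notation vec R n := 'cV[R]_((2 * n).+1).

(* C^oo for maps on a finite-dimensional space: every iterated directional
   derivative exists and is (Frechet) differentiable everywhere. *)
Definition smooth (R : realType) (V W : normedModType R) (f : V -> W) : Prop :=
  forall (vs : seq V) (x : V),
    differentiable (foldr (fun v (h : V -> W) => 'D_v h) f vs) x.

Section Geometry.
Variables (R : realType) (n : nat).

(* Indices of elementary matrices are 1-based; inord is only used in range. *)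
Definition e_ (i j : nat) : mat R n := delta_mx (inord i.-1) (inord j.-1).
Definition e1 : vec R n := delta_mx ord0 ord0.

Definition C_ : mat R n :=
  \sum_(1 <= i < (2 * n).+2) (-1) ^+ (n + i - 1) *: e_ i (2 * n + 2 - i).

Definition inner (X Y : vec R n) : R := (X^T *m C_ *m Y) ord0 ord0.

Definition in_O (A : mat R n) : Prop := A^T *m C_ *m A = C_.
Definition in_o (A : mat R n) : Prop := A^T *m C_ + C_ *m A = 0.

Definition b_ : mat R n := \sum_(1 <= i < (2 * n).+1) e_ i.+1 i.

Definition beta_ (i : nat) : mat R n :=
  e_ (n + 1 - i) (n + i) + e_ (n + 2 - i) (n + 1 + i).

Definition in_V (A : mat R n) : Prop :=
  exists c : nat -> R, A = \sum_(1 <= i < n.+1) c i *: beta_ i.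

Definition smooth_V (u : R -> mat R n) : Prop :=
  smooth u /\ forall x, in_V (u x).

Definition isotropic_subspace (W : {vspace vec R n}) : Prop :=
  forall X Y, X \in W -> Y \in W -> inner X Y = 0.

Definition maximal_isotropic (W : {vspace vec R n}) : Prop :=
  isotropic_subspace W /\
  forall W' : {vspace vec R n},
    isotropic_subspace W' -> (W <= W')%VS -> W' = W.

Definition jet (gamma : R -> vec R n) (k : nat) (s : R) : seq (vec R n) :=
  [seq derive1n i gamma s | i <- iota 0 k].

Definition isotropic_curve (gamma : R -> vec R n) : Prop :=
  smooth gamma /\
  forall s, free (jet gamma (2 * n).+1 s) /\
            maximal_isotropic <<jet gamma n s>>%VS.

(* The space M_{n+1,n}. *)
Definition in_M (gamma : R -> vec R n) : Prop :=
  isotropic_curve gamma /\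
  forall x, inner (derive1n n gamma x) (derive1n n gamma x) = 1.

Definition curvature (g : R -> mat R n) (x : R) : mat R n :=
  invmx (g x) *m derive1 g x - b_.

Definition moving_frame (gamma : R -> vec R n) (g : R -> mat R n) : Prop :=
  [/\ smooth g, forall x, in_O (g x),
      forall i : nat, (1 <= i <= n.+1)%N ->
        forall x, col (inord i.-1) (g x) = derive1n i.-1 gamma x
    & smooth_V (curvature g)].

(* A family is a smooth function of (eps, x) defined for all eps; restricting
   eps to an interval around 0 gives the same tangent vectors, since such an
   interval can be reparametrized by R with unit speed at 0. *)
Definition tangent (gamma v : R -> vec R n) : Prop :=
  exists Gamma : R * R -> vec R n,
    [/\ smooth Gamma,
        forall eps, in_M (fun x => Gamma (eps, x)),
        forall x, Gamma (0, x) = gamma x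
      & forall x, v x = derive1 (fun eps => Gamma (eps, x)) 0].

(* Differential polynomials with real coefficients in the entries of u.  For u
   valued in V_n these entries are 0 or coordinates of u in the basis beta_i,
   and each coordinate is an entry. *)
Inductive dpoly : Type :=
| DConst of R
| DVar of 'I_(2 * n).+1 & 'I_(2 * n).+1 & nat
| DAdd of dpoly & dpoly
| DMul of dpoly & dpoly.

Fixpoint deval (p : dpoly) (u : R -> mat R n) (x : R) : R :=
  match p with
  | DConst c => c
  | DVar i j k => (derive1n k u x) i j
  | DAdd p q => deval p u x + deval q u x
  | DMul p q => deval p u x * deval q u x
  end.

Definition differential_polynomial
    (xi : (R -> mat R n) -> R -> vec R n) : Prop :=
  exists p : 'I_(2 * n).+1 -> dpoly,
    forall u, smooth_V u -> forall x, xi u x = \col_i deval (p i) u x.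

(* The evolution equation gamma_t = g xi(u) is an isotropic curve flow. *)
Definition isotropic_curve_flow
    (xi : (R -> mat R n) -> R -> vec R n) : Prop :=
  differential_polynomial xi /\
  forall gamma g, in_M gamma -> moving_frame gamma g ->
    tangent gamma (fun x => g x *m xi (curvature g) x).

(* The formal series \sum_k xi_k lambda^k is represented by k |-> xi k. *)
Definition lseries := int -> mat R n.

Definition bounded_degree (xi : lseries) : Prop :=
  exists m0 : int, forall k, m0 < k -> xi k = 0.

(* If xi and eta are bounded in degree, the sum has finite support. *)
Definition smul (xi eta : lseries) : lseries :=
  fun k => \sum_(i \in [set: int]) (xi i *m eta (k - i)).

Definition smonom (A : mat R n) (m : int) : lseries :=
  fun k => if k == m then A else 0.

Definition sone : lseries := smonom 1%:M 0.

Definition spow (xi : lseries) (m : nat) : lseries := iter m (smul xi) sone.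

(* Conjugate under the invertible matrices over R((lambda^-1)). *)
Definition lconjugate (xi eta : lseries) : Prop :=
  exists T T' : lseries,
    [/\ bounded_degree T, bounded_degree T', smul T T' = sone, smul T' T = sone
      & xi = smul (smul T eta) T'].

(* e_{i,j} lambda^k has degree i - j + h k. *)
Definition degree_le0 (h : nat) (xi : lseries) : Prop :=
  forall k (i j : 'I_(2 * n).+1),
    xi k i j != 0 -> i%:Z - j%:Z + h%:Z * k <= 0.

(* [d/dx + A, Q] = 0, coefficientwise, for series-valued functions of x. *)
Definition commutes_with_dx (A Q : R -> lseries) : Prop :=
  forall x k,
    derive1 (fun y => Q y k) x + (smul (A x) (Q x) k - smul (Q x) (A x) k) = 0.

Definition in_B (xi : lseries) : Prop :=
  bounded_degree xi /\ forall k, in_o (xi k).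

Definition JB : lseries := fun k =>
  smonom b_ 0 k + smonom (2^-1 *: (e_ 1 (2 * n) + e_ 2 (2 * n + 1))) 1 k.

(* The second equation is the coefficient of lambda^k in
   C_n xi(-lambda)^t C_n + xi(lambda) = 0. *)
Definition in_A (xi : lseries) : Prop :=
  bounded_degree xi /\
  forall k, \tr (xi k) = 0 /\ C_ *m ((-1) ^ k *: xi k)^T *m C_ + xi k = 0.

Definition JA : lseries := fun k =>
  smonom b_ 0 k + smonom (e_ 1 (2 * n + 1)) 1 k.

Definition resolvent (L : lseries -> Prop) (J : lseries) (h : nat)
    (u : R -> mat R n) (Q : R -> lseries) : Prop :=
  [/\ forall x, L (Q x),
      forall k, smooth (fun x => Q x k),
      commutes_with_dx (fun x k => J k + smonom (u x) 0 k) Q,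
      forall x, lconjugate (Q x) J
    & forall x, degree_le0 h (fun k => Q x k - J k)].

(* is_P u Q: Q is P(u, lambda);  is_S u Q: Q is S(u, lambda). *)
Definition is_P := resolvent in_B JB (2 * n).
Definition is_S := resolvent in_A JA (2 * n + 1).

End Geometry.

Arguments e1 {R n}.

(* Main.v *)
From HB Require Import structures.
Require Import Defs.
From mathcomp Require Import all_boot all_order all_algebra.
From mathcomp Require Import all_classical all_reals all_analysis.
From mathcomp Require Import ring lra zify.
Set Implicit Arguments.
Unset Strict Implicit.
Unset Printing Implicit Defensive.
Import Order.TTheory GRing.Theory Num.Theory.
Import numFieldNormedType.Exports.
Local Open Scope ring_scope.
Local Open Scope classical_set_scope.

(** Let [Q] be the resolvent and [r] its power of exponent [2j-1], with
    coefficients [r_k]. The exponent is odd, so the symmetry that defines the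
    loop algebra passes from [Q] to [r]; in particular [r_0] takes values in
    [o(n+1,n)]. Write [J = b + be lambda]. As [r] commutes with
    [d/dx + J + u], its coefficient of degree 0 satisfies
    [r_0' + [b + u, r_0] = [r_(-1), be]], and the right-hand side turns out to
    be upper triangular.

    Drinfeld-Sokolov gauge fixing ([gauge_fix]) provides a strictly upper
    triangular [eta] such that [K = r_0 - eta] satisfies
    [K' + [b + u, K] = w] with [w] valued in [V_n]. Since [eta e_1 = 0], the
    vector field of the theorem is [g K e_1]. The equation for [K] is the
    linearization of [g^-1 g_x = b + u], and it is integrated as follows
    ([tangent_of_gauge]): for each [eps], let [h_eps] solve
    [h' = h (b + u + eps w)] with a suitable initial value in [O(n+1,n)]. The
    curves [h_eps e_1] belong to [M_{n+1,n}] ([frame_in_M]), and their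
    [eps]-derivative at 0 is [g K e_1]. With [h_eps = Z g] and
    [W = g w g^-1] the equation becomes [Z_x = eps Z W]. Its solution is a
    power series in [eps] whose coefficients are iterated integrals in [x]; a
    class of such series that is stable under both partial derivatives shows
    that the solution is smooth in [(eps, x)].

    That [r_0 e_1] is a differential polynomial does not follow from the
    existence of [Q], but from the equations that determine it. Put [X = Q - J]
    and grade by the degree of the statement. The resolvent satisfies
    [f(Q) = 0] for [f(z) = z^(2n+1) - lambda z] (B-type) or
    [z^(2n+1) - lambda] (A-type), because [J] does. The commutation relation
    determines [Q X - X J] in terms of [u], [X] and [X'], with one more
    homogeneous component than is known of [X]. Up to such commutators,
    [f(Q) - f(J)] is [X f'(J)]; as [f] is separable, [f'(J)] is invertible,
    and one more component of [X] is determined ([known_X]). *)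

(** * Calculus of smooth functions *)

Section Smooth.
Variables (R : realType).
Implicit Types (V W : normedModType R).

(** This avoids formulas for iterated derivatives: to prove smoothness it is
    enough to exhibit a class of functions stable under one differentiation. *)
Lemma smooth_coind V W (P : (V -> W) -> Prop) :
  (forall f x, P f -> differentiable f x) ->
  (forall f v, P f -> P ('D_v f)) -> forall f, P f -> smooth f.
Proof.
move=> Pdiff PD f Pf vs x; apply: Pdiff.
by elim: vs => [//|v vs IH] /=; apply: PD.
Qed.

Lemma smooth_differentiable V W (f : V -> W) x : smooth f -> differentiable f x.
Proof. by move=> /(_ [::] x). Qed.

Lemma smooth_derive V W (f : V -> W) v : smooth f -> smooth ('D_v f).
Proof.
by move=> fs vs x; have := fs (rcons vs v) x; rewrite foldr_rcons.
Qed.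

Lemma smooth_derivable V W (f : V -> W) x v : smooth f -> derivable f x v.
Proof. by move=> fs; apply/diff_derivable/smooth_differentiable. Qed.

(** By the Leibniz rule the algebra generated by the smooth functions is stable
    under derivatives, which a set of single products is not. *)
Inductive smooth_alg V : (V -> R) -> Prop :=
| SmoothGen f : smooth (f : V -> R) -> smooth_alg f
| SmoothAdd f g : smooth_alg f -> smooth_alg g -> smooth_alg (f \+ g)
| SmoothMul f g : smooth_alg f -> smooth_alg g -> smooth_alg (f \* g).

Lemma smooth_algW V (f : V -> R) : smooth_alg f -> smooth f.
Proof.
apply: (smooth_coind (P := @smooth_alg V)) => {f}.
  move=> f x; elim=> [g gs|g h _ dg _ dh|g h _ dg _ dh].
  - exact: smooth_differentiable.
  - exact: differentiableD.
  - exact: differentiableM.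
have dif g : smooth_alg g -> forall x, differentiable g x.
  elim=> [{}g gs|{}g h _ dg _ dh|{}g h _ dg _ dh] x.
  - exact: smooth_differentiable.
  - exact: differentiableD.
  - exact: differentiableM.
move=> f v; elim=> [g gs|g h ag dg ah dh|g h ag dg ah dh].
- exact/SmoothGen/smooth_derive.
- have -> : 'D_v (g \+ h) = 'D_v g \+ 'D_v h.
    by apply/funext => x; rewrite deriveD //; exact/diff_derivable/dif.
  exact: SmoothAdd.
- have -> : 'D_v (g \* h) = (g \* 'D_v h) \+ (h \* 'D_v g).
    by apply/funext => x; rewrite deriveM //; exact/diff_derivable/dif.
  by apply: SmoothAdd; apply: SmoothMul.
Qed.

Lemma smooth_cst V W (c : W) : smooth (fun _ : V => c).
Proof.
apply: (smooth_coind (P := fun f : V -> W => exists c, f = cst c)); last by exists c.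
  by move=> f x [a ->]; exact: differentiable_cst.
move=> f v [a ->]; exists 0; apply/funext => x; exact: derive_cst.
Qed.

Lemma smoothD V (f g : V -> R) : smooth f -> smooth g -> smooth (fun x => f x + g x).
Proof. by move=> fs gs; apply: smooth_algW; apply: SmoothAdd; apply: SmoothGen. Qed.

Lemma smoothM V (f g : V -> R) : smooth f -> smooth g -> smooth (fun x => f x * g x).
Proof. by move=> fs gs; apply: smooth_algW; apply: SmoothMul; apply: SmoothGen. Qed.

Lemma smoothN V (f : V -> R) : smooth f -> smooth (fun x => - f x).
Proof.
move=> fs; have -> : (fun x => - f x) = (fun x => (-1) * f x).
  by apply/funext => x; rewrite mulN1r.
by apply: smoothM => //; exact: smooth_cst.
Qed.

Lemma smooth_sum V (I : Type) (r : seq I) (P : pred I) (f : I -> V -> R) :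
  (forall i, smooth (f i)) -> smooth (fun x => \sum_(i <- r | P i) f i x).
Proof.
move=> fs; elim: r => [|i r IH].
  under eq_fun do rewrite big_nil; exact: smooth_cst.
under eq_fun do rewrite big_cons.
by case: (P i) => //; apply: smoothD.
Qed.

Lemma differentiable_mx V m n (F : V -> 'M[R]_(m, n)) x :
  (forall i j, differentiable (fun y => F y i j) x) -> differentiable F x.
Proof.
move=> dF.
have -> : F = \sum_(i < m) \sum_(j < n)
   (fun y => (F y i j) *: (delta_mx i j : 'M[R]_(m, n))).
  apply/funext => y; rewrite [LHS]matrix_sum_delta fct_sumE.
  by apply: eq_bigr => i _; rewrite fct_sumE.
apply: differentiable_sum => i; apply: differentiable_sum => j.
exact: differentiableZl.
Qed.

Lemma smooth_mx V m n (F : V -> 'M[R]_(m, n)) :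
  (forall i j, smooth (fun y => F y i j)) -> smooth F.
Proof.
apply: (smooth_coind (P := fun F : V -> 'M[R]_(m, n) =>
   forall i j, smooth (fun y => F y i j))) => {F}.
  by move=> F x Fs; apply: differentiable_mx => i j; exact: smooth_differentiable.
move=> F v Fs i j.
have -> : (fun y => 'D_v F y i j) = 'D_v (fun y => F y i j).
  apply/funext => y; rewrite derive_mx ?mxE //; apply: diff_derivable.
  by apply: differentiable_mx => k l; exact: smooth_differentiable.
exact: smooth_derive.
Qed.

Lemma smooth_coord V m n (F : V -> 'M[R]_(m, n)) i j :
  smooth F -> smooth (fun y => F y i j).
Proof.
move=> Fs.
apply: (smooth_coind (P := fun f : V -> R => exists2 F : V -> 'M[R]_(m, n),
   smooth F & f = fun y => F y i j)); last by exists F.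
  move=> f x [{Fs}F Fs ->].
  apply: (@differentiable_comp _ _ _ _ F (fun M : 'M[R]_(m, n) => M i j)).
    exact: smooth_differentiable.
  exact: differentiable_coord.
move=> f v [{Fs}F Fs ->]; exists ('D_v F); first exact: smooth_derive.
by apply/funext => y; rewrite derive_mx ?mxE //; exact: smooth_derivable.
Qed.

Lemma derive_slice_snd W (f : R * R -> W) (a x v : R) :
  'D_v (fun y : R => f (a, y)) x = 'D_((0, v) : R * R) f (a, x).
Proof.
rewrite /derive.
suff -> : (fun h : R => h^-1 *: (((fun y => f (a, y)) \o shift x) (h *: v) - f (a, x))) =
  (fun h => h^-1 *: ((f \o shift (a, x)) (h *: (0, v)) - f (a, x))) by [].
apply/funext => t /=; congr (_ *: (f _ - _)).
by apply/pair_equal_spec; split => /=; rewrite ?scaler0 ?add0r.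
Qed.

Lemma derive_slice_fst W (f : R * R -> W) (a x v : R) :
  'D_v (fun y : R => f (y, x)) a = 'D_((v, 0) : R * R) f (a, x).
Proof.
rewrite /derive.
suff -> : (fun h : R => h^-1 *: (((fun y => f (y, x)) \o shift a) (h *: v) - f (a, x))) =
  (fun h => h^-1 *: ((f \o shift (a, x)) (h *: (v, 0)) - f (a, x))) by [].
apply/funext => t /=; congr (_ *: (f _ - _)).
by apply/pair_equal_spec; split => /=; rewrite ?scaler0 ?add0r.
Qed.

Lemma smooth_slice W (f : R * R -> W) (a : R) :
  smooth f -> smooth (fun x : R => f (a, x)).
Proof.
move=> fs.
apply: (smooth_coind (P := fun h : R -> W => exists2 f : R * R -> W,
   smooth f & h = fun x => f (a, x))); last by exists f.
  move=> h x [{fs}f fs ->].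
  apply: (@differentiable_comp _ _ _ _ (fun y : R => (a, y)) f).
    by apply: differentiable_pair.
  exact: smooth_differentiable.
move=> h v [{fs}f fs ->]; exists ('D_((0, v) : R * R) f); first exact: smooth_derive.
by apply/funext => x; exact: derive_slice_snd.
Qed.

Lemma smooth_snd W (f : R -> W) : smooth f -> smooth (fun p : R * R => f p.2).
Proof.
move=> fs.
apply: (smooth_coind (P := fun h : R * R -> W => exists2 f : R -> W,
   smooth f & h = fun p => f p.2)); last by exists f.
  move=> h x [{fs}f fs ->].
  apply: (@differentiable_comp _ _ _ _ (fun p : R * R => p.2) f).
    by apply: (@linear_differentiable _ _ _ snd) => y; exact: cvg_snd.
  exact: smooth_differentiable.
by move=> h v [{fs}f fs ->]; exists ('D_(v.2) f); first exact: smooth_derive.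
Qed.

Lemma smooth_derive1 W (f : R -> W) : smooth f -> smooth (derive1 f).
Proof.
move=> sf; have -> : derive1 f = 'D_1 f by apply/funext => x; rewrite derive1E.
exact: smooth_derive.
Qed.

Lemma smooth_mulmx V m n p (F : V -> 'M[R]_(m, n)) (G : V -> 'M[R]_(n, p)) :
  smooth F -> smooth G -> smooth (fun x => F x *m G x).
Proof.
move=> sF sG; apply: smooth_mx => i j; under eq_fun do rewrite mxE.
by apply: smooth_sum => k; apply: smoothM; exact: smooth_coord.
Qed.

Lemma smooth_addmx V m n (F G : V -> 'M[R]_(m, n)) :
  smooth F -> smooth G -> smooth (fun x => F x + G x).
Proof.
move=> sF sG; apply: smooth_mx => i j; under eq_fun do rewrite mxE.
by apply: smoothD; exact: smooth_coord.
Qed.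

Lemma smooth_oppmx V m n (F : V -> 'M[R]_(m, n)) : smooth F -> smooth (fun x => - F x).
Proof.
move=> sF; apply: smooth_mx => i j; under eq_fun do rewrite mxE.
by apply: smoothN; exact: smooth_coord.
Qed.

Lemma smooth_scalemx V m n (a : V -> R) (F : V -> 'M[R]_(m, n)) :
  smooth a -> smooth F -> smooth (fun x => a x *: F x).
Proof.
move=> sa sF; apply: smooth_mx => i j; under eq_fun do rewrite mxE.
by apply: smoothM => //; exact: smooth_coord.
Qed.

Lemma smooth_trmx V m n (F : V -> 'M[R]_(m, n)) : smooth F -> smooth (fun x => (F x)^T).
Proof.
by move=> sF; apply: smooth_mx => i j; under eq_fun do rewrite mxE; exact: smooth_coord.
Qed.

End Smooth.

(** * Second-order estimates *)

Section Expansion.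
Variables (R : realType).

(** A quadratic remainder is a little-o. In this form the remainder of a sum of
    a series can be estimated term by term. *)
Lemma diff_quadratic (V W : normedModType R) (f : V -> W) (L : {linear V -> W})
    (p : V) (M : R) : continuous L ->
  (forall h : V, `|h| <= 1 -> `|f (h + p) - f p - L h| <= M * `|h| ^+ 2) ->
  differentiable f p /\ 'd f p = L :> (V -> W).
Proof.
move=> Lc H.
have fE : f \o shift p = cst (f p) + L +o_ 0 id.
  apply/eqaddoP => e e0 /=.
  have M1 : 0 < `|M| + 1 by rewrite ltr_wpDl.
  near=> h.
  rewrite !fctE /= [X in `|X|](_ : _ = f (h + p) - f p - L h); last first.
    by rewrite opprD addrA.
  have h1 : `|h| <= 1.
    near: h; apply/nbhs_le_nbhs_norm; exists 1 => //= x.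
    by rewrite /= sub0r normrN => /ltW.
  have he : `|h| <= e / (`|M| + 1).
    near: h; apply/nbhs_le_nbhs_norm; exists (e / (`|M| + 1)); first by rewrite /= divr_gt0.
    by move=> x /=; rewrite sub0r normrN => /ltW.
  apply: le_trans (H h h1) _; rewrite expr2 mulrA; apply: ler_wpM2r => //.
  move: he; rewrite ler_pdivlMr // => he.
  apply: le_trans he; rewrite mulrC; apply: ler_wpM2l => //.
  by apply: le_trans (ler_norm _) _; rewrite lerDl.
have dE := diff_unique Lc fE.
by split => //; apply/diff_locallyP; rewrite dE.
Unshelve. all: by end_near. Qed.

Lemma differentiable_quadratic (f : R * R -> R) (p : R * R) (l1 l2 M : R) :
  (forall h : R * R, `|h| <= 1 ->
     `|f (h + p) - f p - (h.1 * l1 + h.2 * l2)| <= M * `|h| ^+ 2) ->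
  differentiable f p /\ forall v : R * R, 'D_v f p = v.1 * l1 + v.2 * l2.
Proof.
move=> H.
pose L (v : R * R) : R := v.1 * l1 + v.2 * l2.
have Llin : linear L.
  by move=> a u v; rewrite /L /= /GRing.scale /=; ring.
pose LM := GRing.isLinear.Build _ _ _ _ _ Llin.
pose LL : {linear (R * R)%type -> R} := HB.pack L LM.
have Lc : continuous LL.
  move=> v; rewrite /LL /= /L; apply: cvgD; apply: cvgM; try exact: cvg_cst;
  [exact: cvg_fst|exact: cvg_snd].
have [df dE] := diff_quadratic Lc H.
by split => // v; rewrite deriveE // dE.
Qed.

Definition ssum (c : nat -> R) : R := limn (series c).

Lemma geo_cvg (c : nat -> R) (M : R) :
  (forall k, `|c k| <= M / 2 ^+ k) -> cvgn (series c).
Proof.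
move=> cM; apply: normed_cvg; rewrite /normed_series_of /=.
apply: (@series_le_cvg _ _ (geometric M (2^-1))) => [k|k|k|] /=.
- exact: normr_ge0.
- by rewrite /geometric /= exprVn; apply: le_trans (cM k); rewrite normr_ge0.
- by have := cM k; rewrite exprVn.
- by apply: is_cvg_geometric_series; rewrite ger0_norm ?invr_ge0 // invf_lt1 // ltr1n.
Qed.

Lemma ssum_le (c : nat -> R) (M : R) :
  (forall k, `|c k| <= M / 2 ^+ k) -> `|ssum c| <= 2 * M.
Proof.
move=> cM.
have h2 : `|2^-1 : R| < 1 by rewrite ger0_norm ?invr_ge0 // invf_lt1 // ltr1n.
have cg : cvgn (series (geometric M (2^-1 : R))) by exact: is_cvg_geometric_series.
have cn : cvgn [normed series c].
  rewrite /normed_series_of /=.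
  apply: (@series_le_cvg _ _ (geometric M (2^-1))) => [k|k|k|] //=.
  - by rewrite /geometric /= exprVn; apply: le_trans (cM k); rewrite normr_ge0.
  - by have := cM k; rewrite exprVn.
apply: le_trans (lim_series_norm cn) _.
have -> : 2 * M = limn (series (geometric M (2^-1 : R))).
  rewrite (cvg_lim _ (cvg_geometric_series h2)) //.
  by field.
by apply: lim_series_le => // k /=; have := cM k; rewrite exprVn.
Qed.

Lemma ssum_lin (c d : nat -> R) (t : R) : cvgn (series c) -> cvgn (series d) ->
  ssum (fun k => c k + t * d k) = ssum c + t * ssum d.
Proof.
move=> cc cd; rewrite /ssum.
have -> : (fun k => c k + t * d k) = c + t *: d by apply/funext.
rewrite lim_seriesD //; last exact: is_cvg_seriesZ.
by rewrite lim_seriesZ.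
Qed.

Lemma ssumS (c : nat -> R) : cvgn (series c) ->
  ssum c = c 0%N + ssum (fun k => c k.+1).
Proof.
move=> cc; rewrite /ssum.
have e n : series c n.+1 = c 0%N + series (fun k => c k.+1) n.
  by rewrite /series /= big_nat_recl.
have cS : (fun n => series c n.+1) @ \oo --> limn (series c).
  by rewrite (cvg_shiftS (series c)).
have -> : limn (series c) = limn (fun n => series c n.+1).
  by apply/esym/cvg_lim.
have c1 : cvgn (fun n => series c n.+1) by apply/cvg_ex; exists (limn (series c)).
have c2 : cvgn (series (fun k => c k.+1)).
  have -> : series (fun k => c k.+1) = (fun n => series c n.+1 - c 0%N).
    by apply/funext => n; rewrite e addrC addKr.
  by apply: is_cvgB => //; exact: is_cvg_cst.
have -> : (fun n => series c n.+1) = (cst (c 0%N) \+ series (fun k => c k.+1)).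
  by apply/funext => n; rewrite e.
rewrite limD //; last exact: is_cvg_cst.
by rewrite lim_cst.
Qed.

End Expansion.

Section Taylor.
Variables (R : realType).

Lemma mvt_le (f df : R -> R) (x y M : R) :
  (forall z : R, is_derive z 1 f (df z)) ->
  (forall z, `|z - x| <= `|y - x| -> `|df z| <= M) ->
  `|f y - f x| <= M * `|y - x|.
Proof.
move=> fd dM.
have fc z : {for z, continuous f}.
  by apply/differentiable_continuous/derivable1_diffP; have [] := fd z.
have main a b : a <= b -> (forall z, a <= z <= b -> `|df z| <= M) ->
    `|f b - f a| <= M * (b - a).
  move=> ab dM'; have [c cab ->] : exists2 c, c \in `[a, b]%R & f b - f a = df c * (b - a).
    by apply: MVT_segment => //; apply: continuous_subspaceT; exact: fc.
  rewrite normrM [X in _ * X]ger0_norm ?subr_ge0 //.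
  by apply: ler_wpM2r; [rewrite subr_ge0 | apply: dM'; rewrite in_itv /= in cab].
have [xy|/ltW yx] := leP x y.
  rewrite (ger0_norm (_ : 0 <= y - x)) ?subr_ge0 //; apply: main => // z /andP[xz zy].
  by apply: dM; rewrite !ger0_norm ?subr_ge0 // lerD2r.
rewrite distrC [X in _ * X]distrC (ger0_norm (_ : 0 <= x - y)) ?subr_ge0 //.
apply: main => // z /andP[yz zx].
by apply: dM; rewrite !ler0_norm ?subr_le0 // !opprB lerD2l lerN2.
Qed.

(** Mean value theorem, applied first to [z |-> f z - z * f' x], whose
    derivative is [f' z - f' x], and then to [f']. *)
Lemma taylor2_le (f df ddf : R -> R) (x k X M : R) :
  (forall z : R, is_derive z 1 f (df z)) ->
  (forall z : R, is_derive z 1 df (ddf z)) ->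
  `|x| + `|k| <= X ->
  (forall z, `|z| <= X -> `|ddf z| <= M) ->
  `|f (k + x) - f x - k * df x| <= M * `|k| ^+ 2.
Proof.
move=> fd dfd xk dM.
have M0 : 0 <= M by apply: le_trans (dM x _) => //; apply: le_trans xk; rewrite lerDl.
pose g z := f z - z * df x.
have gd (z : R) : is_derive z 1 g (df z - df x).
  have h : is_derive z 1 (fun z => f z - df x *: z) (df z - df x *: 1) by apply: is_deriveB.
  have -> : g = (fun z => f z - df x *: z) by apply/funext => t; rewrite /g mulrC.
  by apply: is_derive_eq; rewrite /GRing.scale /= mulr1.
have -> : f (k + x) - f x - k * df x = g (k + x) - g x by rewrite /g; ring.
apply: le_trans (@mvt_le g _ x (k + x) (M * `|k|) gd _) _; last first.
  by rewrite addrK expr2 mulrA.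
move=> z; rewrite addrK => zk.
apply: le_trans (@mvt_le df _ x z M dfd _) _; last by apply: ler_wpM2l.
move=> t tz; apply: dM; apply: le_trans xk.
rewrite -[t](subrK x) addrC; apply: le_trans (ler_normD _ _) _.
by rewrite lerD2l; apply: le_trans zk.
Qed.

(** Taylor estimates of the [k]-th power at orders 0, 1 and 2. Their constants
    are polynomial in [k], so that a geometric factor absorbs them. *)
Lemma pow_bounds (e h rho : R) k : 1 <= rho -> `|e| <= rho -> `|h + e| <= rho ->
  [/\ `|(h + e) ^+ k| <= rho ^+ k,
      `|(h + e) ^+ k - e ^+ k| <= `|h| * k%:R * rho ^+ k
    & `|(h + e) ^+ k - e ^+ k - h * (k%:R * e ^+ k.-1)| <= `|h| ^+ 2 * k%:R ^+ 2 * rho ^+ k].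
Proof.
move=> r1 er hr.
have r0 : 0 <= rho by apply: le_trans r1.
have pw x m : `|x| <= rho -> `|x ^+ m| <= rho ^+ m.
  by move=> xr; rewrite normrX lerXn2r ?nnegrE.
have mono m : rho ^+ m <= rho ^+ m.+1 by rewrite exprS ler_peMl ?exprn_ge0.
have p2 m : `|(h + e) ^+ m - e ^+ m| <= `|h| * m%:R * rho ^+ m.
  elim: m => [|m IH]; first by rewrite !expr0 subrr normr0 mulr0 mul0r.
  have -> : (h + e) ^+ m.+1 - e ^+ m.+1 = (h + e) * ((h + e) ^+ m - e ^+ m) + h * e ^+ m.
    by rewrite !exprS; ring.
  apply: le_trans (ler_normD _ _) _; rewrite !normrM.
  have -> : `|h| * m.+1%:R * rho ^+ m.+1 = rho * (`|h| * m%:R * rho ^+ m) + `|h| * rho ^+ m.+1.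
    by rewrite exprS -natr1; ring.
  apply: lerD; first by apply: ler_pM.
  by apply: ler_wpM2l => //; apply: le_trans (mono m); apply: pw.
split=> //; first exact: pw.
elim: k => [|k IH]; first by rewrite !expr0 subrr mul0r mulr0 subr0 normr0 mulr_ge0 ?exprn_ge0 ?mulr_ge0.
have -> : (h + e) ^+ k.+1 - e ^+ k.+1 - h * (k.+1%:R * e ^+ k.+1.-1) =
   e * ((h + e) ^+ k - e ^+ k - h * (k%:R * e ^+ k.-1)) + h * ((h + e) ^+ k - e ^+ k).
  case: k {IH} => [|k] /=; first by rewrite !expr0 !expr1; ring.
  rewrite -[k.+2%:R]natr1 !exprS; ring.
apply: le_trans (ler_normD _ _) _; rewrite !normrM.
apply: le_trans (lerD (ler_pM _ _ er IH) (ler_wpM2l _ (p2 k))) _ => //.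
have -> : rho * (`|h| ^+ 2 * k%:R ^+ 2 * rho ^+ k) = `|h| ^+ 2 * k%:R ^+ 2 * rho ^+ k.+1.
  by rewrite [rho ^+ k.+1]exprS; ring.
have -> : `|h| * (`|h| * k%:R * rho ^+ k) = `|h| ^+ 2 * k%:R * rho ^+ k by ring.
apply: le_trans (lerD (lexx _) (ler_wpM2l _ (mono k))) _; first by rewrite mulr_ge0 ?exprn_ge0.
rewrite -mulrDl; apply: ler_wpM2r; first exact: exprn_ge0.
rewrite -mulrDr; apply: ler_wpM2l; first exact: exprn_ge0.
by rewrite -!natrX -natrD ler_nat; lia.
Qed.

End Taylor.

(** * Power series with functions as coefficients *)

Section EpsSeries.
Variables (R : realType).
Implicit Types (a b : nat -> R -> R).

(** Coefficients [a k x] of a power series in [eps] that converges for all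
    [eps], locally uniformly in [x]. *)
Definition entire a := forall X r : R, 0 < r -> exists M, forall k x, `|x| <= X ->
  `|a k x| * r ^+ k <= M.

(** The parameter [eps] is the first component of [p]. *)
Definition eps_series a (p : R * R) : R := ssum (fun k => a k p.2 * p.1 ^+ k).

Definition coef_add a b k x := a k x + b k x.
Definition coef_mulf a (c : R -> R) k x := a k x * c x.
Definition coef_shift a k x := if k is k'.+1 then a k' x else 0.
Definition coef_dif a k x := k.+1%:R * a k.+1 x.

Lemma natr_exp2 k : k.+1%:R <= 2 ^+ k :> R.
Proof. by rewrite -natrX ler_nat; apply: ltn_expl. Qed.

(** A radius [r] larger than twice the absolute value of [eps] makes the terms
    geometric. *)
Lemma entire_geo a (p : R * R) : entire a -> exists M, forall k,
  `|a k p.2 * p.1 ^+ k| <= M / 2 ^+ k.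
Proof.
move=> ea.
have [M aM] := ea `|p.2| (2 * (`|p.1| + 1)) ltac:(by rewrite mulr_gt0 // ltr_wpDl).
exists M => k; rewrite normrM normrX ler_pdivlMr ?exprn_gt0 //.
apply: le_trans (aM k p.2 (lexx _)); rewrite -mulrA; apply: ler_wpM2l => //.
rewrite exprMn mulrC; apply: ler_wpM2l; first exact: exprn_ge0.
by rewrite lerXn2r ?nnegrE ?addr_ge0 // lerDl.
Qed.

Lemma entire_cvg a p : entire a -> cvgn (series (fun k => a k p.2 * p.1 ^+ k)).
Proof. by move=> ea; have [M /geo_cvg] := @entire_geo _ p ea. Qed.

Lemma entire_add a b : entire a -> entire b -> entire (coef_add a b).
Proof.
move=> ea eb X r r0; have [M aM] := ea X r r0; have [N bN] := eb X r r0.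
exists (M + N) => k x xX; apply: le_trans (lerD (aM k x xX) (bN k x xX)).
by rewrite -mulrDl; apply: ler_wpM2r; [rewrite exprn_ge0 // ltW | exact: ler_normD].
Qed.

Lemma smooth_bounded (c : R -> R) (X : R) : smooth c ->
  exists M, forall x, `|x| <= X -> `|c x| <= M.
Proof.
move=> cs; have [X0|X0] := ltP X 0.
  by exists 0 => x xX; have := le_lt_trans xX X0; rewrite normr_lt0.
have cc : {within `[- X, X], continuous c}.
  apply: continuous_subspaceT => x.
  exact/differentiable_continuous/smooth_differentiable.
have XX : - X <= X by rewrite (le_trans _ X0) // oppr_le0.
have [m _ cm] := EVT_max XX cc; have [m' _ cm'] := EVT_min XX cc.
exists (`|c m| + `|c m'|) => x; rewrite ler_norml => xX.
have {}xX : x \in `[- X, X]%R by rewrite in_itv /=.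
rewrite ler_norml; apply/andP; split.
  apply: le_trans (cm' _ xX); rewrite opprD -subr_ge0 opprD !opprK.
  by rewrite addrCA addr_ge0 // -[X in X + _]opprK addrC subr_ge0 -normrN ler_norm.
by apply: le_trans (cm _ xX) _; apply: le_trans (ler_norm _) _; rewrite lerDl.
Qed.

Lemma entire_mulf a c : entire a -> smooth c -> entire (coef_mulf a c).
Proof.
move=> ea cs X r r0; have [M aM] := ea X r r0; have [N cN] := @smooth_bounded c X cs.
exists (M * N) => k x xX; rewrite /coef_mulf normrM mulrAC; apply: ler_pM => //.
- by rewrite mulr_ge0 // exprn_ge0 // ltW.
- exact: aM.
- exact: cN.
Qed.

Lemma entire_shift a : entire a -> entire (coef_shift a).
Proof.
move=> ea X r r0; have [M aM] := ea X r r0.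
exists (`|M| * r) => -[|k] x xX /=.
  by rewrite normr0 mul0r mulr_ge0 // ltW.
rewrite exprSr mulrA; apply: ler_wpM2r; first exact: ltW.
by apply: le_trans (aM k x xX) (ler_norm _).
Qed.

(** Doubling the radius pays for the factor [k + 1]. *)
Lemma entire_dif a : entire a -> entire (coef_dif a).
Proof.
move=> ea X r r0; have r2 : 0 < 2 * r by rewrite mulr_gt0.
have [M aM] := ea X _ r2.
exists (M / (2 * r)) => k x xX; rewrite ler_pdivlMr //.
apply: le_trans (aM k.+1 x xX).
rewrite /coef_dif normrM (ger0_norm (ler0n _ _)).
have -> : k.+1%:R * `|a k.+1 x| * r ^+ k * (2 * r) =
  `|a k.+1 x| * (k.+1%:R * (r ^+ k * (2 * r))) by ring.
apply: ler_wpM2l => //; rewrite exprSr exprMn -mulrA; apply: ler_wpM2r.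
  by rewrite mulr_ge0 ?exprn_ge0 // ltW.
exact: natr_exp2.
Qed.

Lemma ssum0 : ssum (fun _ => 0 : R) = 0.
Proof.
apply/eqP; rewrite -normr_le0; apply: le_trans (@ssum_le _ _ 0 _) _.
  by move=> k; rewrite normr0 mul0r.
by rewrite mulr0.
Qed.

Lemma eps_series_add a b p : entire a -> entire b ->
  eps_series (coef_add a b) p = eps_series a p + eps_series b p.
Proof.
move=> ea eb; rewrite /eps_series -[X in _ + X]mul1r -ssum_lin; try exact: entire_cvg.
by congr ssum; apply/funext => k; rewrite /coef_add; ring.
Qed.

Lemma eps_series_mulf a c p : entire a -> eps_series (coef_mulf a c) p = eps_series a p * c p.2.
Proof.
move=> ea; have c0 : cvgn (series (fun k : nat => 0 : R)).
  by apply: (@geo_cvg _ _ 0) => k; rewrite normr0 mul0r.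
rewrite /eps_series [RHS]mulrC -[RHS]add0r -[X in X + _]ssum0 -ssum_lin //; last exact: entire_cvg.
by congr ssum; apply/funext => k; rewrite /coef_mulf; ring.
Qed.

Lemma eps_series_eq a b p : (forall k, a k p.2 = b k p.2) -> eps_series a p = eps_series b p.
Proof. by move=> ab; congr ssum; apply/funext => k; rewrite ab. Qed.

Lemma entire0 : entire (fun _ _ => 0).
Proof. by move=> X r _; exists 0 => k x _; rewrite normr0 mul0r. Qed.

Lemma entire_sum (I : Type) (r : seq I) (a : I -> nat -> R -> R) :
  (forall i, entire (a i)) -> entire (fun k x => \sum_(i <- r) a i k x).
Proof.
move=> ea; elim: r => [|i r IH] X s s0.
  have [M bM] := @entire0 X s s0.
  by exists M => k x xX; rewrite big_nil; exact: (bM k x).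
have [M bM] := @entire_add _ _ (ea i) IH X s s0.
by exists M => k x xX; rewrite big_cons; exact: (bM k x).
Qed.

Lemma eps_series_sum (I : Type) (r : seq I) (a : I -> nat -> R -> R) p :
  (forall i, entire (a i)) ->
  eps_series (fun k x => \sum_(i <- r) a i k x) p = \sum_(i <- r) eps_series (a i) p.
Proof.
move=> ea; elim: r => [|i r IH].
  rewrite big_nil -[RHS]ssum0; congr ssum.
  by apply/funext => k; rewrite big_nil mul0r.
rewrite big_cons -IH -eps_series_add //; last exact: entire_sum.
by apply: eps_series_eq => k; rewrite big_cons.
Qed.

Lemma eps_series_shift a p : entire a -> eps_series (coef_shift a) p = p.1 * eps_series a p.
Proof.
move=> ea; rewrite /eps_series ssumS; last by apply: entire_cvg; apply: entire_shift.
rewrite /= mul0r add0r.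
have -> : (fun k => a k p.2 * p.1 ^+ k.+1) = (fun k => coef_mulf a (fun _ => p.1) k p.2 * p.1 ^+ k).
  by apply/funext => k; rewrite /coef_mulf exprS; ring.
by rewrite -/(eps_series _ p) eps_series_mulf // mulrC.
Qed.

Lemma eps_series0 a x : entire a -> eps_series a (0, x) = a 0%N x.
Proof.
move=> ea; rewrite /eps_series ssumS; last by apply: (@entire_cvg _ (0, x)).
rewrite /= expr0 mulr1.
have -> : (fun k => a k.+1 x * 0 ^+ k.+1) = (fun k => 0).
  by apply/funext => k; rewrite expr0n mulr0.
by rewrite ssum0 addr0.
Qed.

(** Put [h = (h1, h2)]. The second-order increment of [a k x * eps ^+ k] splits
    into the second-order increment of [a k] times a power, the derivative of
    [a k] times the first-order increment of the power, and [a k] times the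
    second-order increment of the power. All three are [O(`|h| ^+ 2)], and the
    constants are summable in [k]: they grow like [4^k * rho^k], whereas the
    coefficients are controlled with the radius [8 * rho]. *)
Lemma eps_series_differentiable a a' a'' :
  entire a -> entire a' -> entire a'' ->
  (forall k x, is_derive x (1 : R) (a k) (a' k x)) ->
  (forall k x, is_derive x (1 : R) (a' k) (a'' k x)) ->
  forall p, differentiable (eps_series a) p /\
    forall v : R * R, 'D_v (eps_series a) p = v.1 * eps_series (coef_dif a) p + v.2 * eps_series a' p.
Proof.
move=> ea ea' ea'' da da' p.
pose rho := `|p.1| + 1; pose X := `|p.2| + 1.
have rho1 : 1 <= rho by rewrite lerDr.
have rho0 : 0 < rho by apply: lt_le_trans rho1.
have r8 : 0 < 8 * rho by rewrite mulr_gt0.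
have [M0 aM0] := ea X _ r8; have [M1 aM1] := ea' X _ r8; have [M2 aM2] := ea'' X _ r8.
have M0p : 0 <= M0.
  by apply: le_trans (aM0 0%N p.2 _); rewrite ?mulr_ge0 ?exprn_ge0 ?(ltW r8) // lerDl.
have M1p : 0 <= M1.
  by apply: le_trans (aM1 0%N p.2 _); rewrite ?mulr_ge0 ?exprn_ge0 ?(ltW r8) // lerDl.
have M2p : 0 <= M2.
  by apply: le_trans (aM2 0%N p.2 _); rewrite ?mulr_ge0 ?exprn_ge0 ?(ltW r8) // lerDl.
apply: (@differentiable_quadratic _ _ _ _ _ (2 * (M0 + M1 + M2))) => -[h k] hk1.
have [h1 k1] : `|h| <= `|(h, k)| /\ `|k| <= `|(h, k)|.
  by rewrite prod_normE /= !le_max !lexx orbT.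
set H := `|(h, k)| in hk1 h1 k1 *.
have H0 : 0 <= H := normr_ge0 _.
pose t m := a m (k + p.2) * (h + p.1) ^+ m - a m p.2 * p.1 ^+ m
  - (h * (m%:R * a m p.2 * p.1 ^+ m.-1) + k * (a' m p.2 * p.1 ^+ m)).
have ctail : cvgn (series (fun m => m%:R * a m p.2 * p.1 ^+ m.-1)).
  have := @entire_cvg _ p (entire_dif ea) => c.
  have -> : series (fun m => m%:R * a m p.2 * p.1 ^+ m.-1) =
     series (coef_shift (fun m x => coef_dif a m p.2 * p.1 ^+ m) ^~ 0).
    by apply/funext => m; apply: eq_bigr => -[|i] _ //=; rewrite !mul0r.
  apply/cvg_ex; exists (limn (series (fun k0 => coef_dif a k0 p.2 * p.1 ^+ k0))).
  rewrite -(cvg_shiftS (series _)) /=.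
  suff -> : (fun n => series (coef_shift (fun m _ => coef_dif a m p.2 * p.1 ^+ m) ^~ 0) n.+1) =
     series (fun k0 => coef_dif a k0 p.2 * p.1 ^+ k0) by [].
  by apply/funext => m; rewrite /series /= big_nat_recl // add0r.
have stail : ssum (fun m => m%:R * a m p.2 * p.1 ^+ m.-1) = eps_series (coef_dif a) p.
  by rewrite ssumS // !mul0r add0r.
have e1 : eps_series a ((h, k) + p) - eps_series a p -
    (h * eps_series (coef_dif a) p + k * eps_series a' p) = ssum t.
  have -> : t = (fun m => ((a m (k + p.2) * (h + p.1) ^+ m + (-1) * (a m p.2 * p.1 ^+ m))
      + (- h) * (m%:R * a m p.2 * p.1 ^+ m.-1)) + (- k) * (a' m p.2 * p.1 ^+ m)).
    by apply/funext => m; rewrite /t; ring.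
  have cA := @entire_cvg _ ((h, k) + p) ea.
  have cB := @entire_cvg _ p ea.
  have cC := @entire_cvg _ p ea'.
  have lincvg (c d : nat -> R) s : cvgn (series c) -> cvgn (series d) ->
     cvgn (series (fun m => c m + s * d m)).
    move=> cc cd; have -> : (fun m => c m + s * d m) = c + s *: d by apply/funext.
    by apply: is_cvg_seriesD => //; apply: is_cvg_seriesZ.
  rewrite ssum_lin //; last by do 2!apply: (lincvg _ _ _ _) => //.
  rewrite ssum_lin //; last by apply: (lincvg _ _ _ _) => //.
  rewrite ssum_lin // stail /eps_series /=; ring.
rewrite e1 -mulrA; apply: ssum_le => m; rewrite ler_pdivlMr ?exprn_gt0 //.
have hb : `|h + p.1| <= rho.
  by apply: le_trans (ler_normD _ _) _; rewrite addrC lerD2l (le_trans h1).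
have kb : `|p.2| + `|k| <= X by rewrite lerD2l (le_trans k1).
have er : `|p.1| <= rho by rewrite lerDl.
have [p1 p2 p3] := pow_bounds m rho1 er hb.
pose Q := (8 * rho) ^+ m.
have Q0 : 0 < Q by apply: exprn_gt0.
(* The three parts of the increment are bounded in the same order below. *)
have tb := @taylor2_le _ _ _ _ p.2 k X (M2 / Q) (da m) (da' m) kb.
have {}tb : `|a m (k + p.2) - a m p.2 - k * a' m p.2| <= M2 / Q * `|k| ^+ 2.
  by apply: tb => z zX; rewrite ler_pdivlMr //; apply: aM2.
have a'b : `|a' m p.2| <= M1 / Q by rewrite ler_pdivlMr //; apply: aM1; rewrite lerDl.
have ab : `|a m p.2| <= M0 / Q by rewrite ler_pdivlMr //; apply: aM0; rewrite lerDl.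
have -> : t m = (a m (k + p.2) - a m p.2 - k * a' m p.2) * (h + p.1) ^+ m
  + k * a' m p.2 * ((h + p.1) ^+ m - p.1 ^+ m)
  + a m p.2 * ((h + p.1) ^+ m - p.1 ^+ m - h * (m%:R * p.1 ^+ m.-1)).
  by rewrite /t; ring.
have rm : 0 <= rho ^+ m by apply: exprn_ge0; apply: ltW.
have HQ M : 0 <= M -> 0 <= M / Q * H ^+ 2.
  by move=> M0'; rewrite mulr_ge0 ?divr_ge0 ?exprn_ge0 // ltW.
have m2 : (1 : R) <= 4 ^+ m /\ m%:R <= 4 ^+ m :> R /\ m%:R ^+ 2 <= 4 ^+ m :> R.
  have e4 : 4 ^+ m = (2 ^+ m) ^+ 2 :> R by rewrite exprAC; congr (_ ^+ _); ring.
  have m1 : m%:R <= 2 ^+ m :> R by apply: le_trans (natr_exp2 m); rewrite ler_nat.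
  have one2 : 1 <= 2 ^+ m :> R by apply: exprn_ege1; rewrite ler1n.
  have l2 : 2 ^+ m <= (2 ^+ m) ^+ 2 :> R by rewrite expr2 ler_peMl // (le_trans ler01).
  by rewrite e4; split; [|split]; [exact: le_trans l2 | exact: le_trans l2
    | rewrite lerXn2r ?nnegrE // (le_trans ler01)].
case: m2 => m20 [m21 m22].
have key M : 0 <= M -> M / Q * H ^+ 2 * (4 ^+ m * rho ^+ m) * 2 ^+ m = M * H ^+ 2.
  move=> _; have -> : Q = 4 ^+ m * rho ^+ m * 2 ^+ m.
    by rewrite -!exprMn /Q; congr (_ ^+ _); ring.
  field; rewrite !expf_neq0 ?pnatr_eq0 //; exact: lt0r_neq0.
pose T M := M / Q * H ^+ 2 * (4 ^+ m * rho ^+ m).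
have -> : (M0 + M1 + M2) * H ^+ 2 = (T M2 + T M1 + T M0) * 2 ^+ m.
  by rewrite !(mulrDl _ _ (2 ^+ m)) /T !key //; ring.
apply: ler_wpM2r; first by rewrite exprn_ge0.
apply: le_trans (ler_normD _ _) _; rewrite /T.
apply: lerD; first
  (apply: le_trans (ler_normD _ _) _; apply: lerD).
- rewrite normrM; apply: ler_pM => //.
    apply: le_trans tb _; apply: ler_wpM2l; first by rewrite divr_ge0 // ltW.
    by rewrite lerXn2r ?nnegrE.
  by apply: le_trans p1 _; rewrite ler_peMl.
- rewrite !normrM.
  have -> : M1 / Q * H ^+ 2 * (4 ^+ m * rho ^+ m) = H * (M1 / Q) * (H * 4 ^+ m * rho ^+ m) by ring.
  apply: ler_pM; rewrite ?mulr_ge0 //; first exact: ler_pM.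
  by apply: le_trans p2 _; apply: ler_wpM2r => //; apply: ler_pM.
- have -> : M0 / Q * H ^+ 2 * (4 ^+ m * rho ^+ m) = M0 / Q * (H ^+ 2 * 4 ^+ m * rho ^+ m) by ring.
  rewrite normrM; apply: ler_pM => //; apply: le_trans p3 _; apply: ler_wpM2r => //.
  by apply: ler_pM; rewrite ?exprn_ge0 // lerXn2r ?nnegrE.
Qed.

End EpsSeries.

Section OneVariable.
Variables (R : realType).

Lemma is_derive1M (f g : R -> R) (x df dg : R) :
  is_derive x 1 f df -> is_derive x 1 g dg ->
  is_derive x 1 (fun y => f y * g y) (df * g x + f x * dg).
Proof.
move=> fd gd; have h : is_derive x 1 (f * g) (f x *: dg + g x *: df) by exact: is_deriveM.
by apply: is_derive_eq h _; rewrite /GRing.scale /= addrC [g x * _]mulrC.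
Qed.

Lemma is_derive1D (f g : R -> R) (x df dg : R) :
  is_derive x 1 f df -> is_derive x 1 g dg ->
  is_derive x 1 (fun y => f y + g y) (df + dg).
Proof. by move=> fd gd; exact: (@is_deriveD _ _ _ f g). Qed.

Lemma is_derive1_sum (I : Type) (r : seq I) (f : I -> R -> R) (df : I -> R) (x : R) :
  (forall i, is_derive x 1 (f i) (df i)) ->
  is_derive x 1 (fun y => \sum_(i <- r) f i y) (\sum_(i <- r) df i).
Proof.
move=> fd; elim: r => [|i r IH].
  by under eq_fun do rewrite big_nil; rewrite big_nil; exact: is_derive_cst.
by under eq_fun do rewrite big_cons; rewrite big_cons; exact: is_derive1D.
Qed.

Lemma smooth_is_derive (f : R -> R) (x : R) : smooth f -> is_derive x 1 f ('D_1 f x).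
Proof. by move=> fs; apply/derivableP/smooth_derivable. Qed.

(** The integral from 0, with a sign to the left of 0. Near a given point it
    differs by a constant from the integral from a point [A] further to the
    left, to which the fundamental theorem applies. *)
Lemma antiderivative (f : R -> R) : continuous f ->
  exists F : R -> R, (forall x : R, is_derive x 1 F (f x)) /\ F 0 = 0.
Proof.
move=> fc.
have fi a b : (@lebesgue_measure R).-integrable `[a, b] (EFin \o f).
  apply: continuous_compact_integrable; first exact: segment_compact.
  exact: continuous_subspaceT.
pose F x := if 0 <= x then \int[lebesgue_measure]_(t in `]0, x]) f t
            else - \int[lebesgue_measure]_(t in `]x, 0]) f t.
exists F; split; last by rewrite /F lexx set_itvoc0 Rintegral_set0.
move=> x; pose A := - (`|x| + 2).
pose G y := \int[lebesgue_measure]_(t in `[A, y]) f t - \int[lebesgue_measure]_(t in `[A, 0]) f t.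
have A0 : A < 0 by rewrite oppr_lt0 ltr_wpDl.
have Ax : A < x.
  have := ler_norm (- x); rewrite normrN lerNl => h.
  by apply: lt_le_trans h; rewrite ltrN2 ltrDl.
have FG : \near x, G x = F x.
  have : \forall y \near x, A < y by apply: lt_nbhsr.
  apply: filterS => y Ay; rewrite /G /F; case: ifPn => y0.
    by rewrite (@Rintegral_itvB _ f (BLeft A) (BRight y) 0) //= bnd_simp // ltW.
  rewrite -ltNge in y0.
  by rewrite -(@Rintegral_itvB _ f (BLeft A) (BRight 0) y) ?opprB //= bnd_simp // ltW.
apply: near_eq_is_derive FG _.
have xu : x < x + 1 by rewrite ltrDl.
have [dH eH] := @continuous_FTC1_closed R f A x (x + 1) xu (fi _ _) Ax (fc x).
have hH : is_derive x 1 (fun y => \int[lebesgue_measure]_(t in `[A, y]) f t) (f x).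
  by rewrite -eH derive1E; exact: derivableP.
rewrite -[f x]subr0.
exact: (is_deriveB hH (is_derive_cst _ _ _)).
Qed.

(** The function [c * expR (L * `|z|)] grows faster than [f]. With such a weight,
    integration of a linear equation does not deteriorate bounds once [L] is
    large. *)
Lemma exp_comparison (f df : R -> R) (c L x : R) :
  (forall z : R, is_derive z 1 f (df z)) ->
  (forall z, `|z| <= `|x| -> `|df z| <= c * L * expR (L * `|z|)) ->
  `|f x - f 0| <= c * (expR (L * `|x|) - 1).
Proof.
move=> fd dM.
wlog x0 : f df x fd dM / 0 <= x => [hw|].
  have [x0|/ltW x0] := leP 0 x; first exact: (hw f df).
  have := hw (fun y => f (- y)) (fun y => - df (- y)) (- x).
  rewrite opprK oppr0 normrN; apply; last by rewrite oppr_ge0.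
    move=> z; have h := @is_derive1_comp _ f -%R z _ _ (fd (- z)) (is_deriveNid _ _).
    by apply: is_derive_eq h _; rewrite /GRing.scale /= mulrN1.
  by move=> z zx; rewrite normrN -[in leRHS](normrN z); apply: dM; rewrite normrN.
rewrite (ger0_norm x0) in dM *.
have eL (z : R) : is_derive z 1 (fun z => c * expR (L * z)) (c * L * expR (L * z)).
  have h1 : is_derive z 1 (fun z => L * z) L.
    apply: is_derive_eq (is_derive1M (is_derive_cst _ _ _) (is_derive_id _ _)) _.
    by rewrite mul0r add0r mulr1.
  have h2 := @is_derive1_comp _ expR _ z _ _ (is_derive_expR _) h1.
  apply: is_derive_eq (is_derive1M (is_derive_cst c _ _) h2) _.
  by rewrite mul0r add0r /=; ring.
have mono (s : R) : `|s| = 1 -> 0 <= (c * expR (L * x) + s * f x) - (c * expR (L * 0) + s * f 0).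
  move=> s1; pose g z := c * expR (L * z) + s * f z.
  have gd (z : R) : is_derive z 1 g (c * L * expR (L * z) + s * df z).
    exact: is_derive1D.
  have [z zx ->] : exists2 z, z \in `[0, x]%R & g x - g 0 = (c * L * expR (L * z) + s * df z) * (x - 0).
    apply: MVT_segment => //; apply: continuous_subspaceT => z.
    by apply/differentiable_continuous/derivable1_diffP; have [] := gd z.
  rewrite subr0 mulr_ge0 //; move: zx; rewrite in_itv /= => /andP[z0 zx].
  have := dM z; rewrite (ger0_norm z0) => /(_ zx).
  have := ler_norm (- (s * df z)); rewrite normrN normrM s1 mul1r => h1 h2.
  by have := le_trans h1 h2; rewrite -subr_ge0 opprK.
rewrite mulr0 expR0 in mono.
have m1 := mono 1 (normr1 _); have m2 := mono (-1) (normrN1 _).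
by rewrite ler_norml; apply/andP; split; lra.
Qed.

End OneVariable.

Section CoefClass.
Variables (R : realType) (I : finType) (z : I -> nat -> R -> R) (w : I -> I -> R -> R).
Hypothesis ze : forall i, entire (z i).
Hypothesis ws : forall i j, smooth (w i j).
Hypothesis zd : forall i k x, is_derive x (1 : R) (z i k)
  (if k is k'.+1 then \sum_l z l k' x * w l i x else 0).

(** Coefficients obtained from those of a solution of [Z_x = eps Z w] by the
    operations that differentiation of the series produces. By [zd] the class
    is stable under termwise derivatives in [x], and by [GDif] under the
    derivative in [eps]. *)
Inductive coef_class : (nat -> R -> R) -> Prop :=
| GGen i : coef_class (z i)
| GAdd a b : coef_class a -> coef_class b -> coef_class (coef_add a b)
| GMulf a c : coef_class a -> smooth c -> coef_class (coef_mulf a c)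
| GShift a : coef_class a -> coef_class (coef_shift a)
| GDif a : coef_class a -> coef_class (coef_dif a).

Lemma coef_class_entire a : coef_class a -> entire a.
Proof.
elim=> [i|{}a b _ ea _ eb|{}a c _ ea sc|{}a _ ea|{}a _ ea].
- exact: ze.
- exact: entire_add.
- exact: entire_mulf.
- exact: entire_shift.
- exact: entire_dif.
Qed.

Lemma coef_class0 (i : I) : coef_class (fun _ _ => 0).
Proof.
have -> : (fun (_ : nat) (_ : R) => (0 : R)) = coef_mulf (z i) (fun _ => 0).
  by apply/funext => k; apply/funext => x; rewrite /coef_mulf mulr0.
by apply: GMulf; [exact: GGen | exact: smooth_cst].
Qed.

Lemma coef_class_sum (i : I) (r : seq I) (a : I -> nat -> R -> R) : (forall l, coef_class (a l)) ->
  coef_class (fun k x => \sum_(l <- r) a l k x).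
Proof.
move=> ga; elim: r => [|l r IH].
  have -> : (fun (k : nat) x => \sum_(l <- [::]) a l k x) = (fun _ _ => 0).
    by apply/funext => k; apply/funext => x; rewrite big_nil.
  exact: coef_class0.
have -> : (fun (k : nat) x => \sum_(l <- l :: r) a l k x) =
  coef_add (a l) (fun k x => \sum_(l <- r) a l k x).
  by apply/funext => k; apply/funext => x; rewrite big_cons.
exact: GAdd.
Qed.

Lemma coef_class_deriv a : coef_class a -> exists2 a', coef_class a' &
  forall k x, is_derive x (1 : R) (a k) (a' k x).
Proof.
elim=> [i|{}a b _ [a' ga' da] _ [b' gb' db]|{}a c ga [a' ga' da] sc|{}a _ [a' ga' da]|{}a _ [a' ga' da]].
- exists (coef_shift (fun k x => \sum_l coef_mulf (z l) (w l i) k x)).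
    by apply: GShift; apply: (coef_class_sum i) => l; apply: GMulf => //; exact: GGen.
  by move=> [|k] x; apply: is_derive_eq (zd i _ x) _.
- exists (coef_add a' b'); first exact: GAdd.
  by move=> k x; apply: is_derive1D.
- exists (coef_add (coef_mulf a' c) (coef_mulf a ('D_1 c))).
    by apply: GAdd; apply: GMulf => //; exact: smooth_derive.
  by move=> k x; apply: is_derive1M => //; exact: smooth_is_derive.
- exists (coef_shift a'); first exact: GShift.
  by move=> [|k] x; [exact: (@is_derive_cst _ _ _ (0 : R)) | exact: da].
- exists (coef_dif a'); first exact: GDif.
  move=> k x; apply: is_derive_eq (is_derive1M (is_derive_cst _ _ _) (da _ _)) _.
  by rewrite mul0r add0r.
Qed.

Lemma coef_class_differentiable a a' : coef_class a ->
  (forall k x, is_derive x (1 : R) (a k) (a' k x)) -> 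
  forall p, differentiable (eps_series a) p /\
    forall v : R * R, 'D_v (eps_series a) p = v.1 * eps_series (coef_dif a) p + v.2 * eps_series a' p.
Proof.
move=> ga da p; have [b gb db] := coef_class_deriv ga.
have [b' gb' db'] := coef_class_deriv gb.
have -> : a' = b.
  apply/funext => k; apply/funext => x.
  by have [_ <-] := da k x; have [_ <-] := db k x.
by apply: (eps_series_differentiable (a'' := b')) => //; exact: coef_class_entire.
Qed.

Lemma eps_series_smooth a : coef_class a -> smooth (eps_series a).
Proof.
move=> ga.
apply: (smooth_coind (P := fun f => exists2 a, coef_class a & f = eps_series a));
  last by exists a.
  move=> f p [b gb ->]; have [b' _ db] := coef_class_deriv gb.
  by have [] := coef_class_differentiable gb db p.
move=> f v [b gb ->]; have [b' gb' db] := coef_class_deriv gb.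
have g1 : coef_class (coef_mulf (coef_dif b) (fun _ => v.1)).
  by apply: GMulf; [exact: GDif | exact: smooth_cst].
have g2 : coef_class (coef_mulf b' (fun _ => v.2)) by apply: GMulf => //; exact: smooth_cst.
exists (coef_add (coef_mulf (coef_dif b) (fun _ => v.1)) (coef_mulf b' (fun _ => v.2))).
  exact: GAdd.
apply/funext => p; have [_ ->] := coef_class_differentiable gb db p.
rewrite eps_series_add ?eps_series_mulf 1?mulrC 1?[v.2 * _]mulrC //;
  apply: coef_class_entire => //; exact: GDif.
Qed.

End CoefClass.

(** * Linear differential equations with a parameter *)

(** Entrywise, so that the product rule holds for rectangular factors. *)
Definition mderiv (R : realType) m n (F F' : R -> 'M[R]_(m, n)) :=
  forall x i j, is_derive x (1 : R) (fun y => F y i j) (F' x i j).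

Section MDeriv.
Variables (R : realType).

Lemma mderivM m n p (F F' : R -> 'M[R]_(m, n)) (G G' : R -> 'M[R]_(n, p)) :
  mderiv F F' -> mderiv G G' ->
  mderiv (fun x => F x *m G x) (fun x => F' x *m G x + F x *m G' x).
Proof.
move=> dF dG x i j; rewrite !mxE -big_split /=.
under eq_fun do rewrite mxE.
by apply: is_derive1_sum => k; exact: is_derive1M.
Qed.

Lemma mderivD m n (F F' G G' : R -> 'M[R]_(m, n)) : mderiv F F' -> mderiv G G' ->
  mderiv (fun x => F x + G x) (fun x => F' x + G' x).
Proof.
move=> dF dG x i j; rewrite !mxE; under eq_fun do rewrite mxE.
exact: is_derive1D.
Qed.

Lemma mderiv_cst m n (A : 'M[R]_(m, n)) : mderiv (fun _ => A) (fun _ => 0).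
Proof. by move=> x i j; rewrite mxE; exact: is_derive_cst. Qed.

Lemma mderivMl m n p (A : 'M[R]_(m, n)) (G G' : R -> 'M[R]_(n, p)) :
  mderiv G G' -> mderiv (fun x => A *m G x) (fun x => A *m G' x).
Proof.
move=> dG; have := mderivM (mderiv_cst A) dG.
by under [X in mderiv _ X]eq_fun do rewrite mul0mx add0r.
Qed.

Lemma mderivMr m n p (A : 'M[R]_(n, p)) (G G' : R -> 'M[R]_(m, n)) :
  mderiv G G' -> mderiv (fun x => G x *m A) (fun x => G' x *m A).
Proof.
move=> dG; have := mderivM dG (mderiv_cst A).
by under [X in mderiv _ X]eq_fun do rewrite mulmx0 addr0.
Qed.

Lemma mderivN m n (F F' : R -> 'M[R]_(m, n)) : mderiv F F' ->
  mderiv (fun x => - F x) (fun x => - F' x).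
Proof.
move=> dF x i j; rewrite !mxE; under eq_fun do rewrite mxE.
exact: (@is_deriveN _ _ _ (fun y => F y i j)).
Qed.

Lemma mderivT m n (F F' : R -> 'M[R]_(m, n)) : mderiv F F' ->
  mderiv (fun x => (F x)^T) (fun x => (F' x)^T).
Proof. by move=> dF x i j; rewrite !mxE; under eq_fun do rewrite mxE. Qed.

Lemma mderiv_unique m n (F F' G : R -> 'M[R]_(m, n)) : mderiv F F' -> mderiv F G ->
  F' = G.
Proof.
move=> d1 d2; apply/funext => x; apply/matrixP => i j.
by have [_ <-] := d1 x i j; have [_ <-] := d2 x i j.
Qed.

Lemma mderiv0_const m n (F : R -> 'M[R]_(m, n)) x y : mderiv F (fun _ => 0) -> F x = F y.
Proof.
move=> dF; apply/matrixP => i j.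
apply: (@is_derive_0_is_cst _ (fun t => F t i j)) => t.
by have := dF t i j; rewrite mxE.
Qed.

Lemma mderiv_derive1 m n (F F' : R -> 'M[R]_(m, n)) : mderiv F F' -> derive1 F = F'.
Proof.
move=> dF; apply/funext => x; apply/matrixP => i j.
have d : derivable F x 1 by apply/derivable_mxP => k l; have [] := dF x k l.
by rewrite derive1E derive_mx // mxE; have [_] := dF x i j.
Qed.

Lemma smooth_mderiv m n (F : R -> 'M[R]_(m, n)) : smooth F -> mderiv F (derive1 F).
Proof.
move=> sF x i j.
have d : derivable F x 1 by apply: smooth_derivable.
rewrite derive1E derive_mx // mxE; apply: derivableP.
by have /derivable_mxP := d; apply.
Qed.

End MDeriv.

Section ParamODE.
Variables (R : realType) (m : nat) (W : R -> 'M[R]_m) (D : 'M[R]_m).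
Hypothesis Ws : smooth W.

(** A primitive vanishing at 0; the value for discontinuous [f] is a default. *)
Definition prim (f : R -> R) : R -> R :=
  if pselect (continuous f) is left fc then sval (cid (antiderivative fc)) else 0.

Lemma primP (f : R -> R) : continuous f -> (forall x : R, is_derive x 1 (prim f) (f x)) /\ prim f 0 = 0.
Proof. by rewrite /prim; case: pselect => // fc _; exact: (svalP (cid (antiderivative fc))). Qed.

Fixpoint mxpow k : 'M[R]_m := if k is k'.+1 then mxpow k' *m D else 1%:M.
Definition exp_coef k : 'M[R]_m := (k`!%:R)^-1 *: mxpow k.

(** Coefficients of the Dyson series, the formal solution in powers of [eps] of
    [Z_x = eps Z W] with [Z = exp (eps D)] at [x = 0]. *)
Fixpoint dyson_coef k : R -> 'M[R]_m := if k is k'.+1 then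
  fun x => \matrix_(i, j) (prim (fun y => (dyson_coef k' y *m W y) i j) x) + exp_coef k'.+1
  else fun _ => 1%:M.

Lemma dyson_coef_deriv k :
  mderiv (dyson_coef k) (if k is k'.+1 then fun x => dyson_coef k' x *m W x else fun _ => 0).
Proof.
elim: k => [|k IH] /=; first exact: mderiv_cst.
have pc i j : continuous (fun y => (dyson_coef k y *m W y) i j).
  move=> x; apply/differentiable_continuous/derivable1_diffP.
  by have [] := mderivM IH (smooth_mderiv Ws) x i j.
move=> x i j; under eq_fun do rewrite mxE [X in X + _]mxE.
rewrite -[X in is_derive _ _ _ X]addr0; apply: is_derive1D.
  by have [] := primP (pc i j).
Qed.

Lemma dyson_coef0 k : dyson_coef k 0 = exp_coef k.
Proof.
case: k => [|k] /=; first by rewrite /exp_coef /= fact0 invr1 scale1r.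
have pc i j : continuous (fun y => (dyson_coef k y *m W y) i j).
  move=> x; apply/differentiable_continuous/derivable1_diffP.
  by have [] := mderivM (dyson_coef_deriv k) (smooth_mderiv Ws) x i j.
by apply/matrixP => i j; rewrite mxE [X in X + _]mxE; have [_ ->] := primP (pc i j); rewrite add0r.
Qed.

Lemma exp_coef_bound (r : R) : 0 < r -> exists2 M, 0 <= M &
  forall k i j, `|exp_coef k i j| * r ^+ k <= M.
Proof.
move=> r0; pose d := \sum_i \sum_j `|D i j|.
have d0 : 0 <= d by apply: sumr_ge0 => i _; apply: sumr_ge0.
have db k i j : `|mxpow k i j| <= d ^+ k.
  elim: k i j => [|k IH] i j /=.
    by rewrite mxE expr0; case: (i == j); rewrite ?normr1 ?normr0.
  rewrite mxE; apply: le_trans (ler_norm_sum _ _ _) _.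
  apply: (@le_trans _ _ (\sum_l d ^+ k * `|D l j|)).
    by apply: ler_sum => l _; rewrite normrM; apply: ler_wpM2r.
  rewrite -mulr_sumr exprSr; apply: ler_wpM2l; first exact: exprn_ge0.
  apply: ler_sum => l _; rewrite (bigD1 j) //= lerDl; exact: sumr_ge0.
have dr : 0 <= d * r by rewrite mulr_ge0 // ltW.
exists (expR (d * r)); first exact: expR_ge0.
move=> k i j; apply: (@le_trans _ _ ((d * r) ^+ k / k`!%:R)).
  rewrite /exp_coef mxE normrM ger0_norm ?invr_ge0 // exprMn mulrC mulrA [X in _ <= X]mulrC.
  rewrite [r ^+ k * _]mulrC -mulrA; apply: ler_wpM2l; first by rewrite invr_ge0.
  by rewrite mulrC; apply: ler_wpM2r => //; rewrite exprn_ge0 // ltW.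
case: k => [|k]; first by rewrite expr0 fact0 divr1; apply: le_trans (expR_ge1Dx _); rewrite lerDl.
by apply: le_trans (expR_ge1Dxn k dr); rewrite lerDr.
Qed.

(** For a fixed radius [r], induction on [k] bounds the entries of
    [r^k * dyson_coef k x] by [M * expR (L * `|x|)]: one integration costs the
    factor [m * w * r], where [w] bounds [W], and the exponential weight
    compensates it since [L] is larger. The bound [M] at [x = 0] comes from the
    exponential series of [D]. *)
Lemma dyson_coef_entire i j : entire (fun k x => dyson_coef k x i j).
Proof.
move=> X r r0; have [M M0 cM] := exp_coef_bound r0.
have [w w0 wb] : exists2 w, 0 <= w & forall x, `|x| <= X -> forall p q, `|W x p q| <= w.
  have h (pq : 'I_m * 'I_m) : {M : R | forall x, `|x| <= X -> `|W x pq.1 pq.2| <= M}.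
    by apply: cid; apply: smooth_bounded; exact: smooth_coord.
  exists (\sum_pq `|sval (h pq)|); first exact: sumr_ge0.
  move=> x xX p q; rewrite (bigD1 (p, q)) //=.
  apply: le_trans (svalP (h (p, q)) x xX) _; apply: le_trans (ler_norm _) _.
  by rewrite lerDl sumr_ge0.
pose L := m%:R * w * r + 1.
have L0 : 0 <= L by rewrite addr_ge0 // !mulr_ge0 // ltW.
suff key : forall k x p q, `|x| <= X -> `|dyson_coef k x p q| <= M / r ^+ k * expR (L * `|x|).
  exists (M * expR (L * X)) => k x xX; rewrite -ler_pdivlMr ?exprn_gt0 //.
  apply: le_trans (key _ _ _ _ xX) _; rewrite mulrAC; apply: ler_wpM2r.
    by rewrite invr_ge0 exprn_ge0 // ltW.
  by apply: ler_wpM2l => //; rewrite ler_expR; apply: ler_wpM2l.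
have e1 y : 1 <= expR (L * `|y|).
  by rewrite -expR0 ler_expR mulr_ge0.
have c0 k : 0 <= M / r ^+ k by rewrite divr_ge0 // exprn_ge0 // ltW.
have z0b k p' q' : `|dyson_coef k 0 p' q'| <= M / r ^+ k.
  by rewrite dyson_coef0 ler_pdivlMr ?exprn_gt0.
elim=> [|k IH] x p q xX.
  by apply: le_trans (z0b 0%N p q) _; rewrite ler_peMr.
have := @exp_comparison R (fun y => dyson_coef k.+1 y p q) (fun y => (dyson_coef k y *m W y) p q)
  (M / r ^+ k.+1) L x (dyson_coef_deriv k.+1 ^~ p ^~ q).
move=> h; rewrite -[dyson_coef _ x _ _](subrK (dyson_coef k.+1 0 p q)).
apply: le_trans (ler_normD _ _) _.
have -> : M / r ^+ k.+1 * expR (L * `|x|) =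
  M / r ^+ k.+1 * (expR (L * `|x|) - 1) + M / r ^+ k.+1 by ring.
apply: lerD => //; apply: h => y yx.
have yX : `|y| <= X by apply: le_trans yx xX.
rewrite mxE; apply: le_trans (ler_norm_sum _ _ _) _.
apply: (@le_trans _ _ (\sum_(l < m) (M / r ^+ k * expR (L * `|y|)) * w)).
  by apply: ler_sum => l _; rewrite normrM; apply: ler_pM => //; [exact: IH | exact: wb].
rewrite sumr_const card_ord -mulr_natr.
have -> : M / r ^+ k * expR (L * `|y|) * w * m%:R = M / r ^+ k * (w * m%:R) * expR (L * `|y|) by ring.
have -> : M / r ^+ k.+1 * L * expR (L * `|y|) = M / r ^+ k * (L / r) * expR (L * `|y|).
  by rewrite exprS; field; rewrite expf_neq0 ?lt0r_neq0.
apply: ler_wpM2r; first exact: expR_ge0.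
apply: ler_wpM2l; first exact: c0.
by rewrite ler_pdivlMr // /L [w * _]mulrC lerDl.
Qed.

Definition dyson (p : R * R) : 'M[R]_m := \matrix_(i, j) eps_series (fun k x => dyson_coef k x i j) p.

Let dyson_row i q k x := dyson_coef k x i q.
Let dyson_row_d i q k x : is_derive x (1 : R) (dyson_row i q k)
  (if k is k'.+1 then \sum_l dyson_row i l k' x * W x l q else 0).
Proof.
by have h := dyson_coef_deriv k x i q; case: k h => [|k] h; apply: is_derive_eq h _; rewrite mxE.
Qed.
Let Wsm l q : smooth (fun x => W x l q). Proof. exact: smooth_coord. Qed.
Let dyson_row_class i q := @GGen R _ (dyson_row i) q.

Lemma dyson_smooth : smooth dyson.
Proof.
apply: smooth_mx => i j; under eq_fun do rewrite mxE.
exact: (eps_series_smooth (fun q => dyson_coef_entire i q) Wsm (dyson_row_d i) (dyson_row_class i j)).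
Qed.

Lemma dyson0 x : dyson (0, x) = 1%:M.
Proof. by apply/matrixP => i j; rewrite mxE eps_series0 //; exact: dyson_coef_entire. Qed.

Lemma dyson_coef_entire_all i : forall q, entire (dyson_row i q).
Proof. by move=> q; exact: dyson_coef_entire. Qed.

Lemma dyson_row_sum i (c : 'I_m -> R -> R) p : (forall l, smooth (c l)) ->
  eps_series (fun k x => \sum_l coef_mulf (dyson_row i l) (c l) k x) p = \sum_l dyson p i l * c l p.2.
Proof.
move=> sc; rewrite eps_series_sum => [|l]; last by apply: entire_mulf => //; exact: dyson_coef_entire.
by apply: eq_bigr => l _; rewrite eps_series_mulf ?mxE //; exact: dyson_coef_entire.
Qed.

Lemma dyson_deriv_x e : mderiv (fun x => dyson (e, x)) (fun x => e *: (dyson (e, x) *m W x)).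
Proof.
move=> x i j; under eq_fun do rewrite mxE.
have [a' ga' da] := coef_class_deriv Wsm (dyson_row_d i) (dyson_row_class i j).
have [df D0] := coef_class_differentiable (dyson_coef_entire_all i) Wsm
  (dyson_row_d i) (dyson_row_class i j) da (e, x).
have ea' : a' = coef_shift (fun k x => \sum_l coef_mulf (dyson_row i l) (fun x => W x l j) k x).
  apply/funext => k; apply/funext => y; have [_ <-] := da k y.
  by have [_ ->] := dyson_row_d i j k y; case: k.
have d : derivable (fun y => eps_series (dyson_row i j) (e, y)) x 1.
  apply/diff_derivable/smooth_differentiable/smooth_slice.
  exact: (eps_series_smooth (dyson_coef_entire_all i) Wsm (dyson_row_d i) (dyson_row_class i j)).
apply: DeriveDef => //.
rewrite derive_slice_snd D0 /= mul0r add0r mul1r ea' eps_series_shift; last first.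
  by apply: entire_sum => l; apply: entire_mulf => //; exact: dyson_coef_entire.
by rewrite dyson_row_sum // !mxE.
Qed.

Lemma dyson_deriv_eps x i j e : is_derive e (1 : R) (fun e => dyson (e, x) i j)
  (eps_series (coef_dif (dyson_row i j)) (e, x)).
Proof.
under eq_fun do rewrite mxE.
have [a' ga' da] := coef_class_deriv Wsm (dyson_row_d i) (dyson_row_class i j).
have [df D0] := coef_class_differentiable (dyson_coef_entire_all i) Wsm
  (dyson_row_d i) (dyson_row_class i j) da (e, x).
have d : derivable (fun e => eps_series (dyson_row i j) (e, x)) e 1.
  apply: diff_derivable.
  by apply: (@differentiable_comp _ _ _ _ (fun y : R => (y, x)) (eps_series (dyson_row i j))) => //;
    apply: differentiable_pair.
apply: DeriveDef => //.
by rewrite derive_slice_fst D0 /= mul0r addr0 mul1r.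
Qed.

(** The coefficient of [eps] is the primitive of [W] with value [D] at 0. *)
Lemma dyson_deriv_eps0 H x : mderiv H W -> H 0 = D ->
  forall i j, is_derive 0 (1 : R) (fun e => dyson (e, x) i j) (H x i j).
Proof.
move=> HW H0 i j; apply: is_derive_eq (dyson_deriv_eps x i j 0) _.
rewrite eps_series0; last by apply: entire_dif; exact: dyson_coef_entire.
rewrite /coef_dif mul1r /dyson_row; suff -> : dyson_coef 1 x = H x by [].
apply/eqP; rewrite -subr_eq0; apply/eqP.
have d : mderiv (fun x => dyson_coef 1 x - H x) (fun _ => 0).
  have h := mderivD (dyson_coef_deriv 1) (mderivN HW).
  move=> y p q; apply: is_derive_eq (h y p q) _.
  by rewrite /= mul1mx subrr.
rewrite (mderiv0_const x 0 d) dyson_coef0 H0 /exp_coef /= mul1mx.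
by rewrite (_ : 1`! = 1)%N // invr1 scale1r subrr.
Qed.

(** On the line [x = 0] the series is the exponential of [eps * D]. *)
Lemma dyson_deriv_x0 : mderiv (fun e => dyson (e, 0)) (fun e => dyson (e, 0) *m D).
Proof.
move=> e i j; apply: is_derive_eq (dyson_deriv_eps 0 i j e) _.
have e1 k : coef_dif (dyson_row i j) k 0 = \sum_l dyson_row i l k 0 * D l j.
  rewrite /coef_dif /dyson_row dyson_coef0 /exp_coef mxE mxE mulr_sumr mulr_sumr.
  apply: eq_bigr => l _; rewrite dyson_coef0 mxE factS natrM invfM.
  have n0 : k.+1%:R != 0 :> R by rewrite pnatr_eq0.
  have f0 : k`!%:R != 0 :> R by rewrite pnatr_eq0 -lt0n fact_gt0.
  by move: (k.+1%:R : R) (k`!%:R : R) n0 f0 => a c a0 c0; field; rewrite a0 c0.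
rewrite [RHS]mxE -(@dyson_row_sum i (fun l _ => D l j) (e, 0)); last by move=> l; exact: smooth_cst.
by apply: eps_series_eq => k /=; exact: e1.
Qed.

End ParamODE.

(** * The form, the Lie algebra and the space [V_n] *)

Section LinAlg.
Variables (R : realType) (n : nat).
Local Notation N := (2 * n).+1.
Local Notation C := (C_ R n).
Local Notation b := (b_ R n).
Implicit Types (A B : 'M[R]_N) (i j : 'I_N).

Lemma e_E (p q : nat) i j : (0 < p <= N)%N -> (0 < q <= N)%N ->
  e_ R n p q i j = ((i.+1 == p) && (j.+1 == q))%:R.
Proof.
move=> /andP[p0 pN] /andP[q0 qN]; rewrite mxE; congr ((_ && _)%:R).
  by rewrite -val_eqE /= inordK ?prednK //; case: p p0 {pN} => //.
by rewrite -val_eqE /= inordK ?prednK //; case: q q0 {qN} => //.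
Qed.

Lemma C_E i j : C i j = if (i + j == 2 * n)%N then (-1) ^+ (n + i) else 0.
Proof.
rewrite /C_ summxE big_add1 /= big_mkord (bigD1 i) //= big1 ?addr0.
  rewrite mxE e_E //; try by have := ltn_ord i; lia.
  rewrite eqxx /= (_ : (n + i.+1 - 1 = n + i)%N); last by lia.
  have -> : (j.+1 == (2 * n + 2 - i.+1)%N) = (i + j == 2 * n)%N.
    by apply/eqP/eqP; have := ltn_ord i; lia.
  by case: ifP; rewrite ?mulr1 ?mulr0.
move=> k ki; rewrite mxE e_E ?(ltn_ord k) //; last by have := ltn_ord k; lia.
have -> : (i.+1 == k.+1) = false by apply/negbTE; rewrite eqSS eq_sym.
by rewrite mulr0.
Qed.

Lemma b_E i j : b i j = (i == j.+1 :> nat)%:R.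
Proof.
rewrite /b_ summxE big_add1 /= big_mkord.
have [jn|jn] := ltnP j (2 * n).
  rewrite (bigD1 (Ordinal jn)) //= big1 ?addr0.
    rewrite e_E //; try by lia.
    by rewrite eqxx andbT eqSS.
  move=> k ki; rewrite e_E; try by have := ltn_ord k; lia.
  have -> : (j.+1 == k.+1) = false.
    by apply/negbTE; apply: contra ki => /eqP [jk]; apply/eqP/val_inj.
  by rewrite andbF.
rewrite big1 => [|k _].
  by have -> : (i == j.+1 :> nat) = false by apply/negbTE/eqP; have := ltn_ord i; lia.
rewrite e_E; try by have := ltn_ord k; lia.
have -> : (j.+1 == k.+1) = false by apply/negbTE/eqP; have := ltn_ord k; lia.
by rewrite andbF.
Qed.

Lemma beta_E k i j : (0 < k <= n)%N ->
  beta_ R n k i j = ((i + k == n)%N && (j.+1 == (n + k)%N))%:R +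
    ((i + k == n.+1)%N && (nat_of_ord j == (n + k)%N))%:R.
Proof.
move=> kn; rewrite /beta_ mxE !e_E; try by lia.
by congr ((_ && _)%:R + (_ && _)%:R); lia.
Qed.

Lemma C_tr : C^T = C.
Proof.
apply/matrixP => i j; rewrite mxE !C_E addnC; case: eqP => // ij.
by rewrite -[LHS]signr_odd -[RHS]signr_odd (_ : odd (n + j) = odd (n + i)) //; lia.
Qed.

Lemma mulCE m (A : 'M[R]_(N, m)) i (j : 'I_m) : (C *m A) i j = (-1) ^+ (n + i) * A (rev_ord i) j.
Proof.
rewrite mxE (bigD1 (rev_ord i)) //= big1 ?addr0.
  by rewrite C_E /= ifT //; have := ltn_ord i; lia.
move=> k ki; rewrite C_E ifF ?mul0r //; apply/negbTE; apply: contra ki => /eqP e.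
by apply/eqP/val_inj => /=; have := ltn_ord i; lia.
Qed.

Lemma CC : C *m C = 1%:M.
Proof.
apply/matrixP => i j; rewrite mulCE C_E !mxE /=.
have -> : (N - i.+1 + j == 2 * n)%N = (i == j).
  by rewrite -val_eqE /=; have := ltn_ord i; have := ltn_ord j; lia.
case: eqP => [_|//]; rewrite ?mulr0 // -exprD.
have -> : (n + i + (n + (N - i.+1)) = 2 * (2 * n))%N by have := ltn_ord i; lia.
by rewrite exprM sqrrN !expr1n.
Qed.

(** Skew-symmetry of [C A]; up to signs, [C] reverses the order of the rows. *)
Lemma in_oP A : in_o A <-> forall i j,
  (-1) ^+ i * A (rev_ord i) j + (-1) ^+ j * A (rev_ord j) i = 0.
Proof.
have e i j : (A^T *m C + C *m A) i j =
   (-1) ^+ n * ((-1) ^+ i * A (rev_ord i) j + (-1) ^+ j * A (rev_ord j) i).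
  rewrite mxE mulCE (_ : (A^T *m C) i j = (C *m A) j i); last first.
    by rewrite (_ : A^T *m C = (C *m A)^T) ?mxE // trmx_mul C_tr.
  by rewrite mulCE !exprD; ring.
split=> [oA i j|oA].
  have := e i j; rewrite oA mxE => /esym/eqP; rewrite mulf_eq0 signr_eq0 /=.
  by move/eqP.
by apply/matrixP => i j; rewrite e oA mulr0 mxE.
Qed.

Lemma in_oD A B : in_o A -> in_o B -> in_o (A + B).
Proof.
rewrite /in_o => oA oB; rewrite raddfD /= mulmxDl mulmxDr addrACA oA oB; exact: addr0.
Qed.

Lemma in_oN A : in_o A -> in_o (- A).
Proof. by rewrite /in_o => oA; rewrite raddfN /= mulNmx mulmxN -opprD oA oppr0. Qed.

Lemma in_oZ a A : in_o A -> in_o (a *: A).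
Proof. by rewrite /in_o => oA; rewrite linearZ /= -scalemxAl -scalemxAr -scalerDr oA scaler0. Qed.

Lemma in_o0 : in_o (0 : 'M[R]_N).
Proof. by rewrite /in_o trmx0 mul0mx mulmx0 addr0. Qed.

Lemma in_oE A : in_o A <-> A^T *m C = - (C *m A).
Proof. by rewrite /in_o; split => [/eqP|->]; rewrite ?addr_eq0 ?addNr // => /eqP. Qed.

Lemma in_o_tr A : in_o A -> C *m A^T = - (A *m C).
Proof.
move=> /in_oE oA.
by rewrite -[LHS]mulmx1 -CC mulmxA -[C *m _ *m C]mulmxA oA mulmxN mulmxA CC mul1mx mulNmx.
Qed.

Lemma in_o_comm A B : in_o A -> in_o B -> in_o (A *m B - B *m A).
Proof.
rewrite !in_oE => oA oB; rewrite raddfB /= !trmx_mul mulmxBl -!mulmxA oA oB !mulmxN !mulmxA oA oB.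
by rewrite !mulNmx !opprK mulmxBr opprB !mulmxA.
Qed.

Lemma in_o_b : in_o b.
Proof.
apply/in_oP => i j; rewrite !b_E /=.
have -> : (N - i.+1 == j.+1)%N = (i + j.+1 == 2 * n)%N by have := ltn_ord i; lia.
have -> : (N - j.+1 == i.+1)%N = (i + j.+1 == 2 * n)%N by have := ltn_ord j; lia.
case: eqP => [ij|_]; last by rewrite !mulr0 addr0.
rewrite !mulr1 -signr_odd -[X in _ + X]signr_odd.
have := congr1 odd ij; rewrite oddD oddM /=.
by case: (odd i); case: (odd j) => //= _; rewrite ?expr0 ?expr1 ?addNr ?subrr.
Qed.

Lemma in_o_beta k : (0 < k <= n)%N -> in_o (beta_ R n k).
Proof.
move=> kn; apply/in_oP => i j; rewrite !beta_E //=.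
have -> : (N - i.+1 + k == n)%N = (nat_of_ord i == (n + k)%N) by have := ltn_ord i; lia.
have -> : (N - i.+1 + k == n.+1)%N = (i.+1 == n + k)%N by have := ltn_ord i; lia.
have -> : (N - j.+1 + k == n)%N = (nat_of_ord j == (n + k)%N) by have := ltn_ord j; lia.
have -> : (N - j.+1 + k == n.+1)%N = (j.+1 == n + k)%N by have := ltn_ord j; lia.
have [i1|i1] := eqVneq (nat_of_ord i) (n + k)%N; have [j1|j1] := eqVneq (nat_of_ord j) (n + k)%N;
have [i2|i2] := eqVneq i.+1 (n + k)%N; have [j2|j2] := eqVneq j.+1 (n + k)%N => //=;
rewrite ?mulr0 ?addr0 ?add0r ?mulr1 ?mulr0 ?addr0 //; try lia.
  by rewrite i1 -j2 exprS mulN1r addNr.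
by rewrite j1 -i2 exprS mulN1r subrr.
Qed.

Lemma in_V_o A : in_V A -> in_o A.
Proof.
move=> [c ->]; rewrite big_nat; elim/big_ind: _ => [|x y ox oy|k kn].
- exact: in_o0.
- exact: in_oD.
- by apply/in_oZ/in_o_beta; lia.
Qed.

Lemma in_V_upper A i j : in_V A -> (j <= i)%N -> A i j = 0.
Proof.
move=> [c ->] ji; rewrite summxE big_nat big1 // => k kn.
rewrite mxE beta_E; last by lia.
have -> : (i + k == n)%N && (j.+1 == (n + k)%N) = false by lia.
have -> : (i + k == n.+1)%N && (nat_of_ord j == (n + k)%N) = false by lia.
by rewrite addr0 mulr0.
Qed.

Lemma in_V_left A i j : in_V A -> (j < n)%N -> A i j = 0.
Proof.
move=> [c ->] ji; rewrite summxE big_nat big1 // => k kn.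
rewrite mxE beta_E; last by lia.
have -> : (i + k == n)%N && (j.+1 == (n + k)%N) = false by lia.
have -> : (i + k == n.+1)%N && (nat_of_ord j == (n + k)%N) = false by lia.
by rewrite addr0 mulr0.
Qed.

Lemma in_VD A B : in_V A -> in_V B -> in_V (A + B).
Proof.
move=> [c ->] [d ->]; exists (fun k : nat => c k + d k).
by rewrite -big_split /=; apply: eq_bigr => i _; rewrite scalerDl.
Qed.

Lemma in_VZ a A : in_V A -> in_V (a *: A).
Proof.
move=> [c ->]; exists (fun k : nat => a * c k).
by rewrite scaler_sumr; apply: eq_bigr => i _; rewrite scalerA.
Qed.

Lemma in_O_inv A : in_O A -> (C *m A^T *m C) *m A = 1%:M /\ A *m (C *m A^T *m C) = 1%:M.
Proof.
move=> oA; have h : (C *m A^T *m C) *m A = 1%:M by rewrite -!mulmxA [A^T *m _]mulmxA oA CC.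
by split => //; apply: mulmx1C.
Qed.

Lemma in_O_tr A : A *m C *m A^T = C -> in_O A.
Proof.
move=> h; have h1 : A *m (C *m A^T *m C) = 1%:M by rewrite !mulmxA h CC.
have e := mulmx1C h1.
by rewrite /in_O -[LHS]mul1mx -CC -[RHS]mulmx1 -e !mulmxA.
Qed.

Lemma in_OM A B : in_O A -> in_O B -> in_O (A *m B).
Proof.
move=> oA oB; rewrite /in_O trmx_mul -!mulmxA [A^T *m _]mulmxA [A^T *m C *m _]mulmxA oA.
by rewrite mulmxA oB.
Qed.

Lemma inner_O A X Y : in_O A -> inner (A *m X) (A *m Y) = inner X Y.
Proof.
move=> oA; rewrite /inner trmx_mul -!mulmxA [A^T *m _]mulmxA [A^T *m C *m _]mulmxA oA.
by rewrite mulmxA.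
Qed.

Lemma innerE (X Y : 'cV[R]_N) : inner X Y = \sum_(i < N) (-1) ^+ (n + i) * X i 0 * Y (rev_ord i) 0.
Proof.
rewrite /inner -mulmxA mxE; apply: eq_bigr => i _.
by rewrite mulCE mxE; ring.
Qed.

Lemma inner_bilin (I J : Type) (r : seq I) (s : seq J) (c : I -> R) (d : J -> R)
   (X : I -> 'cV[R]_N) (Y : J -> 'cV[R]_N) :
  inner (\sum_(i <- r) c i *: X i) (\sum_(j <- s) d j *: Y j) =
  \sum_(i <- r) \sum_(j <- s) c i * d j * inner (X i) (Y j).
Proof.
rewrite /inner (raddf_sum (@trmx R N 1)) /= !mulmx_suml summxE; apply: eq_bigr => i _.
rewrite mulmx_sumr summxE; apply: eq_bigr => j _.
rewrite (_ : (c i *: X i)^T = c i *: (X i)^T); last by apply/matrixP => p q; rewrite !mxE.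
by rewrite -!scalemxAl -scalemxAr !mxE; ring.
Qed.

End LinAlg.

(** * Curves with a given frame equation *)

Section Frame.
Variables (R : realType) (n : nat).
Local Notation N := (2 * n).+1.
Local Notation C := (C_ R n).
Local Notation b := (b_ R n).

Section Jets.
Variables (h v : R -> 'M[R]_N).
Hypothesis hd : mderiv h (fun x => h x *m (b + v x)).
Hypothesis ho : forall x, in_O (h x).
Hypothesis vs : smooth v.
Hypothesis vV : forall x, in_V (v x).
Let gam := fun x => h x *m (e1 : vec R n).

Definition unitri k (q : 'cV[R]_N) := forall i : 'I_N, (k <= i)%N -> q i 0 = (i == k :> nat)%:R.

(** The coordinates [q] of a derivative of [gam] in the frame become
    [q' + (b + v) q] for the next one. As [b] shifts the basis and [v] is
    strictly upper triangular, they remain unitriangular. Up to order [n] there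
    is no correction at all, because the first [n] columns of [v] vanish. *)
Lemma jet_coeffs k : (k <= 2 * n)%N -> exists q : R -> 'cV[R]_N,
  [/\ smooth q, forall x, derive1n k gam x = h x *m q x, forall x, unitri k (q x)
    & (k <= n)%N -> forall x, q x = delta_mx (inord k) 0].
Proof.
elim: k => [|k IH] kn.
  exists (fun _ => e1); split.
  - exact: smooth_cst.
  - by [].
  - by move=> x i _; rewrite /e1 mxE eqxx andbT.
  - move=> _ x; rewrite /e1; congr delta_mx; apply/val_inj; rewrite /= inordK //.
have [q [qs qd qu qn]] := IH (ltnW kn).
exists (fun x => derive1 q x + (b + v x) *m q x); split.
- apply: smooth_addmx; first exact: smooth_derive1.
  by apply: smooth_mulmx => //; apply: smooth_addmx => //; exact: smooth_cst.
- move=> x; rewrite derive1nS (_ : derive1n k gam = fun x => h x *m q x); last exact/funext.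
  rewrite (mderiv_derive1 (mderivM hd (smooth_mderiv qs))).
  by rewrite -mulmxA -mulmxDr addrC.
- move=> x i ki.
  have q' : derive1 q x i 0 = 0.
    have [_ <-] := smooth_mderiv qs x i 0.
    have -> : (fun y => q y i 0) = cst ((i == k :> nat)%:R).
      by apply/funext => y; apply: qu; exact: ltnW.
    exact: derive_cst.
  rewrite mxE q' add0r mulmxDl mxE [X in _ + X]mxE [X in _ + X]big1 ?addr0; last first.
    move=> j _; have [ij|ij] := leqP j i; first by rewrite in_V_upper ?mul0r.
    rewrite (qu x j) ?(leq_trans (ltnW ki) (ltnW ij)) //.
    by rewrite (_ : (j == k :> nat) = false) ?mulr0 //; lia.
  rewrite mxE (bigD1 (inord i.-1)) //= big1 ?addr0.
    rewrite b_E inordK; last by have := ltn_ord i; lia.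
    rewrite prednK; last by lia.
    rewrite eqxx mul1r qu inordK; try by have := ltn_ord i; lia.
    by congr (_%:R); lia.
  move=> j ji; rewrite b_E.
  have -> : (i == j.+1 :> nat) = false.
    apply/negbTE; apply: contra ji => /eqP ij; apply/eqP/val_inj.
    by rewrite /= inordK ij //= -ij ltnW.
  by rewrite mul0r.
- move=> kn' x; have qE y := qn (ltnW kn') y.
  have -> : derive1 q x = 0.
    have -> : q = cst (delta_mx (inord k) 0) by apply/funext.
    by rewrite derive1_cst.
  rewrite add0r qE -colE; apply/matrixP => i j; rewrite ord1 {j}.
  have k2 : (k < N)%N by lia.
  have vk : v x i (inord k) = 0 by apply: in_V_left => //; rewrite inordK.
  rewrite mxE [LHS]mxE vk addr0 b_E inordK // [RHS]mxE andbT -val_eqE /=.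
  by rewrite inordK //; lia.
Qed.

(** In the frame the jet is a unitriangular matrix. The coefficients of a
    vanishing combination are eliminated from the last one down. *)
Lemma frame_jet_free x : free (jet gam N x).
Proof.
(* The [q] of [jet_coeffs], extended by 0 to all [k]. *)
pose q k := if (k <= 2 * n)%N =P true is ReflectT kn then sval (cid (jet_coeffs kn)) else fun _ => 0.
have qP k : (k <= 2 * n)%N -> derive1n k gam x = h x *m q k x /\ unitri k (q k x).
  by rewrite /q; case: eqP => // kn _; case: (svalP (cid (jet_coeffs kn))).
have [hi _] := in_O_inv (ho x).
have szj : size (jet gam N x) = N by rewrite size_map size_iota.
have jE (i : 'I_N) : (jet gam N x)`_i = h x *m q i x.
  rewrite (nth_map 0%N) ?size_iota // nth_iota // add0n.
  have i2 : (i <= 2 * n)%N by rewrite -ltnS.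
  by have [] := qP i i2.
rewrite -[jet _ _ _]/(tval (Tuple (introT eqP szj))).
apply/freeP => c c0.
have {}c0 : \sum_(i < N) c i *: q i x = 0.
  rewrite -[LHS]mul1mx -hi -[LHS]mulmxA.
  rewrite [X in _ *m X](_ : _ = 0) ?mulmx0 // -[RHS]c0 mulmx_sumr.
  by apply: eq_bigr => i _; rewrite -scalemxAr -jE.
suff key d (i : 'I_N) : (N - d <= i)%N -> c i = 0 by move=> i; apply: (key N); rewrite subnn.
elim: d i => [|d IH] i di; first by have := ltn_ord i; lia.
have [di'|di'] := leqP (N - d) i; first exact: IH.
have := congr1 (fun M : 'cV[R]_N => M i 0) c0; rewrite summxE mxE (bigD1 i) //= big1 ?addr0.
  have i2 : (i <= 2 * n)%N by rewrite -ltnS.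
  by rewrite mxE; have [_ ->] := qP i i2; rewrite ?eqxx ?mulr1.
move=> k ki; rewrite mxE; have [ki'|ki'] := ltnP k i.
  have k2 : (k <= 2 * n)%N by rewrite -ltnS.
  have [_ ->] := qP k k2; rewrite ?(ltnW ki') //.
  by rewrite (_ : (i == k :> nat) = false) ?mulr0 //; lia.
rewrite IH ?mul0r //.
have : (i != k :> nat) by apply: contra ki => /eqP ik; apply/eqP/val_inj.
lia.
Qed.

Lemma frame_jet k x : (k <= n)%N -> derive1n k gam x = h x *m delta_mx (inord k) 0.
Proof.
move=> kn; have [q [_ -> _ ->]] := @jet_coeffs k ltac:(lia); by [].
Qed.

Lemma inner_delta (i j : 'I_N) : inner (delta_mx i 0 : vec R n) (delta_mx j 0) = C i j.
Proof.
rewrite /inner -mulmxA -[C *m _]colE mxE (bigD1 i) //= big1 ?addr0.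
  by rewrite !mxE !eqxx mul1r.
by move=> k ki; rewrite !mxE (negbTE ki) mul0r.
Qed.

(** In the frame, the jet of order [n] spans the first [n] basis vectors. A vector
    orthogonal to them has no component beyond the middle one, and its square
    is then the square of the middle component. *)
Lemma frame_maximal x : maximal_isotropic <<jet gam n x>>%VS.
Proof.
have [hi hi'] := in_O_inv (ho x).
have jm X : X \in jet gam n x -> exists2 i : nat, (i < n)%N & X = h x *m delta_mx (inord i) 0.
  move=> /mapP[i]; rewrite mem_iota => /andP[_ i_n] ->; exists i => //.
  by apply: frame_jet; apply: ltnW.
have iso0 (i j : nat) : (i < n)%N -> (j < n)%N ->
    inner (h x *m delta_mx (inord i) 0) (h x *m delta_mx (inord j) 0) = 0.
  move=> i_n jn; rewrite inner_O // inner_delta C_E !inordK; try lia.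
  by rewrite ifF //; lia.
split.
  move=> X Y; set s := in_tuple (jet gam n x).
  rewrite -[jet gam n x]/(tval s) => /coord_span -> /coord_span ->.
  rewrite inner_bilin big1 // => i _; rewrite big1 // => j _.
  have sn : size (jet gam n x) = n by rewrite size_map size_iota.
  have /jm[i' i'n ->] : s`_i \in jet gam n x by apply: mem_nth; exact: ltn_ord.
  have /jm[j' j'n ->] : s`_j \in jet gam n x by apply: mem_nth; exact: ltn_ord.
  by rewrite iso0 // mulr0.
move=> W' isoW' sub; apply/eqP; rewrite eqEsubv sub andbT; apply/subvP => X XW'.
pose Y := C *m (h x)^T *m C *m X.
have XE : X = h x *m Y by rewrite /Y mulmxA hi' mul1mx.
have jin (i : nat) : (i < n)%N -> h x *m delta_mx (inord i) 0 \in <<jet gam n x>>%VS.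
  move=> i_n; apply: memv_span; rewrite -frame_jet ?(ltnW i_n) //.
  by apply/mapP; exists i => //; rewrite mem_iota.
have Yhigh (j : 'I_N) : (n < j)%N -> Y j 0 = 0.
  move=> nj; have i_n : (rev_ord j < n)%N by rewrite /=; have := ltn_ord j; lia.
  have := isoW' _ _ (subvP sub _ (jin _ i_n)) XW'; rewrite {1}XE inner_O //.
  rewrite inord_val innerE (bigD1 (rev_ord j)) //= big1 ?addr0.
    rewrite !mxE !eqxx rev_ordK mulr1 => /eqP; rewrite mulf_eq0 signr_eq0 /=.
    by move/eqP.
  by move=> k kj; rewrite !mxE (negbTE kj) mulr0 mul0r.
have nN : (n < N)%N by lia.
have Yn (j : 'I_N) : j = n :> nat -> Y j 0 = 0.
  move=> jn; have := isoW' _ _ XW' XW'; rewrite {1 2}XE inner_O // innerE.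
  have rj : rev_ord j = j by apply/val_inj => /=; lia.
  rewrite (bigD1 j) //= big1 ?addr0.
    rewrite rj jn addnn -mul2n exprM sqrrN !expr1n mul1r => /eqP.
    by rewrite mulf_eq0 orbb => /eqP.
  move=> k kj; have [nk|nk] := ltnP n k; first by rewrite Yhigh // mulr0 mul0r.
  rewrite [Y (rev_ord k) 0]Yhigh ?mulr0 //=.
  have : (k != j :> nat) by apply: contra kj => /eqP e; apply/eqP/val_inj.
  lia.
rewrite XE (matrix_sum_delta Y) mulmx_sumr; apply: memv_suml => i _.
rewrite big_ord1 -scalemxAr.
have [i_n|ni] := ltnP i n; first by apply: memvZ; rewrite -[i]inord_val; apply: jin.
have -> : Y i 0 = 0.
  by move: ni; rewrite leq_eqVlt => /orP[/eqP/esym/Yn|/Yhigh].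
by rewrite scale0r mem0v.
Qed.

Lemma frame_in_M : smooth h -> in_M gam.
Proof.
move=> hs; split; last first.
  move=> x; rewrite frame_jet // inner_O // inner_delta C_E !inordK; try lia.
  by rewrite addnn -mul2n eqxx exprM sqrrN !expr1n.
split; last by move=> s; split; [exact: frame_jet_free | exact: frame_maximal].
by apply: smooth_mulmx => //; exact: smooth_cst.
Qed.
End Jets.

Lemma in_o_conj (g w : 'M[R]_N) : in_O g -> in_o w -> in_o (g *m w *m (C *m g^T *m C)).
Proof.
move=> og ow; have [hi hi'] := in_O_inv og.
apply/in_oE; rewrite !trmx_mul !trmxK !C_tr.
have -> : C *m (g *m C) *m (w^T *m g^T) *m C = C *m g *m (C *m w^T *m C) *m (C *m g^T *m C).
  transitivity (C *m g *m C *m w^T *m (C *m C) *m g^T *m C); last by rewrite !mulmxA.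
  by rewrite CC mulmx1 !mulmxA.
have -> : C *m w^T *m C = - w by rewrite (in_o_tr ow) mulNmx -mulmxA CC mulmx1.
by rewrite !mulmxN !mulNmx !mulmxA.
Qed.

(** The equation for [K] linearizes [g^-1 g_x = b + u] in the direction [w].
    With [h_eps = Z g], the frame equation with curvature [u + eps w] becomes
    [Z_x = eps Z W]. The initial value of [Z] is [exp (eps D)], where [D] is the
    value at 0 of [H = g K g^-1]: as [H' = W], the [eps]-derivative of [Z] at
    [eps = 0] is then [H], and that of [h_eps e_1] is [g K e_1]. *)
Lemma tangent_of_gauge (g u K w : R -> 'M[R]_N) :
  smooth g -> (forall x, in_O (g x)) ->
  mderiv g (fun x => g x *m (b + u x)) -> smooth u -> (forall x, in_V (u x)) ->
  smooth w -> (forall x, in_V (w x)) ->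
  smooth K -> in_o (K 0) ->
  mderiv K (fun x => w x - ((b + u x) *m K x - K x *m (b + u x))) ->
  tangent (fun x => g x *m e1) (fun x => g x *m (K x *m e1)).
Proof.
move=> gs og gd us uV ws wV Ks K0 Kd.
pose gi x := C *m (g x)^T *m C.
have gig x : gi x *m g x = 1%:M by have [] := in_O_inv (og x).
have ggi x : g x *m gi x = 1%:M by have [] := in_O_inv (og x).
have gis : smooth gi.
  by apply: smooth_mulmx; [apply: smooth_mulmx; [|exact: smooth_trmx]|]; exact: smooth_cst.
pose W x := g x *m w x *m gi x.
have Ws : smooth W by apply: smooth_mulmx => //; exact: smooth_mulmx.
have Wo x : in_o (W x) by apply: in_o_conj => //; exact: in_V_o.
pose H x := g x *m K x *m gi x.
have Ho : in_o (H 0) by exact: in_o_conj.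
have gid : mderiv gi (fun x => - ((b + u x) *m gi x)).
  have := mderivMr C (mderivMl C (mderivT gd)).
  suff -> : (fun x => C *m (g x *m (b + u x))^T *m C) = (fun x => - ((b + u x) *m gi x)) by [].
  apply/funext => x; have /in_o_tr h : in_o (b + u x) by apply: in_oD; [exact: in_o_b|exact: in_V_o].
  by rewrite trmx_mul mulmxA h !mulNmx /gi !mulmxA.
have Hd : mderiv H W.
  have h := mderivM (mderivM gd Kd) gid.
  suff -> : W = (fun x => (g x *m (b + u x) *m K x +
      g x *m (w x - ((b + u x) *m K x - K x *m (b + u x)))) *m gi x +
      g x *m K x *m - ((b + u x) *m gi x)) by [].
  apply/funext => x; rewrite /W mulmxN [g x *m K x *m (_ *m _)]mulmxA -mulmxBl; congr (_ *m _).
  by rewrite -!mulmxA -mulmxDr -mulmxBr; congr (_ *m _); rewrite opprB addrCA subrKC addrK.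
pose Z := dyson W (H 0).
have Zs : smooth Z := dyson_smooth (H 0) Ws.
(* Along a solution of [A' = A X] with [X] in the Lie algebra, [A C A^T] is
   constant. *)
have oconst (A X : R -> 'M[R]_N) : mderiv A (fun t => A t *m X t) -> (forall t, in_o (X t)) ->
    A 0 *m C *m (A 0)^T = C -> forall t, A t *m C *m (A t)^T = C.
  move=> Ad Xo A0 t; rewrite -[RHS]A0.
  apply: (@mderiv0_const _ _ _ (fun t => A t *m C *m (A t)^T)).
  have := mderivM (mderivMr C Ad) (mderivT Ad).
  suff -> : (fun x => A x *m X x *m C *m (A x)^T + A x *m C *m (A x *m X x)^T) = (fun _ => 0) by [].
  apply/funext => y; have h := in_o_tr (Xo y).
  by rewrite trmx_mul -!mulmxA [C *m (_ *m _)]mulmxA h mulNmx !mulmxN -!mulmxA addrN.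
have ZO e x : in_O (Z (e, x)).
  apply: in_O_tr; apply: (oconst (fun x => Z (e, x)) (fun x => e *: W x)).
  - by under [X in mderiv _ X]eq_fun do rewrite -scalemxAr; exact: dyson_deriv_x.
  - by move=> t; apply: in_oZ.
  - apply: (oconst (fun e => Z (e, 0)) (fun _ => H 0)) => //.
      exact: dyson_deriv_x0.
    by rewrite /= /Z dyson0 // trmx1 mulmx1 mul1mx.
pose h e x := Z (e, x) *m g x.
have hs e : smooth (h e) by apply: smooth_mulmx => //; exact: smooth_slice.
have hd e : mderiv (h e) (fun x => h e x *m (b + (u x + e *: w x))).
  have := mderivM (dyson_deriv_x (H 0) Ws e) gd.
  suff -> : (fun x => e *: (dyson W (H 0) (e, x) *m W x) *m g x +
      dyson W (H 0) (e, x) *m (g x *m (b + u x)))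
     = (fun x => h e x *m (b + (u x + e *: w x))) by [].
  apply/funext => x; rewrite -/Z /h -mulmxA scalemxAr -mulmxA -mulmxDr; congr (_ *m _).
  rewrite -scalemxAl /W -mulmxA gig mulmx1 addrA [RHS]mulmxDr -[in RHS]scalemxAr; exact: addrC.
exists (fun p : R * R => h p.1 p.2 *m (e1 : vec R n)); split.
- apply: smooth_mulmx; last exact: smooth_cst.
  apply: smooth_mulmx; last exact: smooth_snd.
  by have -> : (fun x : R * R => Z (x.1, x.2)) = Z by apply/funext => -[].
- move=> e /=; apply: (@frame_in_M (h e) (fun x => u x + e *: w x)) => //.
  + by move=> x; apply: in_OM.
  + by apply: smooth_addmx => //; apply: smooth_scalemx => //; exact: smooth_cst.
  + by move=> x; apply: in_VD => //; exact: in_VZ.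
- by move=> x /=; rewrite /h /Z dyson0 // mul1mx.
- move=> x /=.
  have d0 i j : is_derive 0 (1 : R) (fun e => Z (e, x) i j) (H x i j).
    exact: dyson_deriv_eps0.
  have d1 i : is_derive 0 (1 : R) (fun e => (h e x *m e1 : vec R n) i 0)
      ((H x *m g x *m e1 : vec R n) i 0).
    have hE e : (h e x *m e1 : vec R n) i 0 = \sum_j Z (e, x) i j * (g x *m e1 : vec R n) j 0.
      by rewrite /h -mulmxA mxE.
    rewrite (eq_fun hE) -mulmxA mxE; apply: is_derive1_sum => j.
    apply: is_derive_eq (is_derive1M (d0 i j) (is_derive_cst _ _ _)) _.
    by rewrite mulr0 addr0.
  have -> : g x *m (K x *m e1) = H x *m g x *m e1.
    by rewrite /H -[_ *m gi x *m g x]mulmxA gig mulmx1 mulmxA.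
  apply/matrixP => i j; rewrite ord1 {j} derive1E.
  have dd : derivable (fun e => h e x *m e1 : vec R n) 0 1.
    by apply/derivable_mxP => k l; rewrite ord1; have [] := d1 k.
  by rewrite derive_mx // [RHS]mxE; have [_ ->] := d1 i.
Qed.

End Frame.

(** * Drinfeld-Sokolov gauge fixing *)

Section Gauge.
Variables (R : realType) (n : nat).
Local Notation N := (2 * n).+1.
Local Notation C := (C_ R n).
Local Notation b := (b_ R n).
Implicit Types A B X Y : 'M[R]_N.

(** The principal filtration of constant matrices: the entry [(i, j)] has height
    [j - i]. *)
Definition height (d : nat) A := forall i j : 'I_N, (j < i + d)%N -> A i j = 0.
Definition lie A B := A *m B - B *m A.

Lemma lieDr A B B' : lie A (B + B') = lie A B + lie A B'.
Proof. by rewrite /lie mulmxDr mulmxDl opprD addrACA. Qed.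

Lemma lieDl A A' B : lie (A + A') B = lie A B + lie A' B.
Proof. by rewrite /lie mulmxDr mulmxDl opprD addrACA. Qed.

Lemma heightD d A B : height d A -> height d B -> height d (A + B).
Proof. by move=> hA hB i j ij; rewrite mxE hA // hB // addr0. Qed.

Lemma heightN d A : height d A -> height d (- A).
Proof. by move=> hA i j ij; rewrite mxE hA // oppr0. Qed.

Lemma heightZ d a A : height d A -> height d (a *: A).
Proof. by move=> hA i j ij; rewrite mxE hA // mulr0. Qed.

Lemma heightM d d' A B : height d A -> height d' B -> height (d + d') (A *m B).
Proof.
move=> hA hB i j ij; rewrite mxE big1 // => k _.
have [ki|ki] := ltnP k (i + d); first by rewrite hA // mul0r.
by rewrite hB ?mulr0 //; lia.
Qed.

Lemma height_le d d' A : (d' <= d)%N -> height d A -> height d' A.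
Proof. by move=> dd hA i j ij; apply: hA; lia. Qed.

Lemma height_lie d d' A B : height d A -> height d' B -> height (d + d') (lie A B).
Proof.
move=> hA hB; apply: heightD; first exact: heightM.
by apply: heightN; rewrite addnC; exact: heightM.
Qed.

Lemma in_V_height A : in_V A -> height 1 A.
Proof. by move=> VA i j ij; apply: in_V_upper => //; lia. Qed.

(** The involution whose fixed points form the orthogonal Lie algebra. *)
Definition theta A := - (C *m A^T *m C).

Lemma theta_o A : in_o A <-> theta A = A.
Proof.
rewrite in_oE /theta; split=> h.
  by rewrite -mulmxA h mulmxN mulmxA CC mul1mx opprK.
by rewrite -[in RHS]h mulmxN opprK !mulmxA CC mul1mx.
Qed.

Lemma thetaK A : theta (theta A) = A.
Proof.
rewrite /theta (raddfN (@trmx R N N)) /= !trmx_mul trmxK !C_tr mulmxN mulNmx opprK.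
by rewrite !mulmxA CC mul1mx -mulmxA CC mulmx1.
Qed.

Lemma theta_lie A B : theta (lie A B) = lie (theta A) (theta B).
Proof.
rewrite /theta /lie (raddfB (@trmx R N N)) /= !trmx_mul !mulmxN !mulNmx !opprK.
have e P Q : C *m P *m C *m (C *m Q *m C) = C *m (P *m Q) *m C.
  by rewrite !mulmxA -[_ *m C *m C]mulmxA CC mulmx1.
by rewrite !e mulmxBr mulmxBl opprB.
Qed.

Lemma theta_E A i j : theta A i j = - ((-1) ^+ (i + j) * A (rev_ord j) (rev_ord i)).
Proof.
rewrite /theta mxE -mulmxA mulCE; congr (- _).
have -> : (A^T *m C) (rev_ord i) j = (C *m A) j (rev_ord i).
  by rewrite (_ : A^T *m C = (C *m A)^T) ?mxE // trmx_mul C_tr.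
rewrite mulCE mulrA -exprD; congr (_ * _).
by rewrite -signr_odd -[RHS]signr_odd; congr (_ ^+ nat_of_bool _); lia.
Qed.

Lemma height_theta d A : height d A -> height d (theta A).
Proof.
move=> hA i j ij; rewrite theta_E hA ?mulr0 ?oppr0 //=.
by have := ltn_ord i; have := ltn_ord j; lia.
Qed.

Lemma in_o_derive1 (F : R -> 'M[R]_N) : smooth F -> (forall x, in_o (F x)) ->
  forall x, in_o (derive1 F x).
Proof.
move=> Fs Fo x.
have dF := mderivN (mderivMr C (mderivMl C (mderivT (smooth_mderiv Fs)))).
have eF : (fun x => - (C *m (F x)^T *m C)) = F.
  by apply/funext => y; exact: ((theta_o _).1 (Fo y)).
rewrite eF in dF; have e := mderiv_unique (smooth_mderiv Fs) dF.
by apply/theta_o; exact: (esym (congr1 (fun f => f x) e)).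
Qed.

Lemma smooth_theta (F : R -> 'M[R]_N) : smooth F -> smooth (fun x => theta (F x)).
Proof.
move=> Fs; apply: smooth_oppmx; apply: smooth_mulmx; last exact: smooth_cst.
by apply: smooth_mulmx; [exact: smooth_cst | exact: smooth_trmx].
Qed.

Lemma smooth_lie (F G : R -> 'M[R]_N) : smooth F -> smooth G -> smooth (fun x => lie (F x) (G x)).
Proof.
by move=> Fs Gs; apply: smooth_addmx; [|apply: smooth_oppmx]; exact: smooth_mulmx.
Qed.

Definition diag_entry d A (l : nat) : R := if (l + d <= 2 * n)%N then A (inord l) (inord (l + d)) else 0.
Definition diag_sum d A : R := \sum_(l < N) diag_entry d A l.

(** The bracket with [b] of a matrix on superdiagonal [d + 1] has on
    superdiagonal [d] the differences of consecutive entries. Prefix sums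
    invert this. *)
Definition prefix_mx d A : 'M[R]_N :=
  \matrix_(i, j) if (j == i + d.+1 :> nat)%N then - \sum_(l < i.+1) diag_entry d A l else 0.

Lemma diag_entryE d A (i j : 'I_N) : (j = i + d :> nat)%N -> diag_entry d A i = A i j.
Proof.
move=> ij; rewrite /diag_entry -ij ifT; last by rewrite -ltnS.
by rewrite !inord_val.
Qed.

Lemma prefix_mx_height d A : height d.+1 (prefix_mx d A).
Proof. by move=> i j ij; rewrite mxE ifF //; lia. Qed.

Lemma mulbE A i j : (b *m A) i j = if i is Ordinal i'.+1 _ then A (inord i') j else 0.
Proof.
rewrite mxE; case: i => -[|i] iN.
  by rewrite big1 // => k _; rewrite b_E mul0r.
rewrite (bigD1 (inord i)) //= big1 ?addr0.
  by rewrite b_E /= inordK ?eqxx ?mul1r // ltnW.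
move=> k ki; rewrite b_E /=.
have -> : (i.+1 == k.+1) = false.
  apply/negbTE; apply: contra ki => /eqP [ik]; apply/eqP/val_inj.
  by rewrite /= inordK -?ik // ltnW.
by rewrite mul0r.
Qed.

Lemma mulEb A (i j : 'I_N) : (A *m b) i j = if (j.+1 < N)%N then A i (inord j.+1) else 0.
Proof.
rewrite mxE; case: ifP => jN.
  rewrite (bigD1 (inord j.+1)) //= big1 ?addr0.
    by rewrite b_E /= inordK // eqxx mulr1.
  move=> k kj; rewrite b_E.
  have -> : (k == j.+1 :> nat) = false.
    apply/negbTE; apply: contra kj => /eqP kj; apply/eqP/val_inj.
    by rewrite /= inordK.
  by rewrite mulr0.
rewrite big1 // => k _; rewrite b_E.
have -> : (k == j.+1 :> nat) = false by apply/negbTE/eqP; have := ltn_ord k; lia.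
by rewrite mulr0.
Qed.

Lemma mxBE A B i j : (A - B) i j = A i j - B i j.
Proof. by rewrite !mxE. Qed.

Lemma lie_bE A i j : lie b A i j =
  (if i is Ordinal i'.+1 _ then A (inord i') j else 0) -
  (if (j.+1 < N)%N then A i (inord j.+1) else 0).
Proof. by rewrite -mulEb -mulbE /lie mxBE. Qed.

(** The sum of all entries of the superdiagonal is the only obstruction: it is
    the last prefix sum, which has no place in the matrix. *)
Lemma lie_prefix d A : height d A -> diag_sum d A = 0 -> height d.+1 (A - lie b (prefix_mx d A)).
Proof.
move=> hA s0 i j ij; rewrite mxBE lie_bE.
have [jd|jd] := eqVneq (nat_of_ord j) (i + d)%N; last first.
  have jd' : (j < i + d)%N by lia.
  rewrite hA // sub0r.
  have -> : (if (j.+1 < N)%N then prefix_mx d A i (inord j.+1) else 0) = 0.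
    by case: ifP => // jN; rewrite prefix_mx_height // inordK //; lia.
  case: i ij jd jd' => -[|i] iN ij jd jd'; first by rewrite subrr oppr0.
  by rewrite prefix_mx_height ?subrr ?oppr0 // inordK; move: jd' => /=; lia.
rewrite -(diag_entryE A jd).
have -> : (match i with | @Ordinal _ 0 _ => 0 | @Ordinal _ i'.+1 _ => prefix_mx d A (inord i') j end)
    = - \sum_(l < i) diag_entry d A l.
  case: i ij jd => -[|i] iN ij /= jd; first by rewrite big_ord0 oppr0.
  by rewrite mxE inordK ?(ltnW iN) // jd addSn addnS eqxx.
have -> : (if (j.+1 < N)%N then prefix_mx d A i (inord j.+1) else 0)
    = - \sum_(l < i.+1) diag_entry d A l.
  case: ifP => jN; first by rewrite mxE inordK // jd addnS eqxx.
  suff -> : \sum_(l < i.+1) diag_entry d A l = diag_sum d A by rewrite s0 oppr0.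
  apply: esym; rewrite /diag_sum.
  rewrite (big_ord_widen N (diag_entry d A) (ltn_ord i)) [LHS](bigID (fun l : 'I_N => (l < i.+1)%N)) /=.
  rewrite [X in _ + X]big1 ?addr0 // => l li.
  by rewrite /diag_entry ifF //; have := ltn_ord j; lia.
by rewrite big_ord_recr /= opprK addKr subrr.
Qed.

(** The reflection in the antidiagonal preserves each superdiagonal, and on the
    even ones it changes the sign of the entries of [A]. *)
Lemma diag_sum_even d A : ~~ odd d -> in_o A -> diag_sum d A = 0.
Proof.
move=> de /theta_o oA.
suff h : diag_sum d A = - diag_sum d A by lra.
rewrite {1}/diag_sum /diag_sum -sumrN.
have [dN|dN] := leqP d (2 * n); last first.
  by rewrite !big1 // => l _; rewrite /diag_entry ifF ?oppr0 //; lia.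
have red (F : nat -> R) : (forall l, (2 * n - d < l)%N -> F l = 0) ->
   \sum_(l < N) F l = \sum_(l < (2 * n - d).+1) F l.
  move=> F0; have le : ((2 * n - d).+1 <= N)%N by lia.
  rewrite (big_ord_widen N F le) [LHS](bigID (fun l : 'I_N => (l < (2 * n - d).+1)%N)) /=.
  by rewrite [X in _ + X]big1 ?addr0 // => l; rewrite -leqNgt => /F0.
rewrite (red (diag_entry d A)); last by move=> l ll; rewrite /diag_entry ifF //; lia.
rewrite (red (fun l => - diag_entry d A l)); last by move=> l ll; rewrite /diag_entry ifF ?oppr0 //; lia.
rewrite [RHS](reindex_inj rev_ord_inj) /=; apply: eq_bigr => l _.
have lN := ltn_ord l.
rewrite /diag_entry !ifT; try by lia.
rewrite -{1}oA theta_E; congr (- _).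
rewrite -signr_odd !inordK; try by lia.
rewrite (_ : odd (l + (l + d)) = false) ?mul1r; last by lia.
by congr (A _ _); apply/val_inj; rewrite /= !inordK; lia.
Qed.

Lemma diag_sum_beta k : (0 < k <= n)%N -> diag_sum (2 * k).-1 (beta_ R n k) = 2.
Proof.
move=> kn; rewrite /diag_sum.
have E (l : 'I_N) : diag_entry (2 * k).-1 (beta_ R n k) l = (l + k == n)%N%:R + (l + k == n.+1)%N%:R.
  rewrite /diag_entry; case: ifP => ll.
    rewrite beta_E // !inordK; try by lia.
    by congr (_%:R + _%:R); lia.
  by rewrite (_ : (l + k == n)%N = false) 1?(_ : (l + k == n.+1)%N = false) ?addr0 //; lia.
rewrite (eq_bigr _ (fun l _ => E l)) big_split /=.
have one m : (k <= m <= n.+1)%N -> \sum_(l < N) (l + k == m)%N%:R = 1 :> R.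
  move=> km; have mN : (m - k < N)%N by lia.
  rewrite (bigD1 (Ordinal mN)) //= big1 ?addr0; first by rewrite subnK ?eqxx //; lia.
  move=> l lm; rewrite (_ : (l + k == m)%N = false) //.
  apply/negbTE; apply: contra lm => /eqP e; apply/eqP/val_inj => /=; lia.
by rewrite !one //; lia.
Qed.

Lemma beta_height k : (0 < k <= n)%N -> height (2 * k).-1 (beta_ R n k).
Proof.
move=> kn i j ij; rewrite beta_E //.
rewrite (_ : (i + k == n)%N && (j.+1 == (n + k)%N) = false); last by lia.
rewrite (_ : (i + k == n.+1)%N && (nat_of_ord j == (n + k)%N) = false); last by lia.
by rewrite addr0.
Qed.

Lemma diag_sumD d A B : diag_sum d (A + B) = diag_sum d A + diag_sum d B.
Proof.
rewrite /diag_sum -big_split; apply: eq_bigr => l _; rewrite /diag_entry; case: ifP => _ /=.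
  by rewrite mxE.
by rewrite addr0.
Qed.

Lemma diag_sumZ d a A : diag_sum d (a *: A) = a * diag_sum d A.
Proof.
rewrite /diag_sum mulr_sumr; apply: eq_bigr => l _; rewrite /diag_entry; case: ifP => _ /=.
  by rewrite mxE.
by rewrite mulr0.
Qed.

Lemma in_V_beta a k : (0 < k <= n)%N -> in_V (a *: beta_ R n k).
Proof.
move=> kn; exists (fun l => if l == k then a else 0).
rewrite (bigD1_seq k) /=; [|by rewrite mem_index_iota; lia|exact: iota_uniq].
rewrite eqxx.
by rewrite big1 ?addr0 // => l /negbTE ->; rewrite scale0r.
Qed.

Lemma smooth_diag_entry d l (F : R -> 'M[R]_N) : smooth F -> smooth (fun x => diag_entry d (F x) l).
Proof.
move=> Fs; case e : (l + d <= 2 * n)%N; under eq_fun do rewrite /diag_entry e.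
  exact: smooth_coord.
exact: smooth_cst.
Qed.

Lemma smooth_diag_sum d (F : R -> 'M[R]_N) : smooth F -> smooth (fun x => diag_sum d (F x)).
Proof.
by move=> Fs; apply: smooth_sum => l; exact: smooth_diag_entry.
Qed.

Lemma smooth_prefix d (F : R -> 'M[R]_N) : smooth F -> smooth (fun x => prefix_mx d (F x)).
Proof.
move=> Fs; apply: smooth_mx => i j.
case e : (nat_of_ord j == i + d.+1)%N; last first.
  by under eq_fun do rewrite mxE e; exact: smooth_cst.
under eq_fun do rewrite mxE e.
by apply: smoothN; apply: smooth_sum => l; exact: smooth_diag_entry.
Qed.

(** One superdiagonal at a time. On superdiagonal [d], a multiple [B] of [beta_]
    corrects the sum of the entries, and what remains is [lie b Y0] with [Y0] of
    height [d + 1]. Averaging [Y0] with its image under the involution [theta],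
    which fixes [b] and [M - B], puts it into the orthogonal Lie algebra. The
    derivative of the average [Y] and its bracket with [u] only affect higher
    superdiagonals. *)
Lemma gauge_fix (u : R -> 'M[R]_N) : smooth u -> (forall x, in_V (u x)) ->
  forall k d, (d + k = N)%N -> forall M : R -> 'M[R]_N, smooth M ->
  (forall x, in_o (M x)) -> (forall x, height d (M x)) ->
  exists eta : R -> 'M[R]_N, [/\ smooth eta, forall x, in_o (eta x), forall x, height 1 (eta x)
    & forall x, in_V (M x - derive1 eta x - lie (b + u x) (eta x))].
Proof.
move=> us uV; elim=> [|k IH] d dk M Ms Mo Mh.
  have M0 x : M x = 0.
    by apply/matrixP => i j; rewrite Mh ?mxE //; have := ltn_ord j; lia.
  exists (fun _ => 0); split.
  - exact: smooth_cst.
  - by move=> x; exact: in_o0.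
  - by move=> x i j _; rewrite mxE.
  - move=> x; rewrite M0 (derive1_cst (0 : 'M[R]_N)) /lie mulmx0 mul0mx !subr0.
    exists (fun _ => 0); rewrite big1 // => l _; exact: scale0r.
have [B [Bs Bo Bh BV B0]] : exists B : R -> 'M[R]_N, [/\ smooth B, forall x, in_o (B x),
    forall x, height d (B x), forall x, in_V (B x) & forall x, diag_sum d (M x - B x) = 0].
  case de : (odd d).
    have kn : (0 < uphalf d <= n)%N by lia.
    have dE : d = (2 * uphalf d).-1 by lia.
    exists (fun x => (diag_sum d (M x) / 2) *: beta_ R n (uphalf d)); split.
    - apply: smooth_scalemx; last exact: smooth_cst.
      by apply: smoothM; [exact: smooth_diag_sum | exact: smooth_cst].
    - by move=> x; apply/in_oZ/in_o_beta.
    - by move=> x; apply: heightZ; rewrite {1}dE; exact: beta_height.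
    - by move=> x; apply: in_V_beta.
    - move=> x; rewrite -scaleNr diag_sumD diag_sumZ {3}dE diag_sum_beta //.
      by rewrite mulNr divfK ?subrr // pnatr_eq0.
  exists (fun _ => 0); split.
  - exact: smooth_cst.
  - by move=> x; exact: in_o0.
  - by move=> x i j _; rewrite mxE.
  - by move=> x; exists (fun _ => 0); rewrite big1 // => l _; exact: scale0r.
  - by move=> x; rewrite subr0 diag_sum_even // de.
pose X x := M x - B x.
have Xs : smooth X by apply: smooth_addmx => //; exact: smooth_oppmx.
have Xo x : in_o (X x) by apply: in_oD => //; exact: in_oN.
have Xh x : height d (X x) by apply: heightD => //; exact: heightN.
pose Y0 x := prefix_mx d (X x).
pose Y x := 2^-1 *: (Y0 x + theta (Y0 x)).
have Y0s : smooth Y0 by exact: smooth_prefix.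
have Ys : smooth Y.
  by apply: smooth_scalemx; [exact: smooth_cst | apply: smooth_addmx => //; exact: smooth_theta].
have Yo x : in_o (Y x).
  apply/in_oZ/theta_o; rewrite /theta (raddfD (@trmx R N N)) /= mulmxDr mulmxDl opprD.
  by rewrite -/(theta _) -[X in _ + X]/(theta (theta _)) thetaK addrC.
have Yh x : height d.+1 (Y x).
  by apply: heightZ; apply: heightD; [|apply: height_theta]; exact: prefix_mx_height.
have XY x : height d.+1 (X x - lie b (Y x)).
  have h1 := lie_prefix (Xh x) (B0 x).
  have h2 := height_theta h1.
  have -> : X x - lie b (Y x) = 2^-1 *: ((X x - lie b (Y0 x)) + theta (X x - lie b (Y0 x))).
    have -> : theta (X x - lie b (Y0 x)) = X x - lie b (theta (Y0 x)).
      have -> : theta (X x - lie b (Y0 x)) = theta (X x) - theta (lie b (Y0 x)).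
        rewrite /theta (raddfB (@trmx R N N)) /= mulmxBr mulmxBl opprB opprK.
        by rewrite addrC.
      by rewrite theta_lie ((theta_o _).1 (Xo x)) ((theta_o _).1 (in_o_b R n)).
    rewrite /Y /lie -!scalemxAr -!scalemxAl mulmxDr mulmxDl.
    apply/matrixP => i j; rewrite !mxE; lra.
  by apply: heightZ; apply: heightD.
have Y's : smooth (derive1 Y) by exact: smooth_derive1.
have Y'h x : height d.+1 (derive1 Y x).
  move=> i j ij; have [_ <-] := smooth_mderiv Ys x i j.
  have -> : (fun y => Y y i j) = cst 0 by apply/funext => y; rewrite Yh.
  exact: derive_cst.
have Y'o x : in_o (derive1 Y x) by exact: in_o_derive1.
pose M1 x := X x - derive1 Y x - lie (b + u x) (Y x).
have buo x : in_o (b + u x) by apply: in_oD; [exact: in_o_b | exact: in_V_o].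
have bus : smooth (fun x => b + u x) by apply: smooth_addmx => //; exact: smooth_cst.
have [||||eta [es eo eh eV]] := IH d.+1 _ M1; first by rewrite addSnnS.
- apply: smooth_addmx; last by apply: smooth_oppmx; exact: smooth_lie.
  by apply: smooth_addmx => //; exact: smooth_oppmx.
- move=> x; apply: in_oD; last by apply: in_oN; exact: in_o_comm.
  by apply: in_oD => //; exact: in_oN.
- move=> x; have -> : M1 x = (X x - lie b (Y x)) - derive1 Y x - lie (u x) (Y x).
    rewrite /M1 lieDl; move: (lie b _) (lie (u x) _) => P Q.
    by apply/matrixP => i j; rewrite !mxE; ring.
  apply: heightD; first by apply: heightD => //; exact: heightN.
  apply: heightN; apply: height_le (height_lie (in_V_height (uV x)) (Yh x)); lia.
exists (fun x => Y x + eta x); split.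
- exact: smooth_addmx.
- by move=> x; exact: in_oD.
- by move=> x; apply: heightD => //; apply: height_le (Yh x).
- move=> x; have -> : derive1 (fun x => Y x + eta x) x = derive1 Y x + derive1 eta x.
    by rewrite (mderiv_derive1 (mderivD (smooth_mderiv Ys) (smooth_mderiv es))).
  have -> : M x - (derive1 Y x + derive1 eta x) - lie (b + u x) (Y x + eta x) =
    B x + (M1 x - derive1 eta x - lie (b + u x) (eta x)).
    rewrite /M1 /X lieDr; move: (lie _ (Y x)) (lie _ (eta x)) => P Q.
    by apply/matrixP => i j; rewrite !mxE; ring.
  exact: in_VD.
Qed.

End Gauge.

(** * The ring of series *)

Section SeriesRing.
Variables (R : realType) (n : nat).
Local Notation N := (2 * n).+1.
Local Notation Mat := 'M[R]_N.
Implicit Types (x y z : lseries R n) (A B : Mat) (m p k : int).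

Definition bounded_by (m : int) x := forall k, m < k -> x k = 0.

(** Read downwards from its top degree, the product is a Cauchy product of power
    series. *)
Lemma smulE m m' x y (c : nat) : bounded_by m x -> bounded_by m' y ->
  smul x y (m + m' - c%:Z) = \sum_(j < c.+1) x (m - j%:Z) *m y (m' - (c - j)%N%:Z).
Proof.
move=> bx by_.
pose r := [seq m - j%:Z | j <- iota 0 c.+1].
rewrite /smul (fsbigE r); first last.
- move=> i _ ir; have [mi|im] := ltP m i; first by rewrite bx // mul0mx.
  rewrite by_ ?mulmx0 //; apply/negP => h; move/negP: ir; apply.
  apply/mapP; exists (absz (m - i)); last by lia.
  by rewrite mem_iota /=; lia.
- by [].
- rewrite map_inj_uniq ?iota_uniq // => a b; lia.
rewrite (eq_bigl xpredT); last by move=> i; rewrite in_setT.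
rewrite big_map -[iota 0 c.+1]/(index_iota 0 c.+1) big_mkord; apply: eq_bigr => j _.
by congr (_ *m y _); have := ltn_ord j; lia.
Qed.

Lemma smul_bounded m m' x y : bounded_by m x -> bounded_by m' y -> bounded_by (m + m') (smul x y).
Proof.
move=> bx by_ k mk; rewrite /smul fsbig1 // => i _.
have [mi|im] := ltP m i; first by rewrite bx // mul0mx.
by rewrite by_ ?mulmx0 //; lia.
Qed.

(** Associativity of the product is reduced to that of polynomials: a given
    coefficient only depends on truncations of the factors. *)
Definition trunc (m : int) x (K : nat) : {poly Mat} := \poly_(j < K) x (m - j%:Z).

Lemma coef_trunc m x K (c : nat) : (c < K)%N -> (trunc m x K)`_c = x (m - c%:Z).
Proof. by move=> cK; rewrite coef_poly cK. Qed.

Lemma smul_trunc m m' x y c K : bounded_by m x -> bounded_by m' y -> (c < K)%N ->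
  smul x y (m + m' - c%:Z) = (trunc m x K * trunc m' y K)`_c.
Proof.
move=> bx by_ cK; rewrite (smulE c bx by_) coefM; apply: eq_bigr => j _.
by have jc := ltn_ord j; rewrite !coef_trunc //; lia.
Qed.

Lemma smulA x y z : bounded_degree x -> bounded_degree y -> bounded_degree z ->
  smul x (smul y z) = smul (smul x y) z.
Proof.
move=> [m bx] [m' by_] [m'' bz]; apply/funext => k.
have byz := smul_bounded by_ bz; have bxy := smul_bounded bx by_.
have [mk|km] := ltP (m + m' + m'') k.
  rewrite (smul_bounded bxy bz) // (smul_bounded bx byz) //; lia.
pose c := absz (m + m' + m'' - k)%R; pose K := c.+1.
have kE : k = m + m' + m'' - c%:Z by lia.
have kE2 : k = m + (m' + m'') - c%:Z by lia.
transitivity ((trunc m x K * (trunc m' y K * trunc m'' z K))`_c).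
  rewrite kE2 (smulE c bx byz) coefM; apply: eq_bigr => j _; have jc := ltn_ord j.
  rewrite coef_trunc; last by rewrite /K; lia.
  by rewrite (smul_trunc (K := K) by_ bz) // /K; lia.
rewrite kE (smulE c bxy bz) mulrA coefM; apply: eq_bigr => j _; have jc := ltn_ord j.
rewrite (@coef_trunc m''); last by rewrite /K; lia.
by rewrite (smul_trunc (K := K) bx by_) // /K; lia.
Qed.

Lemma bounded_le m m' x : m <= m' -> bounded_by m x -> bounded_by m' x.
Proof. by move=> mm bx k mk; apply: bx; apply: le_lt_trans mk. Qed.

Lemma common_bound x y : bounded_degree x -> bounded_degree y ->
  exists m, bounded_by m x /\ bounded_by m y.
Proof.
move=> [m bx] [m' by_]; exists (Num.max m m'); split.
  by apply: bounded_le bx; rewrite le_max lexx.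
by apply: bounded_le by_; rewrite le_max lexx orbT.
Qed.

Lemma smul_monl A m x k : smul (smonom A m) x k = A *m x (k - m).
Proof.
rewrite /smul (fsbigE [:: m]) //; last first.
  by move=> i _; rewrite inE /smonom => /negbTE ->; rewrite mul0mx.
by rewrite big_cons big_nil in_setT /= addr0 /smonom eqxx.
Qed.

Lemma smul_monr A m x k : smul x (smonom A m) k = x (k - m) *m A.
Proof.
rewrite /smul (fsbigE [:: k - m]) //; last first.
  move=> i _; rewrite inE /smonom => ik.
  rewrite ifF ?mulmx0 //; apply/negbTE; apply: contra ik => /eqP <-; apply/eqP; lia.
rewrite big_cons big_nil in_setT /= addr0 /smonom ifT //; lia.
Qed.

Lemma smulDl x y z : bounded_degree x -> bounded_degree y -> bounded_degree z ->
  smul (fun k => x k + y k) z = (fun k => smul x z k + smul y z k).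
Proof.
move=> bx by_ [m' bz]; have [m [{}bx {}by_]] := common_bound bx by_.
have bxy : bounded_by m (fun k => x k + y k) by move=> k mk; rewrite bx // by_ // addr0.
apply/funext => k; have [mk|km] := ltP (m + m') k.
  by rewrite (smul_bounded bxy bz) // (smul_bounded bx bz) // (smul_bounded by_ bz) // addr0.
pose c := absz (m + m' - k)%R; have -> : k = m + m' - c%:Z by lia.
rewrite (smulE c bxy bz) (smulE c bx bz) (smulE c by_ bz) -big_split.
by apply: eq_bigr => j _; rewrite mulmxDl.
Qed.

Lemma smulDr x y z : bounded_degree x -> bounded_degree y -> bounded_degree z ->
  smul z (fun k => x k + y k) = (fun k => smul z x k + smul z y k).
Proof.
move=> bx by_ [m' bz]; have [m [{}bx {}by_]] := common_bound bx by_.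
have bxy : bounded_by m (fun k => x k + y k) by move=> k mk; rewrite bx // by_ // addr0.
apply/funext => k; have [mk|km] := ltP (m' + m) k.
  by rewrite (smul_bounded bz bxy) // (smul_bounded bz bx) // (smul_bounded bz by_) // addr0.
pose c := absz (m' + m - k)%R; have -> : k = m' + m - c%:Z by lia.
rewrite (smulE c bz bxy) (smulE c bz bx) (smulE c bz by_) -big_split.
by apply: eq_bigr => j _; rewrite mulmxDr.
Qed.

(** Laurent series in the inverse of [lambda], with matrix coefficients. *)
Record bser := Bser { bval :> lseries R n; bvalP : bounded_degree bval }.

Lemma bser_ext (x y : bser) : (forall k, bval x k = bval y k) -> x = y.
Proof.
case: x y => [x px] [y py] /= /funext xy; subst y; congr Bser; exact: Prop_irrelevance.
Qed.

Lemma bdeg0 : bounded_degree (fun _ => 0 : Mat). Proof. by exists 0. Qed.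
Lemma bdegD x y : bounded_degree x -> bounded_degree y -> bounded_degree (fun k => x k + y k).
Proof.
move=> bx by_; have [m [{}bx {}by_]] := common_bound bx by_.
by exists m => k mk; rewrite bx // by_ // addr0.
Qed.
Lemma bdegN x : bounded_degree x -> bounded_degree (fun k => - x k).
Proof. by move=> [m bx]; exists m => k mk; rewrite bx // oppr0. Qed.
Lemma bdegM x y : bounded_degree x -> bounded_degree y -> bounded_degree (smul x y).
Proof. by move=> [m bx] [m' by_]; exists (m + m'); exact: smul_bounded. Qed.
Lemma bdeg_mon A m : bounded_degree (smonom A m).
Proof. by exists m => k mk; rewrite /smonom ifF //; lia. Qed.

Definition bzero := Bser bdeg0.
Definition badd (x y : bser) := Bser (bdegD (bvalP x) (bvalP y)).
Definition bopp (x : bser) := Bser (bdegN (bvalP x)).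
Definition bmul (x y : bser) := Bser (bdegM (bvalP x) (bvalP y)).
Definition bmon A m := Bser (bdeg_mon A m).

Fact baddA : associative badd. Proof. by move=> x y z; apply: bser_ext => k /=; rewrite addrA. Qed.
Fact baddC : commutative badd. Proof. by move=> x y; apply: bser_ext => k /=; rewrite addrC. Qed.
Fact badd0 : left_id bzero badd. Proof. by move=> x; apply: bser_ext => k /=; rewrite add0r. Qed.
Fact baddN : left_inverse bzero bopp badd. Proof. by move=> x; apply: bser_ext => k /=; rewrite addNr. Qed.
Fact bmulA : associative bmul.
Proof. by move=> x y z; apply: bser_ext => k /=; rewrite smulA //; exact: bvalP. Qed.
Fact bmul1 : left_id (bmon 1%:M 0) bmul.
Proof. by move=> x; apply: bser_ext => k /=; rewrite smul_monl mul1mx subr0. Qed.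
Fact bmulr1 : right_id (bmon 1%:M 0) bmul.
Proof. by move=> x; apply: bser_ext => k /=; rewrite smul_monr mulmx1 subr0. Qed.
Fact bmulDl : left_distributive bmul badd.
Proof. by move=> x y z; apply: bser_ext => k /=; rewrite smulDl //; exact: bvalP. Qed.
Fact bmulDr : right_distributive bmul badd.
Proof. by move=> x y z; apply: bser_ext => k /=; rewrite smulDr //; exact: bvalP. Qed.

HB.instance Definition _ := gen_eqMixin bser.
HB.instance Definition _ := gen_choiceMixin bser.
HB.instance Definition _ := GRing.isZmodule.Build bser baddA baddC badd0 baddN.
HB.instance Definition _ := GRing.Zmodule_isPzRing.Build bser bmulA bmul1 bmulr1 bmulDl bmulDr.

Lemma bvalD (x y : bser) k : bval (x + y) k = bval x k + bval y k. Proof. by []. Qed.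
Lemma bvalN (x : bser) k : bval (- x) k = - bval x k. Proof. by []. Qed.
Lemma bvalB (x y : bser) k : bval (x - y) k = bval x k - bval y k. Proof. by []. Qed.
Lemma bvalM (x y : bser) : bval (x * y) = smul x y. Proof. by []. Qed.

Lemma bvalX (x : bser) (j : nat) : bval (x ^+ j) = spow x j.
Proof. by elim: j => [|j IH] //=; rewrite exprS bvalM IH. Qed.

Lemma bmonM A B m p : bmon A m * bmon B p = bmon (A *m B) (m + p).
Proof.
apply: bser_ext => k; rewrite bvalM smul_monl /= /smonom.
have -> : (k - m == p) = (k == m + p) by apply/eqP/eqP; lia.
by case: eqP => _; rewrite ?mulmx0.
Qed.

Lemma bmonD A B m : bmon A m + bmon B m = bmon (A + B) m.
Proof. by apply: bser_ext => k; rewrite bvalD /= /smonom; case: eqP; rewrite ?addr0. Qed.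

Lemma bmon0 m : bmon 0 m = 0.
Proof. by apply: bser_ext => k; rewrite /= /smonom; case: eqP. Qed.

(** The central element [lambda ^ m]. *)
Definition lam (m : int) := bmon 1%:M m.

Lemma lamC m (x : bser) : lam m * x = x * lam m.
Proof. by apply: bser_ext => k; rewrite !bvalM smul_monl smul_monr mul1mx mulmx1. Qed.

Lemma lamM m p : lam m * lam p = lam (m + p).
Proof. by rewrite /lam bmonM mulmx1. Qed.

End SeriesRing.

(** * Powers of the resolvent and tangency *)

Section Star.
Variables (R : realType) (n : nat).
Local Notation N := (2 * n).+1.
Local Notation Mat := 'M[R]_N.
Local Notation C := (C_ R n).
Local Notation b := (b_ R n).
Local Notation bser := (bser R n).

(** An anti-involution. The elements of both loop algebras satisfy
    [star s x = - x], with [s = 1] in B-type and [s = -1] in A-type, and so do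
    their odd powers. *)
Definition star (s : R) (x : lseries R n) : lseries R n := fun k => s ^ k *: (C *m (x k)^T *m C).

Lemma star_bounded s m x : bounded_by m x -> bounded_by m (star s x).
Proof. by move=> bx k mk; rewrite /star bx // trmx0 mulmx0 mul0mx scaler0. Qed.

Lemma starM s x y : s != 0 -> bounded_degree x -> bounded_degree y ->
  star s (smul x y) = smul (star s y) (star s x).
Proof.
move=> s0 [m bx] [m' by_]; apply/funext => k.
have bx' := star_bounded s bx; have by' := star_bounded s by_.
have [mk|km] := ltP (m' + m) k.
  rewrite (smul_bounded by' bx') // /star (smul_bounded bx by_); last by lia.
  by rewrite trmx0 mulmx0 mul0mx scaler0.
pose c := absz (m' + m - k)%R; have kE : k = m' + m - c%:Z by lia.
have kE2 : k = m + m' - c%:Z by lia.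
rewrite {2}kE (smulE c by' bx') /star {2}kE2 (smulE c bx by_).
rewrite (raddf_sum (@trmx R N N)) [C *m _]mulmx_sumr [_ *m C]mulmx_suml scaler_sumr.
rewrite (reindex_inj rev_ord_inj) /=; apply: eq_bigr => j _; have jc := ltn_ord j.
have -> : (c - (c.+1 - j.+1) = j)%N by lia.
have -> : (c.+1 - j.+1 = c - j)%N by lia.
rewrite trmx_mul -scalemxAl -scalemxAr scalerA -exprzDr ?unitfE //.
have -> : m' - j%:Z + (m - (c - j)%N%:Z) = k by lia.
by congr (_ *: _); rewrite !mulmxA -[_ *m C *m C]mulmxA CC mulmx1.
Qed.

Lemma bdeg_star s x : bounded_degree x -> bounded_degree (star s x).
Proof. by move=> [m bx]; exists m; exact: star_bounded. Qed.

Definition bstar s (x : bser) : bser := Bser (bdeg_star s (bvalP x)).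

Lemma bstarM s (x y : bser) : s != 0 -> bstar s (x * y) = bstar s y * bstar s x.
Proof. by move=> s0; apply: bser_ext => k; rewrite bvalM /= starM //; exact: bvalP. Qed.

Lemma bstarX s (x : bser) j : s != 0 -> bstar s x = - x -> bstar s (x ^+ j) = (-1) ^+ j * x ^+ j.
Proof.
move=> s0 sx; elim: j => [|j IH].
  apply: bser_ext => k; rewrite expr0 mul1r /= /star /sone /smonom.
  case: eqP => [->|_]; last by rewrite trmx0 mulmx0 mul0mx scaler0.
  by rewrite expr0z scale1r trmx1 mulmx1 CC.
by rewrite exprS bstarM // IH sx mulrN -mulrA -!exprSr -exprS [(-1) ^+ j.+1]exprS mulN1r mulNr.
Qed.

Lemma bstar_odd s (x : bser) j k : s != 0 -> bstar s x = - x -> odd j ->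
  star s (x ^+ j) k = - bval (x ^+ j) k.
Proof.
move=> s0 sx oj; have := bstarX j s0 sx; rewrite -signr_odd oj expr1 mulN1r.
by move/(congr1 (fun y : bser => bval y k)).
Qed.

Lemma star_fix_o A (s : R) : s ^ (0 : int) *: (C *m A^T *m C) = - A -> in_o A.
Proof. by rewrite expr0z scale1r => h; apply/theta_o; rewrite /theta h opprK. Qed.

(** The uniform degree bound makes the coefficients of products sums with a
    number of terms independent of [x]. *)
Definition sderiv (F F' : R -> bser) :=
  (exists m, forall x, bounded_by m (F x) /\ bounded_by m (F' x)) /\
  forall k, mderiv (fun x => bval (F x) k) (fun x => bval (F' x) k).

Lemma sderivM F F' G G' : sderiv F F' -> sderiv G G' ->
  sderiv (fun x => F x * G x) (fun x => F' x * G x + F x * G' x).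
Proof.
move=> [[m bF] dF] [[m' bG] dG]; split.
  exists (m + m') => x; have [b1 b2] := bF x; have [b3 b4] := bG x.
  split; first exact: smul_bounded.
  move=> k mk; rewrite bvalD !bvalM (smul_bounded b2 b3) // (smul_bounded b1 b4) // addr0 //.
move=> k; have [mk|km] := ltP (m + m') k.
  have -> : (fun x => bval (F x * G x) k) = fun _ => 0.
    by apply/funext => x; rewrite bvalM (smul_bounded (bF x).1 (bG x).1).
  have -> : (fun x => bval (F' x * G x + F x * G' x) k) = fun _ => 0.
    apply/funext => x; rewrite bvalD !bvalM.
    by rewrite (smul_bounded (bF x).2 (bG x).1) // (smul_bounded (bF x).1 (bG x).2) // addr0.
  exact: mderiv_cst.
pose c := absz (m + m' - k)%R; have -> : k = m + m' - c%:Z by lia.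
have -> : (fun x => bval (F x * G x) (m + m' - c%:Z)) =
  (fun x => \sum_(j < c.+1) bval (F x) (m - j%:Z) *m bval (G x) (m' - (c - j)%N%:Z)).
  by apply/funext => x; rewrite bvalM (smulE c (bF x).1 (bG x).1).
have -> : (fun x => bval (F' x * G x + F x * G' x) (m + m' - c%:Z)) =
  (fun x => \sum_(j < c.+1) (bval (F' x) (m - j%:Z) *m bval (G x) (m' - (c - j)%N%:Z) +
       bval (F x) (m - j%:Z) *m bval (G' x) (m' - (c - j)%N%:Z))).
  apply/funext => x; rewrite bvalD !bvalM (smulE c (bF x).2 (bG x).1).
  by rewrite (smulE c (bF x).1 (bG x).2) -big_split.
move=> x p q; rewrite summxE.
have -> : (fun y => (\sum_(j < c.+1) bval (F y) (m - j%:Z) *m bval (G y) (m' - (c - j)%N%:Z)) p q) =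
   (fun y => \sum_(j < c.+1) (bval (F y) (m - j%:Z) *m bval (G y) (m' - (c - j)%N%:Z)) p q).
  by apply/funext => y; rewrite summxE.
apply: is_derive1_sum => j.
exact: (mderivM (dF (m - j%:Z)) (dG (m' - (c - j)%N%:Z)) x p q).
Qed.

Lemma sderiv_ext F F' G : sderiv F F' -> (forall x, F' x = G x) -> sderiv F G.
Proof. by move=> d FG; rewrite (_ : G = F') //; apply/funext. Qed.

(** A bracket with [A] is a derivation, so powers inherit a Lax equation. *)
Lemma sderivX (F A : R -> bser) j : sderiv F (fun x => F x * A x - A x * F x) ->
  sderiv (fun x => F x ^+ j.+1) (fun x => F x ^+ j.+1 * A x - A x * F x ^+ j.+1).
Proof.
move=> dF; elim: j => [|j IH]; first by under [X in sderiv X]eq_fun do rewrite expr1.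
have -> : (fun x => F x ^+ j.+2) = (fun x => F x ^+ j.+1 * F x).
  by apply/funext => x; rewrite exprSr.
apply: sderiv_ext (sderivM IH dF) _ => x.
by rewrite [F x ^+ j.+2]exprSr mulrBl mulrBr !mulrA addrC addrA subrK.
Qed.

Lemma smooth_series_X (F : R -> bser) : (exists m, forall x, bounded_by m (F x)) ->
  (forall k, smooth (fun x => bval (F x) k)) ->
  forall j k, smooth (fun x => bval (F x ^+ j) k).
Proof.
move=> [m bF] sF j.
suff [? ?] : (exists m', forall x, bounded_by m' (F x ^+ j)) /\
  forall k, smooth (fun x => bval (F x ^+ j) k) by [].
elim: j => [|j [[m' bj] IH]].
  split; first by exists 0 => x k k0; rewrite expr0 /= /smonom ifF //; lia.
  by move=> k; under eq_fun do rewrite expr0; exact: smooth_cst.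
split; first by exists (m + m') => x; rewrite exprS bvalM; exact: smul_bounded.
move=> k; have [mk|km] := ltP (m + m') k.
  have -> : (fun x => bval (F x ^+ j.+1) k) = fun _ => 0.
    by apply/funext => x; rewrite exprS bvalM (smul_bounded (bF x) (bj x)).
  exact: smooth_cst.
pose c := absz (m + m' - k)%R; have -> : k = m + m' - c%:Z by lia.
have -> : (fun x => bval (F x ^+ j.+1) (m + m' - c%:Z)) =
  (fun x => \sum_(i < c.+1) bval (F x) (m - i%:Z) *m bval (F x ^+ j) (m' - (c - i)%N%:Z)).
  by apply/funext => x; rewrite exprS bvalM (smulE c (bF x) (bj x)).
apply: smooth_mx => p q.
have -> : (fun y => (\sum_(i < c.+1) bval (F y) (m - i%:Z) *m bval (F y ^+ j) (m' - (c - i)%N%:Z)) p q) =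
   (fun y => \sum_(i < c.+1) (bval (F y) (m - i%:Z) *m bval (F y ^+ j) (m' - (c - i)%N%:Z)) p q).
  by apply/funext => y; rewrite summxE.
by apply: smooth_sum => i; apply: smooth_coord; exact: smooth_mulmx.
Qed.

End Star.

Section TangentResolvent.
Variables (R : realType) (n : nat).
Local Notation N := (2 * n).+1.
Local Notation Mat := 'M[R]_N.
Local Notation C := (C_ R n).
Local Notation b := (b_ R n).
Local Notation bser := (bser R n).
Variables (be : Mat) (s : R) (h : nat).
Hypothesis s0 : s != 0.
Hypothesis h0 : (0 < h)%N.
Let J : lseries R n := fun k => smonom b 0 k + smonom be 1 k.

Lemma resolvent_bounded (Q : lseries R n) : degree_le0 h (fun k => Q k - J k) ->
  bounded_by N Q.
Proof.
move=> dQ k Nk; have J0 : J k = 0.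
  by rewrite /J /smonom !ifF ?addr0 //; lia.
apply/matrixP => i j; rewrite mxE; apply/eqP; apply: contraT => Qk.
have := dQ k i j; rewrite J0 subr0 => /(_ Qk).
have := ltn_ord i; have := ltn_ord j; nia.
Qed.

(** The coefficient of degree 0 of the Lax equation of [Q^j] is
    [R_0' = M - lie (b + u) R_0] with [M = lie R_(-1) be]. Hence [M] is in the
    orthogonal Lie algebra, and if it is upper triangular then [gauge_fix]
    applies to it. The matrix [K = R_0 - eta] satisfies the equation of
    [tangent_of_gauge] and has the same first column as [R_0]. *)
Lemma tangent_of_resolvent (gamma : R -> vec R n) (g : R -> mat R n)
    (Q : R -> lseries R n) (j : nat) :
  moving_frame gamma g -> odd j ->
  (forall x k, s ^ k *: (C *m (Q x k)^T *m C) = - Q x k) ->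
  (forall A : Mat, s ^ (-1 : int) *: (C *m A^T *m C) = - A ->
     height 0 (A *m be - be *m A)) ->
  (forall k, smooth (fun x => Q x k)) ->
  commutes_with_dx (fun x k => J k + smonom (curvature g x) 0 k) Q ->
  (forall x, degree_le0 h (fun k => Q x k - J k)) ->
  tangent gamma (fun x => g x *m (spow (Q x) j 0 *m e1)).
Proof.
move=> [gs go gcol [us uV]] oj Qo up Qs Qc Qd.
have [u uE] : exists u, u = curvature g by exists (curvature g).
rewrite -uE in us uV Qc.
have Qb x : bounded_by N (Q x) by exact: resolvent_bounded.
pose F x : bser := @Bser R n (Q x) (ex_intro _ N%:Z (Qb x)).
pose A x : bser := bmon b 0 + bmon be 1 + bmon (u x) 0.
have dF : sderiv F (fun x => F x * A x - A x * F x).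
  have Ab x : bounded_by 1 (A x).
    by move=> k k1; rewrite !bvalD /= /smonom !ifF ?addr0 //; lia.
  have dE k : derive1 (fun y => Q y k) = (fun x => bval (F x * A x - A x * F x) k).
    apply/funext => x; have := Qc x k.
    have -> : (fun k => J k + smonom (u x) 0 k) = bval (A x) by [].
    by rewrite bvalB !bvalM => /eqP; rewrite addr_eq0 opprB => /eqP.
  split; last by move=> k; rewrite -dE; apply: (@smooth_mderiv _ _ _ (fun x => Q x k)); exact: Qs.
  exists (N%:Z + 1) => x; split; first by apply: bounded_le (Qb x); lia.
  move=> k Nk; rewrite bvalB !bvalM (smul_bounded (Qb x) (Ab x)) //.
  by rewrite (smul_bounded (Ab x) (Qb x)) ?subr0 // addrC.
case: j oj => // j oj.
have dR := sderivX j dF.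
pose Rk k x := bval (F x ^+ j.+1) k.
have Rs k : smooth (Rk k).
  by apply: smooth_series_X => //; exists N%:Z.
have RE x : spow (Q x) j.+1 0 = Rk 0 x by rewrite /Rk bvalX.
have Rstar x k : s ^ k *: (C *m (Rk k x)^T *m C) = - Rk k x.
  apply: (bstar_odd (x := F x) k s0 _ oj).
  by apply: bser_ext => k' /=; rewrite /star Qo.
have Ro x : in_o (Rk 0 x) by apply: star_fix_o (Rstar x 0).
pose M x := Rk (-1) x *m be - be *m Rk (-1) x.
have Ms : smooth M.
  by apply: smooth_addmx; [|apply: smooth_oppmx]; apply: smooth_mulmx => //; exact: smooth_cst.
have R0d : derive1 (Rk 0) = fun x => M x - lie (b + u x) (Rk 0 x).
  rewrite (mderiv_derive1 (dR.2 0)); apply/funext => x.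
  rewrite bvalB /A !mulrDr !mulrDl !bvalD !bvalM !smul_monl !smul_monr !subr0 sub0r.
  rewrite /M /lie -/(Rk (-1) x) -/(Rk 0 x) mulmxDl mulmxDr.
  move: (Rk 0 x *m b) (Rk 0 x *m u x) (b *m Rk 0 x) (u x *m Rk 0 x)
    (Rk (-1) x *m be) (be *m Rk (-1) x) => *.
  by apply/matrixP => p q; rewrite !mxE; ring.
have bus : smooth (fun x => b + u x) by apply: smooth_addmx => //; exact: smooth_cst.
have buo x : in_o (b + u x) by apply: in_oD; [exact: in_o_b | exact: in_V_o].
have R0'o x : in_o (derive1 (Rk 0) x) by exact: in_o_derive1.
have Mo x : in_o (M x).
  have -> : M x = derive1 (Rk 0) x + lie (b + u x) (Rk 0 x) by rewrite R0d subrK.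
  by apply: in_oD => //; exact: in_o_comm.
have Mh x : height 0 (M x) by apply: up; exact: Rstar.
have [eta [es eo eh eV]] := gauge_fix us uV (add0n N) Ms Mo Mh.
pose w x := M x - derive1 eta x - lie (b + u x) (eta x).
pose K x := Rk 0 x - eta x.
have gd : mderiv g (fun x => g x *m (b + u x)).
  have [gi gi'] : (forall x, invmx (g x) *m g x = 1%:M) /\ (forall x, g x *m invmx (g x) = 1%:M).
    have ug x : g x \in unitmx by have [_ /mulmx1_unit[]] := in_O_inv (go x).
    by split => x; [exact: mulVmx | exact: mulmxV].
  suff -> : (fun x => g x *m (b + u x)) = derive1 g by exact: smooth_mderiv.
  by apply/funext => x; rewrite uE /curvature addrC subrK mulmxA gi' mul1mx.
have -> : (fun x => g x *m (spow (Q x) j.+1 0 *m e1)) = (fun x => g x *m (K x *m e1)).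
  apply/funext => x; congr (_ *m _); rewrite RE /K mulmxBl.
  suff -> : eta x *m e1 = 0 by rewrite subr0.
  apply/matrixP => p q; rewrite mxE big1 ?mxE // => i _; rewrite /e1 mxE.
  have [->|i0] := eqVneq i ord0; last by rewrite mulr0.
  by rewrite eh ?mul0r // addn1.
have -> : gamma = (fun x => g x *m e1).
  apply/funext => x; have := gcol 1%N isT x; rewrite derive1n0 => <-.
  by rewrite -colE; congr col; apply/val_inj; rewrite /= inordK.
apply: (@tangent_of_gauge _ _ g u K w) => //.
- apply: smooth_addmx; last by apply: smooth_oppmx; exact: smooth_lie.
  by apply: smooth_addmx => //; apply: smooth_oppmx; exact: smooth_derive1.
- by apply: smooth_addmx => //; exact: smooth_oppmx.
- by apply: in_oD => //; exact: in_oN.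
- have := mderivD (smooth_mderiv (Rs 0)) (mderivN (smooth_mderiv es)).
  rewrite R0d; suff -> : (fun x => w x - ((b + u x) *m K x - K x *m (b + u x))) =
     (fun x => M x - lie (b + u x) (Rk 0 x) - derive1 eta x) by [].
  apply/funext => x; rewrite /w -[X in _ - X]/(lie (b + u x) (K x)) /K.
  have -> : lie (b + u x) (Rk 0 x - eta x) = lie (b + u x) (Rk 0 x) - lie (b + u x) (eta x).
    rewrite lieDr; congr (_ + _); rewrite /lie mulmxN mulNmx opprB opprK addrC.
    by [].
  move: (lie _ (eta x)) (lie _ (Rk 0 x)) => P P'.
  by apply/matrixP => p q; rewrite !mxE; ring.
Qed.
End TangentResolvent.

(** * Differential polynomials and the principal grading *)

Section DP.
Variables (R : realType) (n : nat).
Local Notation N := (2 * n).+1.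
Local Notation Mat := 'M[R]_N.
Local Notation b := (b_ R n).
Local Notation bser := (bser R n).
Local Notation ufun := ((R -> Mat) -> R -> R).

Definition dp (y : ufun) := exists p : dpoly R n, forall u, smooth_V u -> forall x, y u x = deval p u x.

Lemma dp_cst c : dp (fun _ _ => c). Proof. by exists (DConst n c). Qed.
Lemma dp_add y z : dp y -> dp z -> dp (fun u x => y u x + z u x).
Proof. by move=> [p yp] [q zq]; exists (DAdd p q) => u su x /=; rewrite yp // zq. Qed.
Lemma dp_mul y z : dp y -> dp z -> dp (fun u x => y u x * z u x).
Proof. by move=> [p yp] [q zq]; exists (DMul p q) => u su x /=; rewrite yp // zq. Qed.
Lemma dp_ext y z : (forall u, smooth_V u -> forall x, y u x = z u x) -> dp y -> dp z.
Proof. by move=> yz [p yp]; exists p => u su x; rewrite -yz // yp. Qed.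
Lemma dp_sum (I : Type) (r : seq I) (y : I -> ufun) : (forall i, dp (y i)) ->
  dp (fun u x => \sum_(i <- r) y i u x).
Proof.
move=> dy; elim: r => [|i r IH].
  by apply: dp_ext (dp_cst 0) => u _ x; rewrite big_nil.
by apply: dp_ext (dp_add (dy i) IH) => u _ x; rewrite big_cons.
Qed.

Fixpoint dpder (p : dpoly R n) : dpoly R n := match p with
  | DConst c => DConst n 0
  | DVar i j k => DVar R i j k.+1
  | DAdd p q => DAdd (dpder p) (dpder q)
  | DMul p q => DAdd (DMul (dpder p) q) (DMul p (dpder q))
  end.

Lemma dpderP p u : smooth_V u -> forall x, is_derive x (1 : R) (deval p u) (deval (dpder p) u x).
Proof.
move=> [us _]; elim: p => [c|i j k|p IHp q IHq|p IHp q IHq] x /=.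
- exact: is_derive_cst.
- have sk : smooth (derive1n k u).
    by elim: k => [|k IH] //; rewrite derive1nS; exact: smooth_derive1.
  exact: (smooth_mderiv sk x i j).
- exact: is_derive1D.
- exact: is_derive1M.
Qed.

Lemma dp_der y : dp y -> dp (fun u x => derive1 (y u) x).
Proof.
move=> [p yp]; exists (dpder p) => u su x.
have -> : y u = deval p u by apply/funext => t; exact: yp.
by rewrite derive1E; have [_] := dpderP p su x.
Qed.

Section Filtration.
Variable h : nat.
Hypothesis h0 : (0 < h)%N.
Local Notation fam := ((R -> Mat) -> R -> bser).

(** The degree of [e_(i,j) lambda^k]; only the difference of the indices matters,
    so that they may start at 0. *)
Definition deg (i j : 'I_N) (k : int) : int := i%:Z - j%:Z + h%:Z * k.

(** The components of [Y] in degrees [e, e - 1, ..., e - m + 1] are differential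
    polynomials, and those above vanish. Thus [m] is a relative precision, like
    a number of significant digits, and products preserve it. *)
Definition known (e : int) (m : nat) (Y : fam) :=
  (forall u, smooth_V u -> forall x k i j, e < deg i j k -> bval (Y u x) k i j = 0) /\
  (forall k i j, e - m%:Z < deg i j k -> dp (fun u x => bval (Y u x) k i j)).

Lemma known_ext e m Y Z : (forall u, smooth_V u -> forall x, Y u x = Z u x) ->
  known e m Y -> known e m Z.
Proof.
move=> YZ [Y0 Yd]; split=> [u su x k i j d|k i j d].
  by rewrite -YZ // Y0.
by apply: dp_ext (Yd k i j d) => u su x; rewrite YZ.
Qed.

Lemma known_le e m e' m' Y : e <= e' -> e - m%:Z <= e' - m'%:Z -> known e m Y -> known e' m' Y.
Proof.
move=> ee em [Y0 Yd]; split=> [u su x k i j d|k i j d]; first by apply: Y0 => //; apply: le_lt_trans d.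
by apply: Yd; apply: le_lt_trans d.
Qed.

Lemma knownD e m Y Z : known e m Y -> known e m Z -> known e m (fun u x => Y u x + Z u x).
Proof.
move=> [Y0 Yd] [Z0 Zd]; split=> [u su x k i j d|k i j d].
  by rewrite bvalD mxE Y0 // Z0 // addr0.
by apply: dp_ext (dp_add (Yd k i j d) (Zd k i j d)) => u su x; rewrite bvalD mxE.
Qed.

Lemma knownN e m Y : known e m Y -> known e m (fun u x => - Y u x).
Proof.
move=> [Y0 Yd]; split=> [u su x k i j d|k i j d].
  by rewrite bvalN mxE Y0 // oppr0.
by apply: dp_ext (dp_mul (dp_cst (-1)) (Yd k i j d)) => u su x; rewrite bvalN mxE mulN1r.
Qed.

Lemma known_bounded e m Y : known e m Y ->
  exists B, forall u, smooth_V u -> forall x, bounded_by B (Y u x).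
Proof.
move=> [Y0 _]; exists (`|e| + (2 * n)%N%:Z) => u su x k Bk.
apply/matrixP => i j; rewrite mxE Y0 // /deg.
have := ltn_ord i; have := ltn_ord j; move=> jN iN.
have k0 : 0 < k by lia.
have hk : k <= h%:Z * k by nia.
by lia.
Qed.

(** A component of the product of degree larger than [e + f - m] only involves
    components of the factors of degrees larger than [e - m] and [f - m]. *)
Lemma knownM e f m Y Z : known e m Y -> known f m Z -> known (e + f) m (fun u x => Y u x * Z u x).
Proof.
move=> kY kZ; have [B1 bY] := known_bounded kY; have [B2 bZ] := known_bounded kZ.
case: kY kZ => [Y0 Yd] [Z0 Zd].
have big k : B1 + B2 < k -> forall u, smooth_V u -> forall x, bval (Y u x * Z u x) k = 0.
  by move=> Bk u su x; rewrite bvalM (smul_bounded (bY u su x) (bZ u su x)).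
have small (c : nat) u (su : smooth_V u) x i j : bval (Y u x * Z u x) (B1 + B2 - c%:Z) i j =
   \sum_(a < c.+1) \sum_l bval (Y u x) (B1 - a%:Z) i l * bval (Z u x) (B2 - (c - a)%N%:Z) l j.
  rewrite bvalM (smulE c (bY u su x) (bZ u su x)) summxE.
  by apply: eq_bigr => a _; rewrite mxE.
have diag_sum (c : nat) (a : 'I_c.+1) (i l j : 'I_N) : deg i j (B1 + B2 - c%:Z) =
    deg i l (B1 - a%:Z) + deg l j (B2 - (c - a)%N%:Z).
  rewrite /deg; have ac := ltn_ord a.
  have -> : B1 + B2 - c%:Z = (B1 - a%:Z) + (B2 - (c - a)%N%:Z) by lia.
  by rewrite mulrDr; lia.
split=> [u su x k i j d|k i j d]; have [Bk|kB] := ltP (B1 + B2) k.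
- by rewrite big // mxE.
- pose c := absz (B1 + B2 - k)%R; have kE : k = B1 + B2 - c%:Z by lia.
  rewrite kE small // big1 // => a _; rewrite big1 // => l _.
  rewrite kE (diag_sum c a i l j) in d.
  have [d1|d1] := ltP e (deg i l (B1 - a%:Z)); first by rewrite Y0 // mul0r.
  by rewrite (Z0 u su x) ?mulr0 //; lia.
- by apply: dp_ext (dp_cst 0) => u su x; rewrite big // mxE.
- pose c := absz (B1 + B2 - k)%R; have kE : k = B1 + B2 - c%:Z by lia.
  apply: (@dp_ext (fun u x => \sum_(a < c.+1) \sum_l
     bval (Y u x) (B1 - a%:Z) i l * bval (Z u x) (B2 - (c - a)%N%:Z) l j)).
    by move=> u su x; rewrite kE small.
  apply: dp_sum => a; apply: dp_sum => l.
  rewrite kE (diag_sum c a i l j) in d.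
  have [d1|d1] := ltP e (deg i l (B1 - a%:Z)).
    by apply: dp_ext (dp_cst 0) => u su x; rewrite (Y0 u su x) // mul0r.
  have [d2|d2] := ltP f (deg l j (B2 - (c - a)%N%:Z)).
    by apply: dp_ext (dp_cst 0) => u su x; rewrite (Z0 u su x) // mulr0.
  by apply: dp_mul; [apply: Yd | apply: Zd]; lia.
Qed.

Lemma known_cst e m (y : bser) : (forall k i j, e < deg i j k -> bval y k i j = 0) ->
  known e m (fun _ _ => y).
Proof. by move=> y0; split=> [u _ x k i j d|k i j d]; [exact: y0 | exact: dp_cst]. Qed.

Lemma known_mon e m (A : Mat) (p : int) : (forall i j, e < deg i j p -> A i j = 0) ->
  known e m (fun _ _ => bmon A p).
Proof.
move=> A0; apply: known_cst => k i j d; rewrite /= /smonom; case: eqP => [kp|_]; last by rewrite mxE.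
by apply: A0; rewrite -kp.
Qed.

Lemma known_scal m c : known 0 m (fun _ _ => bmon (c%:M) 0).
Proof.
apply: known_mon => i j; rewrite /deg mulr0 addr0 mxE => d.
by case: eqP => [ij|//]; move: d; rewrite ij subrr ltxx.
Qed.

Lemma known_lam m p : known (h%:Z * p) m (fun _ _ => lam R n p).
Proof.
apply: known_mon => i j; rewrite /deg mxE => d.
by case: eqP => [ij|//]; move: d; rewrite ij subrr add0r ltxx.
Qed.

Lemma knownX e m Y j : known e m Y -> known (e *+ j) m (fun u x => Y u x ^+ j).
Proof.
move=> kY; elim: j => [|j IH].
  by apply: known_ext (known_scal m 1) => u _ x; rewrite expr0.
by rewrite mulrS; apply: known_ext (knownM kY IH) => u _ x; rewrite exprS.
Qed.

Lemma known_U m : known (-1) m (fun u x => bmon (u x) 0).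
Proof.
split=> [u [_ uV] x k i j d|k i j d].
  rewrite /= /smonom; case: eqP => [k0'|_]; last by rewrite mxE.
  by apply: in_V_upper => //; move: d; rewrite /deg k0'; lia.
rewrite /= /smonom; case: eqP => [k0'|_].
  by exists (DVar R i j 0) => u su x.
by apply: dp_ext (dp_cst 0) => u su x; rewrite mxE.
Qed.

Section Resolvent.
Variables (be : Mat) (Q : fam).
Let J : bser := bmon b 0 + bmon be 1.
Hypothesis Jdeg : forall k i j, 1 < deg i j k -> bval J k i j = 0.
Hypothesis Qs : forall u, smooth_V u -> forall k, smooth (fun x => bval (Q u x) k).
Hypothesis Qc : forall u, smooth_V u ->
  commutes_with_dx (fun x => bval (J + bmon (u x) 0)) (fun x => bval (Q u x)).
Hypothesis Qd : forall u, smooth_V u -> forall x, degree_le0 h (bval (Q u x - J)).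

Variable X : fam.
Hypothesis XE : forall u x, X u x = Q u x - J.
Let U : fam := fun u x => bmon (u x) 0.
Let Xd : fam := fun u x => Q u x * (J + U u x) - (J + U u x) * Q u x.

Let kJ m : known 1 m (fun _ _ => J). Proof. exact: known_cst. Qed.
Let QE u x : Q u x = J + X u x. Proof. by rewrite XE addrC subrK. Qed.

Lemma known_X0 : known 0 0 X.
Proof.
have X0 u : smooth_V u -> forall x k i j, 0 < deg i j k -> bval (X u x) k i j = 0.
  move=> su x k i j d; apply/eqP; apply: contraT => Xk.
  by rewrite XE in Xk; have := @Qd u su x k i j Xk; rewrite leNgt; rewrite /deg in d; rewrite d.
split=> // k i j; rewrite subr0 => d.
by apply: dp_ext (dp_cst 0) => u su x; rewrite X0.
Qed.

Lemma known_Q m : known 0 m X -> known 1 m Q.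
Proof.
move=> kX; apply: known_ext (fun u _ x => esym (QE u x)) _.
by apply: knownD; [exact: kJ | apply: known_le kX; lia].
Qed.

(** The resolvent equation: the bracket [Xd] of [Q] with [J + u] is the
    derivative of [Q], hence of [X] since [J] is constant. *)
Lemma Xd_E u x k : smooth_V u -> bval (Xd u x) k = derive1 (fun y => bval (Q u y) k) x.
Proof.
move=> su; have := Qc su x k; rewrite /Xd bvalB !bvalM => /eqP.
by rewrite addr_eq0 opprB => /eqP.
Qed.

Lemma Xd_entry u x k i j : smooth_V u ->
  bval (Xd u x) k i j = derive1 (fun y => bval (X u y) k i j) x.
Proof.
move=> su; rewrite Xd_E //; have [dd <-] := smooth_mderiv (Qs su k) x i j.
rewrite derive1E.
have -> : (fun y => bval (X u y) k i j) = (fun y => bval (Q u y) k i j) - cst (bval J k i j).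
  by apply/funext => y; rewrite XE bvalB !mxE.
by rewrite deriveB // derive_cst subr0.
Qed.

Lemma known_Xd m : known 0 m X -> known 0 m Xd.
Proof.
move=> [X0 Xdp]; split=> [u su x k i j d|k i j d].
  rewrite Xd_entry // (_ : (fun y => _) = cst 0) ?derive1_cst //.
  by apply/funext => y; rewrite X0.
by apply: dp_ext (dp_der (Xdp k i j d)) => u su x; rewrite Xd_entry.
Qed.

Let De : fam := fun u x => Q u x * X u x - X u x * J.

(** One has [Q X - X J = lie J X + X^2], and the resolvent equation expresses
    [lie J X] by [X'], [u] and [Q]. The bracket with [J] raises degrees by 1,
    whereas the expression has degree at most 0. This is the gain of one
    component on which the induction in [known_X] rests. *)
Lemma known_De m : known 0 m X -> known 0 m De.
Proof.
move=> kX; have kQ := known_Q kX.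
apply: (@known_ext _ _ (fun u x => ((X u x * X u x - Xd u x) - U u x * Q u x) + Q u x * U u x)).
  move=> u su x; rewrite /De /Xd QE !(mulrDl, mulrDr).
  move: (J * J) (J * X u x) (X u x * J) (X u x * X u x) => a c d e.
  move: (J * U u x) (U u x * J) (X u x * U u x) (U u x * X u x) => f g i j.
  rewrite !opprD; apply: bser_ext => k; rewrite !(bvalD, bvalN).
  by apply/matrixP => p q; rewrite !mxE; ring.
have kUQ : known 0 m (fun u x => U u x * Q u x) by exact: knownM (known_U m) kQ.
have kQU : known 0 m (fun u x => Q u x * U u x) by exact: knownM kQ (known_U m).
apply: knownD => //; apply: knownD; last exact: knownN.
apply: knownD; last by apply: knownN; exact: known_Xd.
by have := knownM kX kX; rewrite addr0.
Qed.

(** Moving [X] through [a] factors costs the commutator of degree [a - 1]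
    instead of [a]. *)
Lemma known_T m a : known 0 m X -> known (a%:Z - 1) m (fun u x => Q u x ^+ a * X u x - X u x * J ^+ a).
Proof.
move=> kX; have kQ := known_Q kX; have kD := known_De kX.
elim: a => [|a IH].
  apply: (@known_ext _ _ (fun _ _ => 0)).
    by move=> u su x; rewrite !expr0 mul1r mulr1 subrr.
  by apply: known_cst => k i j _; rewrite mxE.
apply: (@known_ext _ _ (fun u x => Q u x ^+ a * De u x + (Q u x ^+ a * X u x - X u x * J ^+ a) * J)).
  move=> u su x; rewrite /De mulrBr mulrBl !mulrA -exprSr -[X u x * J ^+ a * J]mulrA -exprSr.
  by rewrite addrA subrK.
have ka : (a.+1%:Z - 1 = 1 *+ a + 0 :> int) by lia.
have ka' : (a.+1%:Z - 1 = (a%:Z - 1) + 1 :> int) by lia.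
apply: knownD; first by rewrite ka; apply: knownM => //; exact: knownX.
by rewrite ka'; apply: knownM => //; exact: kJ.
Qed.

(** Up to one degree, [X] may be treated as commuting with [J] and [Q], so the
    difference of the powers is governed by the derivative of [z^(k+1)]. *)
Lemma known_power m k : known 0 m X -> exists2 E : fam, known (k%:Z - 1) m E &
  forall u x, Q u x ^+ k.+1 - J ^+ k.+1 = (X u x * J ^+ k) *+ k.+1 + E u x.
Proof.
move=> kX; elim: k => [|k [E kE EE]].
  exists (fun _ _ => 0); first by apply: known_cst => k i j _; rewrite mxE.
  by move=> u x; rewrite !expr1 expr0 mulr1 mulr1n addr0.
exists (fun u x => (Q u x ^+ k.+1 * X u x - X u x * J ^+ k.+1) + E u x * J).
  have ka' : (k.+1%:Z - 1 = (k%:Z - 1) + 1 :> int) by lia.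
  apply: knownD; first exact: known_T.
  by rewrite ka'; apply: knownM => //; exact: kJ.
move=> u x.
have -> : Q u x ^+ k.+2 - J ^+ k.+2 = Q u x ^+ k.+1 * X u x + (Q u x ^+ k.+1 - J ^+ k.+1) * J.
  by rewrite XE mulrBr mulrBl -!exprSr addrA subrK.
rewrite EE mulrDl mulrnAl -mulrA -exprSr [LHS]addrA [RHS]addrA; congr (_ + _).
by rewrite [in RHS]mulrS [RHS]addrC addrA subrK.
Qed.

Section Conclusion.
Variables (c K : bser).
Hypothesis Hrel : forall u, smooth_V u -> forall x, Q u x ^+ N - J ^+ N = X u x * c.
Hypothesis HK : (J ^+ (2 * n) *+ N - c) * K = 1.
Hypothesis kK : forall m, known (- (2 * n)%N%:Z) m (fun _ _ => K).

(** Here [J] and [Q] are roots of [f(z) = z^N - c z] or of [z^N - lambda] with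
    [c = 0], so that the factor inverted by [K] is [f'(J)]. The relation
    [X f'(J) = - E] with the error term [E] of [known_power] determines one more
    component of [X]. *)
Lemma known_X m : known 0 m X.
Proof.
elim: m => [|m kX]; first exact: known_X0.
have [E kE EE] := known_power (2 * n) kX.
have kEK := knownM (knownN kE) (kK m).
have kX' := known_le (e' := 0) (m' := m.+1) _ _ kEK.
apply: known_ext (kX' _ _) => [u su x||]; try lia.
rewrite -[RHS]mulr1 -HK mulrA; congr (_ * K).
have := EE u x; rewrite (Hrel su) mulrBr mulrnAr => ->.
by rewrite opprD addNKr.
Qed.

Lemma diffpoly_of_relation (P : (R -> Mat) -> R -> lseries R n) j :
  (forall u, smooth_V u -> forall x, bval (Q u x) = P u x) ->
  differential_polynomial (fun u x => spow (P u x) j 0 *m e1).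
Proof.
move=> QP.
have dpe i : dp (fun u x => (spow (P u x) j 0 *m e1 : vec R n) i 0).
  have [_ Qdp] := knownX j (known_Q (known_X j.+1)).
  apply: (dp_ext _ (Qdp 0 i ord0 _)).
    move=> u su x; rewrite bvalX QP // /e1 -colE mxE.
    by congr (spow _ _ _ _ _).
  by rewrite /deg /= mulr0 addr0 subr0; lia.
exists (fun i => sval (cid (dpe i))) => u su x.
apply/matrixP => i k; rewrite ord1 {k} [RHS]mxE.
exact: (svalP (cid (dpe i)) u su x).
Qed.

End Conclusion.
End Resolvent.
End Filtration.
End DP.

(** * The elements [J] of both types *)

Section Concrete.
Variables (R : realType) (n : nat).
Hypothesis hn : (1 <= n)%N.
Local Notation N := (2 * n).+1.
Local Notation Mat := 'M[R]_N.
Local Notation C := (C_ R n).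
Local Notation b := (b_ R n).
Local Notation bser := (bser R n).

(** The vector [e_(k+1)], as the first column of a matrix, so that it lives in the
    ring of series. *)
Definition unitcol (k : nat) : bser := bmon (delta_mx (inord k) ord0) 0.

Lemma mul_deltaE (A : Mat) l i j :
  (A *m (delta_mx l ord0 : Mat)) i j = A i l * (j == ord0)%:R.
Proof.
rewrite mxE (bigD1 l) //= big1 ?addr0 => [|k kl]; first by rewrite mxE eqxx.
by rewrite mxE (negbTE kl) mulr0.
Qed.

Lemma bser_cols0 (x : bser) : (forall k, (k <= 2 * n)%N -> x * unitcol k = 0) -> x = 0.
Proof.
move=> x0; apply: bser_ext => k; apply/matrixP => i j.
have := congr1 (fun y : bser => bval y k i ord0) (x0 j _).
rewrite -ltnS => /(_ (ltn_ord j)); rewrite bvalM smul_monr subr0 inord_val mul_deltaE eqxx mulr1 => ->.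
by rewrite !mxE.
Qed.

Lemma b_col k : (k <= 2 * n)%N -> b *m (delta_mx (inord k) ord0 : Mat) =
  if (k < 2 * n)%N then delta_mx (inord k.+1) ord0 else 0.
Proof.
move=> kn; apply/matrixP => i j; rewrite mul_deltaE b_E inordK //.
case: ifP => kn'; rewrite mxE.
  have -> : (i == inord k.+1) = (i == k.+1 :> nat) by rewrite -val_eqE /= inordK.
  by rewrite -natrM mulnb.
by rewrite (_ : (i == k.+1 :> nat) = false) ?mul0r //; have := ltn_ord i; lia.
Qed.

Lemma e_col p q k : (0 < p <= N)%N -> (0 < q <= N)%N -> (k <= 2 * n)%N ->
  e_ R n p q *m (delta_mx (inord k) ord0 : Mat) =
  if k.+1 == q then delta_mx (inord p.-1) ord0 else 0.
Proof.
move=> pN qN kn; apply/matrixP => i j; rewrite mul_deltaE e_E // inordK //.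
case: (k.+1 =P q) => kq; last by rewrite andbF mul0r mxE.
rewrite andbT mxE -natrM mulnb.
have -> : (i == inord p.-1) = (i.+1 == p); last by [].
by rewrite -val_eqE /= inordK; lia.
Qed.

Definition JserA : bser := bmon b 0 + bmon (e_ R n 1 (2 * n + 1)) 1.
Definition JserB : bser := bmon b 0 + bmon (2^-1 *: (e_ R n 1 (2 * n) + e_ R n 2 (2 * n + 1))) 1.
Definition half : bser := bmon ((2^-1)%:M) 0.

Lemma halfC (x : bser) : half * x = x * half.
Proof.
apply: bser_ext => k; rewrite !bvalM smul_monl smul_monr !subr0.
by rewrite mul_scalar_mx mul_mx_scalar.
Qed.

Lemma half2 : half + half = 1.
Proof.
rewrite /half bmonD -raddfD /=; congr (bmon _ 0); congr (_%:M); lra.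
Qed.

Lemma JA_col k : (k <= 2 * n)%N -> JserA * unitcol k =
  if (k < 2 * n)%N then unitcol k.+1 else lam R n 1 * unitcol 0.
Proof.
move=> kn; rewrite /JserA mulrDl !bmonM b_col // e_col //; try lia.
case: ifP => kn'.
  by rewrite (_ : (k.+1 == (2 * n + 1)%N) = false) ?bmon0 ?addr0 //; lia.
rewrite (_ : (k.+1 == (2 * n + 1)%N)); last by lia.
by rewrite bmon0 add0r mul1mx.
Qed.

Lemma JA_colX k : (k <= 2 * n)%N -> JserA ^+ k * unitcol 0 = unitcol k.
Proof.
elim: k => [|k IH] kn; first by rewrite expr0 mul1r.
by rewrite exprS -mulrA IH ?JA_col ?kn //; lia.
Qed.

(** The vector [e_1] is cyclic: [J^k e_1 = e_(k+1)] for [k <= 2n], and the next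
    power maps [e_1] to [lambda e_1]. An element that commutes with [J] and
    kills [e_1] is zero. *)
Lemma JA_power : JserA ^+ N = lam R n 1.
Proof.
apply/eqP; rewrite -subr_eq0; apply/eqP; apply: bser_cols0 => k kn.
have z : (JserA ^+ N - lam R n 1) * unitcol 0 = 0.
  by rewrite mulrBl exprS -mulrA JA_colX // JA_col // ltnn subrr.
by rewrite -JA_colX // mulrA mulrBl -exprD addnC exprD lamC -mulrBr -mulrA z mulr0.
Qed.

Lemma JB_col k : (k <= 2 * n)%N -> JserB * unitcol k =
  if (k < (2 * n).-1)%N then unitcol k.+1 else
  if (k < 2 * n)%N then unitcol k.+1 + half * lam R n 1 * unitcol 0
  else half * lam R n 1 * unitcol 1.
Proof.
move=> kn.
have hl m : half * lam R n 1 * unitcol m = bmon (2^-1 *: delta_mx (inord m) ord0) 1.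
  by rewrite /half /lam /unitcol !bmonM mulmx1 mul_scalar_mx.
rewrite !hl /JserB mulrDl /unitcol !bmonM b_col // -scalemxAl mulmxDl !e_col //; try lia.
case: (ltnP k (2 * n).-1) => kn1.
  rewrite (_ : (k.+1 == (2 * n)%N) = false); last by lia.
  rewrite (_ : (k.+1 == (2 * n + 1)%N) = false); last by lia.
  by rewrite ifT ?addr0 ?scaler0 ?bmon0 ?addr0 //; lia.
case: (ltnP k (2 * n)) => kn2.
  rewrite (_ : (k.+1 == (2 * n)%N)); last by lia.
  by rewrite (_ : (k.+1 == (2 * n + 1)%N) = false) ?addr0 //; lia.
rewrite (_ : (k.+1 == (2 * n)%N) = false); last by lia.
rewrite (_ : (k.+1 == (2 * n + 1)%N)); last by lia.
by rewrite bmon0 !add0r.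
Qed.

Lemma JB_colX k : (k < 2 * n)%N -> JserB ^+ k * unitcol 0 = unitcol k.
Proof.
elim: k => [|k IH] kn; first by rewrite expr0 mul1r.
by rewrite exprS -mulrA IH ?JB_col ?ifT //; lia.
Qed.

(** The vector [e_1] is cyclic again, with
    [J^(2n) e_1 = e_(2n+1) + (lambda/2) e_1]. Applying [J] gives twice
    [(lambda/2) e_2], that is, [lambda J e_1]. *)
Lemma JB_power : JserB ^+ N = lam R n 1 * JserB.
Proof.
apply/eqP; rewrite -subr_eq0; apply/eqP.
have top : JserB ^+ (2 * n) * unitcol 0 = unitcol (2 * n) + half * lam R n 1 * unitcol 0.
  have -> : (2 * n = (2 * n).-1.+1)%N by lia.
  rewrite exprS -mulrA JB_colX; last by lia.
  rewrite JB_col; last by lia.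
  by rewrite ltnn ifT //; lia.
have c1 : JserB * unitcol 0 = unitcol 1 by rewrite JB_col // ifT //; lia.
set f := JserB ^+ N - _.
have fC k : f * JserB ^+ k = JserB ^+ k * f.
  rewrite /f mulrBl mulrBr -!exprD addnC !mulrA -[lam R n 1 * _ * _]mulrA -exprS.
  by rewrite lamC -[in RHS]lamC -mulrA -exprSr exprS -lamC mulrA.
have z : f * unitcol 0 = 0.
  rewrite /f mulrBl exprS -[JserB * _ * _]mulrA top mulrDr JB_col // ltnn ifF; last by lia.
  have -> : JserB * (half * lam R n 1 * unitcol 0) = half * lam R n 1 * unitcol 1.
    rewrite !mulrA -halfC -[half * JserB * _]mulrA -lamC.
    by rewrite -!mulrA c1.
  by rewrite -!mulrDl half2 mul1r -mulrA c1 subrr.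
apply: bser_cols0 => k kn.
have [kn'|kn'] := ltnP k (2 * n); first by rewrite -JB_colX // mulrA fC -mulrA z mulr0.
have -> : k = (2 * n)%N by lia.
have -> : unitcol (2 * n) = JserB ^+ (2 * n) * unitcol 0 - half * lam R n 1 * unitcol 0.
  by rewrite top addrK.
rewrite mulrBr [f * (JserB ^+ _ * _)]mulrA fC -[_ * f * _]mulrA z mulr0 sub0r.
rewrite !mulrA -halfC -[half * f * _]mulrA -lamC.
by rewrite -!mulrA z !mulr0 oppr0.
Qed.

Lemma JA_deg k i j : 1 < deg (2 * n + 1) i j k -> bval JserA k i j = 0.
Proof.
rewrite /deg => d; rewrite bvalD mxE /= /smonom.
have iN := ltn_ord i; have jN := ltn_ord j.
have -> : (if k == 0 then b else 0) i j = 0.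
  case: eqP => [k0|_]; last by rewrite mxE.
  by rewrite b_E (_ : (i == j.+1 :> nat) = false) //; move: d; rewrite k0; lia.
rewrite add0r; case: eqP => [k1|_]; last by rewrite mxE.
rewrite e_E //; try lia.
by rewrite (_ : (i.+1 == 1)%N && (j.+1 == (2 * n + 1)%N) = false) //; move: d; rewrite k1; lia.
Qed.

Lemma JB_deg k i j : 1 < deg (2 * n) i j k -> bval JserB k i j = 0.
Proof.
rewrite /deg => d; rewrite bvalD mxE /= /smonom.
have iN := ltn_ord i; have jN := ltn_ord j.
have -> : (if k == 0 then b else 0) i j = 0.
  case: eqP => [k0|_]; last by rewrite mxE.
  by rewrite b_E (_ : (i == j.+1 :> nat) = false) //; move: d; rewrite k0; lia.
rewrite add0r; case: eqP => [k1|_]; last by rewrite mxE.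
rewrite mxE mxE !e_E //; try lia.
rewrite (_ : (i.+1 == 1)%N && (j.+1 == (2 * n)%N) = false); last by move: d; rewrite k1; lia.
rewrite (_ : (i.+1 == 2)%N && (j.+1 == (2 * n + 1)%N) = false); last by move: d; rewrite k1; lia.
by rewrite addr0 mulr0.
Qed.

Lemma conj_power (q J : bser) (T T' : lseries R n) k :
  bounded_degree T -> bounded_degree T' -> smul T T' = sone R n -> smul T' T = sone R n ->
  bval q = smul (smul T J) T' ->
  exists t t' : bser, [/\ t * t' = 1, q = t * J * t' & q ^+ k = t * J ^+ k * t'].
Proof.
move=> bT bT' TT' T'T qE; pose t := Bser bT; pose t' := Bser bT'.
have tt' : t * t' = 1 by apply: bser_ext => l; rewrite bvalM TT'.
have t't : t' * t = 1 by apply: bser_ext => l; rewrite bvalM T'T.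
have qE' : q = t * J * t' by apply: bser_ext => l; rewrite !bvalM qE.
exists t, t'; split=> //; elim: k => [|k IH]; first by rewrite !expr0 mulr1 tt'.
by rewrite exprS IH {1}qE' exprS !mulrA -[_ * t' * t]mulrA t't mulr1.
Qed.

Definition scal (c : R) : bser := bmon (c%:M) 0.

Lemma bval_mulrn (x : bser) m k : bval (x *+ m) k = bval x k *+ m.
Proof. by elim: m => [|m IH]; rewrite ?mulr0n // !mulrS bvalD IH. Qed.

Lemma scalE c (x : bser) k : bval (scal c * x) k = c *: bval x k.
Proof. by rewrite bvalM smul_monl subr0 mul_scalar_mx. Qed.

Lemma scalC c (x : bser) : scal c * x = x * scal c.
Proof.
by apply: bser_ext => k; rewrite scalE bvalM smul_monr subr0 mul_mx_scalar.
Qed.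

End Concrete.

Section Inverses.
Variables (R : realType) (n : nat).
Hypothesis hn : (1 <= n)%N.
Local Notation N := (2 * n).+1.
Local Notation bser := (bser R n).
Local Notation JA := (JserA R n).
Local Notation JB := (JserB R n).

Lemma scal_mulrn (x : bser) m : x *+ m = scal n m%:R * x.
Proof. by apply: bser_ext => k; rewrite scalE scaler_nat bval_mulrn. Qed.

Lemma scal1 : scal n 1 = 1 :> bser. Proof. by []. Qed.

Lemma scalM (c d : R) : scal n c * scal n d = scal n (c * d).
Proof. by rewrite /scal bmonM -scalar_mxM. Qed.

(** The inverse of the derivative [N J^(2n)] of [z^N - lambda] at [J]: by
    [J^N = lambda] it is [J / (N lambda)]. *)
Definition dJA_inv : bser := scal n (N%:R^-1) * lam R n (-1) * JA.

Lemma dJA_invP : (JA ^+ (2 * n) *+ N - 0) * dJA_inv = 1.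
Proof.
rewrite subr0 scal_mulrn /dJA_inv -mulrA.
have -> : JA ^+ (2 * n) * (scal n N%:R^-1 * lam R n (-1) * JA) =
   scal n N%:R^-1 * lam R n (-1) * JA ^+ N.
  by rewrite exprSr !mulrA; congr (_ * _); rewrite -scalC -!mulrA lamC.
rewrite JA_power // -mulrA lamM mulrA scalM divff ?pnatr_eq0 //.
by rewrite scal1 mul1r.
Qed.

Lemma JB_idem : JB ^+ (2 * n) * JB ^+ (2 * n) = lam R n 1 * JB ^+ (2 * n).
Proof.
have -> : JB ^+ (2 * n) * JB ^+ (2 * n) = JB ^+ N * JB ^+ (2 * n).-1.
  by rewrite -!exprD; congr (_ ^+ _); lia.
by rewrite JB_power // -mulrA -exprS prednK //; lia.
Qed.

(** The inverse of the derivative [N J^(2n) - lambda] of [z^N - lambda z] at [J].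
    On the image of the idempotent [J^(2n) / lambda] the derivative is
    [2n lambda], on its kernel [- lambda]. *)
Definition dJB_inv : bser := lam R n (-1) *
  (scal n (N%:R / (2 * n)%:R) * (lam R n (-1) * JB ^+ (2 * n)) - 1).

Lemma dJB_invP : (JB ^+ (2 * n) *+ N - lam R n 1) * dJB_inv = 1.
Proof.
set a := lam R n (-1) * JB ^+ (2 * n); set s : R := N%:R / (2 * n)%:R.
have l1 : lam R n 1 * lam R n (-1) = 1 by rewrite lamM subrr.
have aE : JB ^+ (2 * n) = lam R n 1 * a by rewrite /a mulrA l1 mul1r.
have aa : a * a = a.
  rewrite /a mulrA -[_ * JB ^+ _ * lam R n (-1)]mulrA -lamC -!mulrA JB_idem.
  by rewrite [lam R n (-1) * (lam R n 1 * _)]mulrA lamM addNr -/(1 : bser) mul1r.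
rewrite /dJB_inv -/a -/s aE; clearbody a.
have -> : lam R n 1 * a *+ N - lam R n 1 = (a *+ N - 1) * lam R n 1.
  by rewrite mulrBl mul1r -lamC mulrnAr.
rewrite mulrA -[_ * lam R n 1 * lam R n (-1)]mulrA l1 mulr1 scal_mulrn.
rewrite mulrBr mulr1 mulrBl mul1r.
have -> : scal n N%:R * a * (scal n s * a) = scal n (N%:R * s) * a.
  by rewrite mulrA -[scal n N%:R * a * scal n s]mulrA -scalC mulrA scalM -mulrA aa.
apply: bser_ext => k; rewrite !(bvalD, bvalN, scalE).
apply/matrixP => i j; rewrite !mxE.
have n0 : (2 * n)%:R != 0 :> R by rewrite pnatr_eq0; lia.
have sE : N%:R * s - s - N%:R = 0.
  rewrite /s -addn1 natrD; move: ((2 * n)%:R : R) n0 => t t0.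
  by field.
rewrite [LHS](_ : _ = (N%:R * s - s - N%:R) * bval a k i j + bval (1 : bser) k i j).
  by rewrite sE mul0r add0r.
by ring.
Qed.

Lemma dJA_inv_known m : known (2 * n + 1) (- (2 * n)%N%:Z) m (fun _ _ => dJA_inv).
Proof.
have h0 : (0 < 2 * n + 1)%N by rewrite addn1.
have := knownM h0 (knownM h0 (known_scal n (2 * n + 1) m N%:R^-1) (known_lam R n (2 * n + 1) m (-1)))
  (known_cst m (@JA_deg R n hn)).
have -> : 0 + (2 * n + 1)%N%:Z * -1 + 1 = - (2 * n)%N%:Z :> int by lia.
exact.
Qed.

Lemma dJB_inv_known m : known (2 * n) (- (2 * n)%N%:Z) m (fun _ _ => dJB_inv).
Proof.
have h0 : (0 < 2 * n)%N by lia.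
have kl := known_lam R n (2 * n) m (-1).
have kJ := knownX h0 (2 * n) (known_cst m (@JB_deg R n hn)).
have k1 := knownM h0 (known_scal n (2 * n) m (N%:R / (2 * n)%:R)) (knownM h0 kl kJ).
have e1 : 0 + ((2 * n)%N%:Z * -1 + 1 *+ (2 * n)) = 0 :> int by lia.
rewrite e1 in k1.
have := knownM h0 kl (knownD k1 (knownN (known_scal n (2 * n) m (1 : R)))).
have -> : (2 * n)%N%:Z * -1 + 0 = - (2 * n)%N%:Z :> int by lia.
exact.
Qed.

End Inverses.

Section Final.
Variables (R : realType) (n : nat).
Hypothesis hn : (1 <= n)%N.
Local Notation N := (2 * n).+1.
Local Notation Mat := 'M[R]_N.
Local Notation C := (C_ R n).
Local Notation bser := (bser R n).

(** The matrix [be] has nonzero entries only in rows 1, 2 and columns 2n, 2n+1.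
    Thus the only entries of its bracket with [A] below the diagonal are
    multiples of the corner [A_(2n+1,1)], which vanishes for [A] in the
    orthogonal Lie algebra. *)
Lemma tangent_P (gamma : R -> vec R n) g (Q : R -> lseries R n) j : odd j ->
  moving_frame gamma g -> is_P (curvature g) Q ->
  tangent gamma (fun x => g x *m (spow (Q x) j 0 *m e1)).
Proof.
move=> oj mf [QB Qs Qc _ Qd].
have h0 : (0 < 2 * n)%N by lia.
apply: (@tangent_of_resolvent R n (2^-1 *: (e_ R n 1 (2 * n) + e_ R n 2 (2 * n + 1))) 1 (2 * n)
  (oner_neq0 _) h0) => //.
- move=> x k; rewrite exp1rz scale1r; have /theta_o := (QB x).2 k.
  by rewrite /theta => h; rewrite -[in RHS]h opprK.
- move=> A; rewrite exp1rz scale1r => hA.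
  have oA : in_o A by apply/theta_o; rewrite /theta hA opprK.
  have corner (p q : 'I_N) : p = (2 * n)%N :> nat -> q = 0%N :> nat -> A p q = 0.
    move=> p2 q0; have /in_oP/(_ q q) := oA; rewrite q0 expr0 !mul1r.
    have -> : rev_ord q = p by apply/val_inj; rewrite /= q0 p2; lia.
    by move=> h; lra.
  move=> i k; rewrite addn0 => ki; rewrite mxBE -scalemxAr -scalemxAl !mxE.
  have iN := ltn_ord i; have kN := ltn_ord k.
  rewrite !big1 ?mulr0 ?subrr // => l _.
    have lN := ltn_ord l; rewrite mxE !e_E; try lia.
    have [i1|i1] := eqVneq (i : nat) 1%N; last first.
      rewrite (_ : (i.+1 == 1)%N = false) 1?(_ : (i.+1 == 2)%N = false) ?addr0 ?mul0r //; lia.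
    rewrite (_ : (i.+1 == 1)%N = false) ?add0r //=; last by lia.
    have [l1|l1] := eqVneq (l : nat) (2 * n)%N; first by rewrite (corner l k) ?mulr0 //; lia.
    by rewrite (_ : (l.+1 == (2 * n + 1)%N) = false) ?andbF ?mul0r //; lia.
  have lN := ltn_ord l; rewrite mxE !e_E; try lia.
  have [k1|k1] := eqVneq (k : nat) (2 * n).-1%N; last first.
    rewrite (_ : (k.+1 == (2 * n)%N) = false) 1?(_ : (k.+1 == (2 * n + 1)%N) = false)
      ?andbF ?addr0 ?mulr0 //; lia.
  rewrite (_ : (k.+1 == (2 * n + 1)%N) = false) ?andbF ?addr0 //; last by lia.
  have [l1|l1] := eqVneq (l : nat) 0%N; first by rewrite (corner i l) ?mul0r //; lia.
  by rewrite (_ : (l.+1 == 1)%N = false) ?mulr0 //; lia.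
Qed.

(** A bracket with the upper right corner matrix is supported in the first row and
    the last column. *)
Lemma tangent_S (gamma : R -> vec R n) g (Q : R -> lseries R n) j : odd j ->
  moving_frame gamma g -> is_S (curvature g) Q ->
  tangent gamma (fun x => g x *m (spow (Q x) j 0 *m e1)).
Proof.
move=> oj mf [QA Qs Qc _ Qd].
have h0 : (0 < 2 * n + 1)%N by lia.
have s0 : (-1 : R) != 0 by rewrite oppr_eq0 oner_neq0.
apply: (@tangent_of_resolvent R n (e_ R n 1 (2 * n + 1)) (-1) (2 * n + 1) s0 h0) => //.
- move=> x k; have [_ /(_ k) [_ h]] := QA x.
  apply/eqP; rewrite -addr_eq0; apply/eqP; rewrite -[RHS]h; congr (_ + _).
  rewrite (_ : ((-1) ^ k *: Q x k)^T = (-1) ^ k *: (Q x k)^T); last by apply/matrixP => p q; rewrite !mxE.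
  by rewrite -scalemxAr -scalemxAl.
- move=> A _ i k; rewrite addn0 => ki; rewrite mxBE !mxE.
  have iN := ltn_ord i; have kN := ltn_ord k.
  rewrite !big1 ?subrr // => l _; have lN := ltn_ord l; rewrite e_E; try lia.
    by rewrite (_ : (i.+1 == 1)%N = false) ?mul0r //; lia.
  by rewrite (_ : (k.+1 == (2 * n + 1)%N) = false) ?andbF ?mulr0 //; lia.
Qed.

(** The value 0 is a default for series of unbounded degree. *)
Definition bser_of (x : lseries R n) : bser :=
  if pselect (bounded_degree x) is left bx then Bser bx else 0.

Lemma bser_ofE x : bounded_degree x -> bval (bser_of x) = x.
Proof. by rewrite /bser_of; case: pselect. Qed.

Section Flow.
Variables (L : lseries R n -> Prop) (be : Mat) (c K : bser) (h : nat).
Let J : bser := bmon (b_ R n) 0 + bmon be 1.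
Hypothesis LB : forall x, L x -> bounded_degree x.
Hypothesis h0 : (0 < h)%N.
Hypothesis Jdeg : forall k i j, 1 < deg h i j k -> bval J k i j = 0.
Hypothesis Jpow : forall (q t t' : bser), t * t' = 1 -> q = t * J * t' ->
  t * J ^+ N * t' - J ^+ N = (q - J) * c.
Hypothesis HK : (J ^+ (2 * n) *+ N - c) * K = 1.
Hypothesis kK : forall m, known h (- (2 * n)%N%:Z) m (fun _ _ => K).

Lemma diffpoly_resolvent (P : (R -> mat R n) -> R -> lseries R n) j :
  (forall u, smooth_V u -> resolvent L (bval J) h u (P u)) ->
  differential_polynomial (fun u x => spow (P u x) j 0 *m e1).
Proof.
move=> HP; pose Q u x := bser_of (P u x).
have QP u : smooth_V u -> P u = (fun x => bval (Q u x)).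
  move=> su; apply/funext => x; have [QB _ _ _ _] := HP u su.
  by rewrite bser_ofE //; exact/LB/QB.
apply: (@diffpoly_of_relation R n h h0 _ Q Jdeg _ _ _ (fun u x => Q u x - J) _ c K _ HK kK) => //.
- by move=> u su k; have [_ Qs _ _ _] := HP u su; rewrite QP // in Qs; exact: Qs.
- by move=> u su; have [_ _ Qc _ _] := HP u su; rewrite QP // in Qc.
- by move=> u su; have [_ _ _ _ Qd] := HP u su; rewrite QP // in Qd.
- move=> u su x; have [_ _ _ Ql _] := HP u su; rewrite QP // in Ql.
  have [T [T' [bT bT' TT' T'T e]]] := Ql x.
  have [t [t' [tt' qE ->]]] := conj_power (q := Q u x) (J := J) N bT bT' TT' T'T e.
  exact: Jpow.
- by move=> u su x; rewrite QP.
Qed.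
End Flow.

Lemma diffpoly_P (P : (R -> mat R n) -> R -> lseries R n) j :
  (forall u, smooth_V u -> is_P u (P u)) ->
  differential_polynomial (fun u x => spow (P u x) j 0 *m e1).
Proof.
have h0 : (0 < 2 * n)%N by lia.
apply: (diffpoly_resolvent (L := @in_B R n) _ h0 (@JB_deg R n hn) _ (dJB_invP R hn) (dJB_inv_known R hn)).
- by move=> x [].
- move=> q t t' tt' qE; rewrite -/(JserB R n) (JB_power R hn) mulrBl qE -!lamC -/(JserB R n).
  by congr (_ - _); rewrite !mulrA -lamC.
Qed.

Lemma diffpoly_S (P : (R -> mat R n) -> R -> lseries R n) j :
  (forall u, smooth_V u -> is_S u (P u)) ->
  differential_polynomial (fun u x => spow (P u x) j 0 *m e1).
Proof.
have h0 : (0 < 2 * n + 1)%N by lia.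
apply: (diffpoly_resolvent (L := @in_A R n) _ h0 (@JA_deg R n hn) _ (dJA_invP R hn) (dJA_inv_known R hn)).
- by move=> x [].
- move=> q t t' tt' _; rewrite -/(JserA R n) (JA_power R hn) mulr0.
  by rewrite -lamC -mulrA tt' mulr1 subrr.
Qed.

End Final.

Theorem proposition5p1 (R : realType) (n : nat) (hn : (1 <= n)%N)
    (j : nat) (hj : (1 <= j)%N) :
  ((forall gamma g (Q : R -> lseries R n),
      in_M gamma -> moving_frame gamma g -> is_P (curvature g) Q ->
      tangent gamma
        (fun x => g x *m (spow (Q x) (2 * j - 1) 0 *m e1))) /\
   (forall P : (R -> mat R n) -> R -> lseries R n,
      (forall u, smooth_V u -> is_P u (P u)) ->
      isotropic_curve_flow
        (fun u x => spow (P u x) (2 * j - 1) 0 *m e1)))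
  /\
  (2 * j - 1 <> 0 %[mod 2 * n + 1] ->
   (forall gamma g (Q : R -> lseries R n),
      in_M gamma -> moving_frame gamma g -> is_S (curvature g) Q ->
      tangent gamma
        (fun x => g x *m (spow (Q x) (2 * j - 1) 0 *m e1))) /\
   (forall S : (R -> mat R n) -> R -> lseries R n,
      (forall u, smooth_V u -> is_S u (S u)) ->
      isotropic_curve_flow
        (fun u x => spow (S u x) (2 * j - 1) 0 *m e1))).
Proof.
have oj : odd (2 * j - 1) by lia.
split; [|move=> _]; split.
- by move=> gamma g Q _ mf QP; exact: tangent_P.
- move=> P HP; split; first exact: diffpoly_P.
  by move=> gamma g _ mf; apply: tangent_P => //; apply: HP; case: mf.
- by move=> gamma g Q _ mf QS; exact: tangent_S.
- move=> S HS; split; first exact: diffpoly_S.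
  by move=> gamma g _ mf; apply: tangent_S => //; apply: HS; case: mf.
Qed.
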